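(* Let $n\ge 1$, let $z_1,\dots,z_n\in\mathbb C$ be pairwise distinct, $z_{n+1}=\infty$, $U(z)=\mathbb P^1\setminus\{z_1,\dots,z_{n+1}\}$. Let $M^1,\dots,M^n,k\in\mathbb C$ with $k\ne -2$, put $\kappa=k+2$ and $M^{n+1}=M^1+\dots+M^n-2$, and let $V_i=V(M^i,k-M^i)$ be the Verma module over $\widehat{\mathfrak{sl}}_2$ with generating vector $v_i$ and $V_i^*$ its contragradient dual ($1\le i\le n+1$). Define linear maps $$\eta^1:\Omega^1(U(z))\to\bigotimes_{i=1}^{n+1}V_i^*,\qquad \eta^0:\Omega^0(U(z))\to \mathfrak{sl}_2(U(z))\otimes\bigotimes_{i=1}^{n+1}V_i^*$$ on the bases of elementary forms and elementary functions as follows. For $b\ge 0$ and $1\le m\le n$, $$\eta^1\Big(\frac{d(t-z_m)}{(t-z_m)^{b+1}}\Big)=-\kappa\, v_1^*\otimes\dots\otimes\Big(\frac{f}{T^b}v_m\Big)^*\otimes\dots\otimes v_{n+1}^*,$$ $$\eta^1(t^b\,dt)=\kappa\, v_1^*\otimes\dots\otimes v_n^*\otimes\Big(\frac{e}{T^{b+1}}v_{n+1}\Big)^*.$$ For $b\ge1$ and $1\le m\le n$, $$\eta^0\Big(\frac1{(t-z_m)^b}\Big)=\frac{f}{(t-z_m)^b}\otimes v_1^*\otimes\dots\otimes v_{n+1}^*-\sum_{l=1}^b\Big[\frac{e}{(t-z_m)^l}\otimes v_1^*\otimes\dots\otimes 2\!\!\sum_{i+j=b-l,\ i\ge j\ge0}\!\!\Big(\frac{f}{T^i}\frac{f}{T^j}v_m\Big)^*\otimes\dots\otimes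 v_{n+1}^*$$ $$\qquad+\frac{h}{(t-z_m)^l}\otimes v_1^*\otimes\dots\otimes\Big(\frac{f}{T^{b-l}}v_m\Big)^*\otimes\dots\otimes v_{n+1}^*\Big]$$ (the modified factor always being in the $m$-th position). Finally $\eta^0(1)=f\otimes v_1^*\otimes\dots\otimes v_{n+1}^*$, $\eta^0(t)=ft\otimes v_1^*\otimes\dots\otimes v_{n+1}^*$, and for $b\ge2$ $$\eta^0(t^b)=ft^b\otimes v_1^*\otimes\dots\otimes v_{n+1}^*-\sum_{l=0}^{b-2}\Big[et^l\otimes v_1^*\otimes\dots\otimes v_n^*\otimes 2\!\!\sum_{i+j=b-l,\ i\ge j\ge1}\!\!\Big(\frac{e}{T^i}\frac{e}{T^j}v_{n+1}\Big)^*+ht^{l+1}\otimes v_1^*\otimes\dots\otimes v_n^*\otimes\Big(\frac{e}{T^{b-l-1}}v_{n+1}\Big)^*\Big].$$ Then $\eta=(\eta^0,\eta^1)$ is a monomorphism of complexes $$\eta:\ \Omega^{\bullet}(U(z))[1]\to C_\bullet\Big(\mathfrak{sl}_2(U(z));\bigotimes_{i=1}^{n+1}V_i^*\Big).$$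
   Context: **De Rham complex.** $\Omega^p(U(z))$ is the space of rational differential $p$-forms ($p=0,1$) in one variable $t$ regular on $U(z)=\mathbb C\setminus\{z_1,\dots,z_n\}$. The twisted De Rham complex is $0\to\Omega^0\xrightarrow{\tilde d}\Omega^1\to0$ with $\tilde d\,\phi=d\phi+\phi\,\alpha$, $\alpha=-\frac1\kappa\sum_{i=1}^n\frac{M^i}{t-z_i}dt$. The shift $[1]$ means only that $\Omega^j$ is placed in degree $j-1$ (with the same differential $\tilde d$). Elementary functions: $(t-z_i)^{-b}$ ($b\ge1$, $1\le i\le n$) and $t^b$ ($b\ge0$); they form a basis of $\Omega^0$. Elementary forms: $d(t-z_i)/(t-z_i)^{b}$ ($b\ge1$) and $t^b dt$ ($b\ge0$), where $d(t-z_i)=dt$; they form a basis of $\Omega^1$. **Affine algebra.** $e,f,h$ are the standard generators of $\mathfrak{sl}_2$: $[e,f]=h,\ [h,e]=2e,\ [h,f]=-2f$. $\widehat{\mathfrak{sl}}_2=\mathfrak{sl}_2[T,T^{-1}]\oplus\mathbb C c$ with $c$ central and $[aT^i,bT^j]=[a,b]T^{i+j}+i\,\mathrm{tr}(ab)\,\delta_{i+j,0}\,c$. Write $X/T^i$ for $XT^{-i}$. Put $f_1=f,\ e_1=e,\ h_1=h,\ f_2=eT^{-1},\ e_2=fT,\ h_2=c-h$. Let $\pi$ be the automorphism of $\widehat{\mathfrak{sl}}_2$ with $c\mapsto c,\ eT^i\mapsto fT^i,\ fT^i\mapsto eT^i,\ hT^i\mapsto -hT^i$. The central element $c$ acts on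 all modules by $k$. **Verma modules.** $V=V(M,k-M)$ is the Verma module generated by $v$ with $e_1v=e_2v=0$, $h_1v=Mv$, $h_2v=(k-M)v$; it is free of rank one over $U\hat{\mathfrak n}_-$, where $\hat{\mathfrak n}_-$ is the Lie subalgebra generated by $f_1,f_2$. It is graded by $\mathbb Z_{\ge0}^2$: $f_{i_1}\cdots f_{i_p}v$ has degree $(p_1,p_2)$, $p_i$ being the number of $i$'s in the sequence; homogeneous components $V_\gamma$ are finite-dimensional. The contragradient dual is $V^*=\bigoplus_\gamma V_\gamma^*$ with the $\widehat{\mathfrak{sl}}_2$-action determined by $\langle f_i\phi,x\rangle=\langle\phi,e_ix\rangle$, $\langle e_i\phi,x\rangle=\langle\phi,f_ix\rangle$, $i=1,2$. **Bases.** For $\gamma=(p_1,p_2)$ with $p_1>p_2$, fix the basis of $V_\gamma$ consisting of all $\frac f{T^{i_1}}\cdots\frac f{T^{i_a}}\frac h{T^{j_1}}\cdots\frac h{T^{j_b}}\frac e{T^{l_1}}\cdots\frac e{T^{l_c}}v$ with $0\le i_a\le\dots\le i_1$, $1\le j_b\le\dots\le j_1$, $1\le l_c\le\dots\le l_1$, $\sum i_s+\sum j_s+\sum l_s+a-c=p_1$, $\sum i_s+\sum j_s+\sum l_s=p_2$. For $p_1<p_2$ fix the basis of all $\frac e{T^{l_1}}\cdots\frac e{T^{l_c}}\frac h{T^{j_1}}\cdots\frac h{T^{j_b}}\frac f{T^{i_1}}\cdots\frac f{T^{i_a}}v$ with the same index conditions. For $\gamma=(0,0)$ the basis is $\{v\}$.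 For an element $x$ of these bases, $x^*$ denotes the corresponding element of the dual basis of $V_\gamma^*\subset V^*$. **Chain complex.** $\mathfrak{sl}_2(U(z))$ is the Lie algebra (pointwise bracket) of $\mathfrak{sl}_2$-valued rational functions on $\mathbb P^1$ regular on $U(z)$. It acts on $W_1\otimes\dots\otimes W_{n+1}$ (here $W_i=V_i^*$) as follows: $a(t)$ acts as the sum over $i=1,\dots,n$ of the Laurent expansion of $a(T+z_i)$ at $T=0$ acting on the $i$-th factor, plus $\pi$ applied to the Laurent expansion of $a(1/T)$ at $T=0$ acting on the $(n+1)$-st factor (this is well defined since, for each $w\in V_i^*$ and $a\in\mathfrak{sl}_2$, $aT^j w=0$ for $j\gg0$). $C_\bullet(\mathfrak{sl}_2(U(z));W)$ is the standard Lie algebra chain complex $\dots\to\Lambda^2\mathfrak{sl}_2(U(z))\otimes W\to\mathfrak{sl}_2(U(z))\otimes W\xrightarrow{d}W\to0$, with last differential $d(x\otimes w)=x\cdot w$, where $W$ sits in degree $0$, $\mathfrak{sl}_2(U(z))\otimes W$ in degree $-1$, etc. (all differentials have degree $+1$). *)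

(* Defs.v *)
From HB Require Import structures.
From mathcomp Require Import all_boot all_order all_algebra.
From mathcomp Require Import fraction complex.
From mathcomp Require Import boolp classical_sets functions cardinality fsbigop.
From mathcomp Require Import reals ring.

Set Implicit Arguments.
Unset Strict Implicit.
Unset Printing Implicit Defensive.

Import GRing.Theory.
Local Open Scope classical_set_scope.
Local Open Scope ring_scope.

Local Notation "x %:F" := (@FracField.tofrac _ x) : ring_scope.

(** [umod good] is the K-module of formal combinations of elements of [X],
    two of them being identified when every map of the class [good] takes the
    same value on both.  It is thus the target of the universal map of class
    [good]; tensor products are the cases where [good] is (multi)linearity
    (see [tens_bilin], [pure_multilin] and [ulift_gen], [ulift_linear],
    [ulift_unique]). *)

Section UniversalModule.
Variables (K : fieldType) (X : choiceType).
Variable good : forall N : lmodType K, (X -> N) -> Prop.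

Definition evalsum (N : lmodType K) (b : X -> N) (s : seq (K * X)) : N :=
  \sum_(p <- s) p.1 *: b p.2.

Definition umod_eq (s t : seq (K * X)) : bool :=
  `[< forall (N : lmodType K) (b : X -> N),
        good b -> evalsum b s = evalsum b t >].

Lemma umod_eq_refl : reflexive umod_eq.
Proof. by move=> s; apply/asboolP. Qed.

Lemma umod_eq_sym : symmetric umod_eq.
Proof.
by move=> s t; apply/asboolP/asboolP => H N b gb; rewrite H.
Qed.

Lemma umod_eq_trans : transitive umod_eq.
Proof.
move=> t s u /asboolP st /asboolP tu; apply/asboolP => N b gb.
by rewrite st // tu.
Qed.

Canonical umod_equiv := EquivRel umod_eq umod_eq_refl umod_eq_sym umod_eq_trans.

Local Open Scope quotient_scope.

Definition umod := {eq_quot umod_eq}.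

HB.instance Definition _ : EqQuotient _ umod_eq umod := EqQuotient.on umod.
HB.instance Definition _ := Choice.on umod.

Definition mkumod (s : seq (K * X)) : umod := \pi_umod s.

Definition gen (x : X) : umod := mkumod [:: (1, x)].

(* the linear map induced by b, for b in the class good *)
Definition ulift (N : lmodType K) (b : X -> N) (u : umod) : N :=
  evalsum b (repr u).

Lemma ulift_mk (N : lmodType K) (b : X -> N) s :
  good b -> ulift b (mkumod s) = evalsum b s.
Proof.
move=> gb; rewrite /ulift.
have : umod_eq (repr (mkumod s)) s by rewrite -eqmodE reprK.
by move/asboolP; apply.
Qed.

Lemma umodP (u v : umod) :
  (forall (N : lmodType K) (b : X -> N), good b -> ulift b u = ulift b v) ->
  u = v.
Proof.
move=> H; rewrite -[u]reprK -[v]reprK; apply/eqP; rewrite eqmodE.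
by apply/asboolP => N b gb; exact: H.
Qed.

Definition uadd (u v : umod) := mkumod (repr u ++ repr v).
Definition uscale (c : K) (u : umod) :=
  mkumod [seq (c * p.1, p.2) | p <- repr u].

Lemma ulift_uadd (N : lmodType K) (b : X -> N) u v :
  good b -> ulift b (uadd u v) = ulift b u + ulift b v.
Proof. by move=> gb; rewrite ulift_mk // /evalsum big_cat. Qed.

Lemma ulift_uscale (N : lmodType K) (b : X -> N) c u :
  good b -> ulift b (uscale c u) = c *: ulift b u.
Proof.
move=> gb; rewrite ulift_mk // /ulift /evalsum big_map scaler_sumr.
by apply: eq_bigr => p _; rewrite scalerA.
Qed.

Lemma ulift_nil (N : lmodType K) (b : X -> N) : good b -> ulift b (mkumod [::]) = 0.
Proof. by move=> gb; rewrite ulift_mk // /evalsum big_nil. Qed.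

Fact uaddA : associative uadd.
Proof. by move=> u v w; apply: umodP => N b gb; rewrite !ulift_uadd // addrA. Qed.
Fact uaddC : commutative uadd.
Proof. by move=> u v; apply: umodP => N b gb; rewrite !ulift_uadd // addrC. Qed.
Fact uadd0 : left_id (mkumod [::]) uadd.
Proof.
by move=> u; apply: umodP => N b gb; rewrite ulift_uadd // ulift_nil // add0r.
Qed.
Fact uaddN : left_inverse (mkumod [::]) (uscale (-1)) uadd.
Proof.
move=> u; apply: umodP => N b gb.
by rewrite ulift_uadd // ulift_uscale // ulift_nil // scaleN1r addNr.
Qed.

HB.instance Definition _ := GRing.isZmodule.Build umod uaddA uaddC uadd0 uaddN.

Fact uscaleA c d (u : umod) : uscale c (uscale d u) = uscale (c * d) u.
Proof. by apply: umodP => N b gb; rewrite !ulift_uscale // scalerA. Qed.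
Fact uscale1 : left_id 1 uscale.
Proof. by move=> u; apply: umodP => N b gb; rewrite ulift_uscale // scale1r. Qed.
Fact uscaleDr : right_distributive uscale +%R.
Proof.
move=> c u v; apply: umodP => N b gb.
by rewrite ulift_uscale // !ulift_uadd // !ulift_uscale // scalerDr.
Qed.
Fact uscaleDl (u : umod) : {morph uscale^~ u : c d / c + d}.
Proof.
move=> c d; apply: umodP => N b gb.
by rewrite ulift_uadd // !ulift_uscale // scalerDl.
Qed.

HB.instance Definition _ :=
  GRing.Zmodule_isLmodule.Build K umod uscaleA uscale1 uscaleDr uscaleDl.

Lemma ulift_linear (N : lmodType K) (b : X -> N) : good b -> linear (ulift b).
Proof.
by move=> gb c u v; rewrite (ulift_uadd (uscale c u) v gb) (ulift_uscale c u gb).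
Qed.

Lemma ulift_gen (N : lmodType K) (b : X -> N) x : good b -> ulift b (gen x) = b x.
Proof. by move=> gb; rewrite ulift_mk // /evalsum big_seq1 scale1r. Qed.

Lemma umod_gen (u : umod) : u = \sum_(p <- repr u) p.1 *: gen p.2.
Proof.
apply: umodP => N b gb; rewrite {1}/ulift /evalsum.
elim: (repr u) => [|p s IHs]; first by rewrite !big_nil ulift_nil.
by rewrite !big_cons ulift_linear // -IHs ulift_gen.
Qed.

Lemma ulift_unique (N : lmodType K) (b : X -> N) (g : umod -> N) :
  linear g -> (forall x, g (gen x) = b x) -> forall u, g u = ulift b u.
Proof.
move=> gL gb u; rewrite {1}(umod_gen u) /ulift /evalsum.
have g0 : g 0 = 0 by have := gL (-1) 0 0; rewrite scaler0 addr0 scaleN1r addNr.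
elim: (repr u) => [|p s IHs]; first by rewrite !big_nil.
by rewrite !big_cons gL IHs gb.
Qed.

End UniversalModule.

Section Tensor.
Variable K : fieldType.

Section Binary.
Variables A B : lmodType K.

Definition bilin (N : lmodType K) (b : A * B -> N) : Prop :=
  (forall c x y w, b (c *: x + y, w) = c *: b (x, w) + b (y, w)) /\
  (forall c x v w, b (x, c *: v + w) = c *: b (x, v) + b (x, w)).

Definition tensor := umod bilin.
HB.instance Definition _ := GRing.Lmodule.on tensor.

Definition tens (x : A) (w : B) : tensor := gen bilin (x, w).

Lemma tens_bilin : bilin (fun p => tens p.1 p.2).
Proof.
split=> c x v w; apply: umodP => N b gb /=; rewrite ulift_linear // !ulift_gen //;
by case: gb => gl gr; rewrite ?gl ?gr.
Qed.

End Binary.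

Section Family.
Variables (m : nat) (W : 'I_m -> lmodType K).

Definition family := forall i, W i.
HB.instance Definition _ := gen_eqMixin family.
HB.instance Definition _ := gen_choiceMixin family.

Definition multilin (N : lmodType K) (b : family -> N) : Prop :=
  forall (w : family) (i : 'I_m) (c : K) (x y : W i),
    b (dfwith w (c *: x + y)) = c *: b (dfwith w x) + b (dfwith w y).

Definition tprod := umod multilin.
HB.instance Definition _ := GRing.Lmodule.on tprod.

Definition pure (w : family) : tprod := gen multilin w.

Lemma pure_multilin : multilin pure.
Proof.
move=> w i c x y; apply: umodP => N b gb.
by rewrite ulift_linear // !ulift_gen.
Qed.

End Family.
End Tensor.

Section RatFun.
Variable K : fieldType.

Definition ratfun := {fraction {poly K}}.
HB.instance Definition _ := GRing.Field.on ratfun.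

Definition cst_rat (c : K) : ratfun := (c%:P)%:F.
Definition t_rat : ratfun := ('X : {poly K})%:F.

Fact cst_rat_is_additive : zmod_morphism cst_rat.
Proof. by move=> c d; rewrite /cst_rat !raddfB. Qed.
Fact cst_rat_is_monoid : monoid_morphism cst_rat.
Proof. by split=> [|c d]; rewrite /cst_rat ?rmorph1 ?rmorphM. Qed.
HB.instance Definition _ :=
  GRing.isZmodMorphism.Build K ratfun cst_rat cst_rat_is_additive.
HB.instance Definition _ :=
  GRing.isMonoidMorphism.Build K ratfun cst_rat cst_rat_is_monoid.

Definition rscale (c : K) (g : ratfun) : ratfun := cst_rat c * g.
Fact rscaleA c d g : rscale c (rscale d g) = rscale (c * d) g.
Proof. by rewrite /rscale rmorphM mulrA. Qed.
Fact rscale1 : left_id 1 rscale.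
Proof. by move=> g; rewrite /rscale rmorph1 mul1r. Qed.
Fact rscaleDr : right_distributive rscale +%R.
Proof. by move=> c g h; rewrite /rscale mulrDr. Qed.
Fact rscaleDl g : {morph rscale^~ g : c d / c + d}.
Proof. by move=> c d; rewrite /rscale rmorphD mulrDl. Qed.
HB.instance Definition _ :=
  GRing.Zmodule_isLmodule.Build K ratfun rscaleA rscale1 rscaleDr rscaleDl.

Definition deriv_rat (g : ratfun) : ratfun :=
  let p := \n_(repr g) in let q := \d_(repr g) in
  (p^`() * q - p * q^`())%:F / q%:F ^+ 2.

(* g(x) for x in K(t), e.g. g(t + a) or g(1/t) *)
Definition subst_rat (x g : ratfun) : ratfun :=
  (map_poly cst_rat \n_(repr g)).[x] / (map_poly cst_rat \d_(repr g)).[x].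

Definition poly_coefz (p : {poly K}) (m : int) : K :=
  if m is Posz i then p`_i else 0.

(* c is the Laurent expansion of g at 0: q * c = p as formal Laurent series
   whenever g = p / q *)
Definition is_laurent (g : ratfun) (c : int -> K) : Prop :=
  (exists N : int, forall j : int, (j < N)%R -> c j = 0) /\
  (forall p q : {poly K}, q != 0 -> g = p%:F / q%:F ->
     forall m : int, \sum_(s < size q) q`_s * c (m - s%:Z) = poly_coefz p m).

Definition laurent (g : ratfun) : int -> K := xget (fun=> 0) [set c | is_laurent g c].

Definition regular_at (x : K) (g : ratfun) : Prop :=
  exists p q : {poly K}, ~~ root q x /\ g = p%:F / q%:F.

Lemma frac_numden (g : ratfun) :
  \d_(repr g) != 0 /\ g = (\n_(repr g))%:F / (\d_(repr g))%:F.
Proof.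
have d0 := denom_ratioP (repr g); split=> //.
have e (p q : {poly K}) : q != 0 ->
    p%:F / q%:F = \pi_(FracField.type {poly K})%qT (Ratio p q).
  move=> q0; unlock FracField.tofrac.
  rewrite -[X in _ * X]FracField.pi_inv -[LHS]FracField.pi_mul.
  rewrite /FracField.mulf /FracField.invf.
  by rewrite !numden_Ratio ?oner_eq0 // mulr1 mul1r.
by rewrite e // Ratio_numden reprK.
Qed.

Lemma frac_eq (p q r s : {poly K}) : q != 0 -> s != 0 ->
  p%:F / q%:F = r%:F / s%:F -> p * s = r * q.
Proof.
move=> q0 s0 /eqP; rewrite eqr_div ?tofrac_eq0 //.
by rewrite -!tofracM tofrac_eq => /eqP.
Qed.

Lemma deriv_frac (p q : {poly K}) : q != 0 ->
  deriv_rat (p%:F / q%:F) = (p^`() * q - p * q^`())%:F / q%:F ^+ 2.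
Proof.
move=> q0; have [d0 eg] := frac_numden (p%:F / q%:F).
rewrite /deriv_rat; move: (\n_(repr _)) (\d_(repr _)) d0 eg => n d d0 eg.
have nq : n * q = p * d by apply: frac_eq; rewrite -?eg.
have dnq : n^`() * q + n * q^`() = p^`() * d + p * d^`().
  by rewrite -!derivM nq.
apply/eqP; rewrite eqr_div ?expf_neq0 ?tofrac_eq0 // -!tofracXn -!tofracM.
rewrite tofrac_eq -subr_eq0; apply/eqP.
transitivity (q * d * ((n^`() * q + n * q^`()) - (p^`() * d + p * d^`()))
  - (q * d^`() + d * q^`()) * (n * q - p * d)); first by ring.
by rewrite nq dnq !subrr !mulr0 subr0.
Qed.

Lemma root_neq0 (q : {poly K}) x : ~~ root q x -> q != 0.
Proof. by apply: contraNneq => ->; rewrite root0. Qed.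

Lemma regular_atD x g h : regular_at x g -> regular_at x h -> regular_at x (g + h).
Proof.
move=> [p [q [qx ->]]] [r [s [sx ->]]]; exists (p * s + r * q), (q * s).
rewrite rootM negb_or qx sx; split=> //.
by rewrite addf_div ?tofrac_eq0 ?(root_neq0 qx) ?(root_neq0 sx) //
  tofracD !tofracM.
Qed.

Lemma regular_atM x g h : regular_at x g -> regular_at x h -> regular_at x (g * h).
Proof.
move=> [p [q [qx ->]]] [r [s [sx ->]]]; exists (p * r), (q * s).
by rewrite rootM negb_or qx sx; split=> //; rewrite mulf_div !tofracM.
Qed.

Lemma regular_at_poly x p : regular_at x p%:F.
Proof. by exists p, 1; rewrite root1; split=> //; rewrite tofrac1 divr1. Qed.

Lemma regular_at_inv x q : ~~ root q x -> regular_at x (q%:F)^-1.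
Proof. by move=> qx; exists 1, q; split=> //; rewrite tofrac1 div1r. Qed.

Lemma regular_atX x g b : regular_at x g -> regular_at x (g ^+ b).
Proof.
move=> gx; elim: b => [|b IHb].
  by rewrite expr0 -tofrac1; apply: regular_at_poly.
by rewrite exprS; apply: regular_atM.
Qed.

Lemma regular_at_deriv x g : regular_at x g -> regular_at x (deriv_rat g).
Proof.
move=> [p [q [qx ->]]]; rewrite deriv_frac ?(root_neq0 qx) //.
apply: regular_atM; first exact: regular_at_poly.
by rewrite -exprVn; apply/regular_atX/regular_at_inv.
Qed.

Section Punctured.
Variables (n : nat) (z : 'I_n -> K).

(* regularity on the line minus the points z_i; the point at infinity is
   removed too, hence carries no condition *)
Definition regular : {pred ratfun} :=
  fun g => `[< forall x, (forall i, x != z i) -> regular_at x g >].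

Lemma regularP g :
  reflect (forall x, (forall i, x != z i) -> regular_at x g) (g \in regular).
Proof. exact: asboolP. Qed.

Fact regular_submod : submod_closed regular.
Proof.
split=> [|c g h /regularP rg /regularP rh]; apply/regularP => x xz.
  by rewrite -tofrac0; apply: regular_at_poly.
apply: regular_atD (rh x xz); apply: regular_atM (rg x xz).
exact: regular_at_poly.
Qed.

HB.instance Definition _ :=
  GRing.isSubmodClosed.Build K ratfun regular regular_submod.

Record Omega0 := MkOmega0 { rat_of :> ratfun; _ : rat_of \in regular }.

HB.instance Definition _ := [isSub for rat_of].
HB.instance Definition _ := [Choice of Omega0 by <:].
HB.instance Definition _ := [SubChoice_isSubLmodule of Omega0 by <:].

(* the form g dt is represented by its coefficient g *)
Definition Omega1 := Omega0.
HB.instance Definition _ := GRing.Lmodule.on Omega1.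

Fact pole_regular (m : 'I_n) (b : nat) :
  (t_rat - cst_rat (z m)) ^- b \in regular.
Proof.
apply/regularP => x xz; rewrite -exprVn; apply/regular_atX.
rewrite /t_rat /cst_rat -tofracB; apply: regular_at_inv.
by rewrite root_XsubC.
Qed.

Fact monom_regular (b : nat) : t_rat ^+ b \in regular.
Proof. by apply/regularP => x _; apply/regular_atX/regular_at_poly. Qed.

Definition pole m b : Omega0 := MkOmega0 (pole_regular m b).
Definition monom b : Omega0 := MkOmega0 (monom_regular b).

Definition alpha (kappa : K) (M : 'I_n -> K) : ratfun :=
  - (cst_rat kappa^-1 *
     \sum_(i < n) cst_rat (M i) / (t_rat - cst_rat (z i))).

Fact dtilde_regular kappa M (phi : Omega0) :
  deriv_rat phi + rat_of phi * alpha kappa M \in regular.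
Proof.
case: phi => g /= /regularP rg; apply/regularP => x xz.
have gx := rg x xz; apply: regular_atD; first exact: regular_at_deriv.
apply: regular_atM => //; rewrite /alpha -mulNr -rmorphN.
apply: regular_atM; first exact: regular_at_poly.
elim/big_ind: _ => [|g1 g2|i _].
- by rewrite -tofrac0; apply: regular_at_poly.
- exact: regular_atD.
apply: regular_atM; first exact: regular_at_poly.
have /regularP := pole_regular i 1; rewrite expr1; exact.
Qed.

Definition dtilde kappa M (phi : Omega0) : Omega1 :=
  MkOmega0 (dtilde_regular kappa M phi).

(* sl_2-valued functions are traceless 2 x 2 matrices of functions *)
Definition sl2_regular : {pred 'M[ratfun]_2} :=
  fun A => (\tr A == 0) && [forall i, forall j, A i j \in regular].

Lemma sl2_regularP (A : 'M[ratfun]_2) :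
  reflect (\tr A = 0 /\ forall i j, A i j \in regular) (A \in sl2_regular).
Proof.
apply: (iffP andP) => -[/eqP trA rA]; split=> //.
  by move=> i j; move/forallP/(_ i)/forallP/(_ j): rA.
by apply/forallP => i; apply/forallP => j.
Qed.

Fact sl2_regular_zmod : zmod_closed sl2_regular.
Proof.
split=> [|A B /sl2_regularP[tA rA] /sl2_regularP[tB rB]]; apply/sl2_regularP.
  by rewrite mxtrace0; split=> // i j; rewrite mxE rpred0.
by rewrite raddfB /= tA tB subrr; split=> // i j; rewrite !mxE rpredB.
Qed.

HB.instance Definition _ :=
  GRing.isZmodClosed.Build 'M[ratfun]_2 sl2_regular sl2_regular_zmod.

Record sl2U := MkSl2U { mx_of :> 'M[ratfun]_2; _ : mx_of \in sl2_regular }.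

HB.instance Definition _ := [isSub for mx_of].
HB.instance Definition _ := [Choice of sl2U by <:].
HB.instance Definition _ := [SubChoice_isSubZmodule of sl2U by <:].

Fact sl2U_scale_subproof (c : K) (A : sl2U) :
  map_mx (fun g : ratfun => c *: g) (mx_of A) \in sl2_regular.
Proof.
case: A => A /= /sl2_regularP[tA rA]; apply/sl2_regularP; split.
  rewrite /mxtrace; under eq_bigr do rewrite mxE.
  by rewrite -scaler_sumr -/(mxtrace A) tA scaler0.
by move=> i j; rewrite mxE rpredZ.
Qed.

Definition sl2U_scale c A : sl2U := MkSl2U (sl2U_scale_subproof c A).

Fact sl2U_scaleA c d A : sl2U_scale c (sl2U_scale d A) = sl2U_scale (c * d) A.
Proof. by apply/val_inj/matrixP => i j; rewrite !mxE scalerA. Qed.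
Fact sl2U_scale1 : left_id 1 sl2U_scale.
Proof. by move=> A; apply/val_inj/matrixP => i j; rewrite !mxE scale1r. Qed.
Fact sl2U_scaleDr : right_distributive sl2U_scale +%R.
Proof. by move=> c A B; apply/val_inj/matrixP => i j; rewrite !mxE scalerDr. Qed.
Fact sl2U_scaleDl A : {morph sl2U_scale^~ A : c d / c + d}.
Proof. by move=> c d; apply/val_inj/matrixP => i j; rewrite !mxE scalerDl. Qed.
HB.instance Definition _ := GRing.Zmodule_isLmodule.Build K sl2U
  sl2U_scaleA sl2U_scale1 sl2U_scaleDr sl2U_scaleDl.

Fact mulU_subproof (a : 'M[K]_2) (g : Omega0) : \tr a = 0 ->
  map_mx (fun c : K => c *: rat_of g) a \in sl2_regular.
Proof.
move=> ta; apply/sl2_regularP; split.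
  rewrite /mxtrace; under eq_bigr do rewrite mxE.
  by rewrite -scaler_suml -/(mxtrace a) ta scale0r.
by move=> i j; rewrite mxE rpredZ //; case: g.
Qed.

(* the function t |-> g(t) a *)
Definition mulU (a : 'M[K]_2) (ta : \tr a = 0) (g : Omega0) : sl2U :=
  MkSl2U (mulU_subproof g ta).

End Punctured.
End RatFun.

Section Affine.
Variable K : fieldType.

Definition mx_e : 'M[K]_2 := delta_mx 0 1.
Definition mx_f : 'M[K]_2 := delta_mx 1 0.
Definition mx_h : 'M[K]_2 := delta_mx 0 0 - delta_mx 1 1.

Fact tr_e : \tr mx_e = 0.
Proof. by rewrite /mxtrace big_ord_recl big_ord1 !mxE /= addr0. Qed.
Fact tr_f : \tr mx_f = 0.
Proof. by rewrite /mxtrace big_ord_recl big_ord1 !mxE /= addr0. Qed.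
Fact tr_h : \tr mx_h = 0.
Proof. by rewrite /mxtrace big_ord_recl big_ord1 !mxE /= subr0 sub0r subrr. Qed.

Definition comm_mx2 (a b : 'M[K]_2) : 'M[K]_2 := a *m b - b *m a.

(* (x, l) stands for \sum_i x_i T^i + l c *)
Definition affine : Type := ((int -> 'M[K]_2) * K^o)%type.
HB.instance Definition _ := GRing.Lmodule.on affine.

(* sl_2[T, 1/T] + K c *)
Definition sl2hat : set affine :=
  [set x | finite_set [set i | x.1 i != 0] /\ forall i, \tr (x.1 i) = 0].

Definition loop (a : 'M[K]_2) (i : int) : affine :=
  (fun j => if j == i then a else 0, 0).
Definition central : affine := (fun=> 0, 1).

(* the bilinear extension of
   [a T^i, b T^j] = [a, b] T^(i+j) + i tr(ab) delta_(i+j,0) c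
   (see [brack_loop]) *)
Definition brack (x y : affine) : affine :=
  (fun m => \sum_(i \in setT) comm_mx2 (x.1 i) (y.1 (m - i)),
   \sum_(i \in setT) i%:~R * \tr (x.1 i *m y.1 (- i))).

Lemma brack_loop a b i j :
  brack (loop a i) (loop b j) =
  loop (comm_mx2 a b) (i + j)
  + (if i + j == 0 then i%:~R * \tr (a *m b) else 0) *: central.
Proof.
have E (U : zmodType) (F : int -> U) : (forall s, s != i -> F s = 0) ->
    \sum_(s \in setT) F s = F i.
  move=> F0; transitivity (\sum_(s \in [set i]) F s); last exact: fsbig_set1.
  apply/esym/fsbig_widen => //.
  by move=> s [_ /eqP si]; exact: F0.
rewrite /brack /loop /central; congr pair => /=.
  apply/funext => m; rewrite E => [|s /negPf si]; last first.
    by rewrite si /comm_mx2 mul0mx mulmx0 subrr.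
  transitivity (if m == i + j then comm_mx2 a b else 0); last first.
    by rewrite -[LHS]addr0; congr (_ + _); exact/esym/scaler0.
  rewrite eqxx subr_eq [j + i]addrC; case: ifP => // _.
  by rewrite /comm_mx2 mul0mx mulmx0 subrr.
rewrite E => [|s /negPf si]; last by rewrite si mul0mx mxtrace0 mulr0.
rewrite eqxx add0r [RHS]mulr1 addrC addr_eq0 [- i == j]eq_sym.
by case: ifP => // _; rewrite mulmx0 mxtrace0 mulr0.
Qed.

End Affine.

Section Modules.
Variable K : fieldType.
Local Notation affine := (affine K).

Definition aff_f1 : affine := loop (mx_f K) 0.
Definition aff_e1 : affine := loop (mx_e K) 0.
Definition aff_h1 : affine := loop (mx_h K) 0.
Definition aff_f2 : affine := loop (mx_e K) (-1).
Definition aff_e2 : affine := loop (mx_f K) 1.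
Definition aff_h2 : affine := central K - aff_h1.

Definition is_submod (U : lmodType K) (S : set U) : Prop :=
  S 0 /\ forall c x y, S x -> S y -> S (c *: x + y).

Definition lspan (U : lmodType K) (A : set U) : set U := smallest (@is_submod U) A.

Definition is_subalg (S : set affine) : Prop :=
  is_submod S /\ forall x y, S x -> S y -> S (brack x y).

Definition nminus : set affine := smallest is_subalg [set aff_f1; aff_f2].

(* rho restricted to the Lie subalgebra P is a representation of P on N; the
   values of rho outside of P are irrelevant *)
Definition is_rep (P : set affine) (N : lmodType K) (rho : affine -> N -> N) : Prop :=
  [/\ forall x, P x -> linear (rho x),
      forall c x y u, P x -> P y ->
        rho (c *: x + y) u = c *: rho x u + rho y u
    & forall x y u, P x -> P y ->
        rho (brack x y) u = rho x (rho y u) - rho y (rho x u)].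

Record affmod := AffMod {
  car :> lmodType K;
  aact : affine -> car -> car;
  vac : car }.

(* [verma_free] says that V is free of rank one over U(n_-) with basis the
   generating vector: modules over U(n_-) are the same as n_--modules, and V
   has the universal property of the free module on one generator *)
Record is_verma (M k : K) (V : affmod) : Prop := IsVerma {
  verma_rep : is_rep (@sl2hat K) (@aact V);
  verma_c : forall x : V, aact (central K) x = k *: x;
  verma_e1 : aact aff_e1 (vac V) = 0;
  verma_e2 : aact aff_e2 (vac V) = 0;
  verma_h1 : aact aff_h1 (vac V) = M *: vac V;
  verma_h2 : aact aff_h2 (vac V) = (k - M) *: vac V;
  verma_free : forall (N : lmodType K) (sigma : affine -> N -> N) (y : N),
    is_rep nminus sigma ->
    exists! phi : V -> N,
      [/\ linear phi,
          forall x u, nminus x -> phi (aact x u) = sigma x (phi u)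
        & phi (vac V) = y] }.

(* [false] stands for the index 1 and [true] for the index 2 *)
Definition aff_f (i : bool) : affine := if i then aff_f2 else aff_f1.
Definition aff_e (i : bool) : affine := if i then aff_e2 else aff_e1.

Definition word (V : affmod) (s : seq bool) : V :=
  foldr (fun i u => aact (aff_f i) u) (vac V) s.

Definition component (V : affmod) (g : nat * nat) : set V :=
  lspan [set x | exists s : seq bool,
    [/\ count_mem false s = g.1, count_mem true s = g.2 & x = word V s]].

Section Dual.
Variable V : affmod.

(* the direct sum of the V_g^*, as the space of linear forms on V vanishing
   on all but finitely many of the V_g *)
Definition cdual_pred : {pred V -> K^o} :=
  fun phi => `[< linear phi /\
    finite_set [set g | exists2 x, component g x & phi x != 0] >].

Fact cdual_submod : submod_closed cdual_pred.
Proof.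
split=> [|c phi psi /asboolP[lphi fphi] /asboolP[lpsi fpsi]]; apply/asboolP.
  split=> [d x y|]; first by rewrite -[LHS]/(0 : K) -[RHS]/(d * 0 + 0) mulr0 addr0.
  by apply: sub_finite_set (finite_set0 _) => g [x _]; rewrite -[X in X != _]/(0 : K) eqxx.
have E x : (c *: phi + psi) x = c *: phi x + psi x by [].
split=> [d x y|].
  by rewrite !E lphi lpsi !scalerDr !scalerA [c * d]mulrC addrACA.
have : finite_set ([set g | exists2 x : V, component g x & phi x != 0] `|`
                   [set g | exists2 x : V, component g x & psi x != 0]).
  by rewrite finite_setU.
apply: sub_finite_set => g [x gx] /= nz.
have [phx|phx] := eqVneq (phi x) 0; last by left; exists x.
right; exists x => //; apply: contraNneq nz => psx.
by rewrite E phx psx scaler0 addr0.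
Qed.

HB.instance Definition _ :=
  GRing.isSubmodClosed.Build K (V -> K^o) cdual_pred cdual_submod.

Record cdual := MkCdual { form :> V -> K^o; _ : form \in cdual_pred }.

HB.instance Definition _ := [isSub for form].
HB.instance Definition _ := [Choice of cdual by <:].
HB.instance Definition _ := [SubChoice_isSubLmodule of cdual by <:].

(* this determines rho on sl2hat, which is generated by the e_i and the f_i *)
Definition is_contragredient (rho : affine -> cdual -> cdual) : Prop :=
  [/\ is_rep (@sl2hat K) rho,
      forall i phi x, rho (aff_f i) phi x = phi (aact (aff_e i) x)
    & forall i phi x, rho (aff_e i) phi x = phi (aact (aff_f i) x)].

Definition over_T (a : 'M[K]_2) (i : nat) (u : V) : V := aact (loop a (- i%:Z)) u.

Definition apply_all (a : 'M[K]_2) (s : seq nat) (u : V) : V :=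
  foldr (over_T a) u s.

Definition pbw_index (g : nat * nat) (s j l : seq nat) : Prop :=
  [/\ sorted geq s, sorted geq j /\ all (leq 1) j, sorted geq l /\ all (leq 1) l,
      (sumn s + sumn j + sumn l + size s = g.1 + size l)%N
    & (sumn s + sumn j + sumn l = g.2)%N].

(* no basis is fixed for g = (p, p), p > 0 *)
Definition basis (g : nat * nat) : set V :=
  if (g.2 < g.1)%N then
    [set x | exists s j l, pbw_index g s j l /\
       x = apply_all (mx_f K) s (apply_all (mx_h K) j (apply_all (mx_e K) l (vac V)))]
  else if (g.1 < g.2)%N then
    [set x | exists s j l, pbw_index g s j l /\
       x = apply_all (mx_e K) l (apply_all (mx_h K) j (apply_all (mx_f K) s (vac V)))]
  else if g == (0, 0)%N then [set vac V]
  else set0.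

Definition is_dual_vector (x : V) (phi : cdual) : Prop :=
  exists g : nat * nat,
    [/\ basis g x,
        forall y, basis g y -> phi y = if y == x then 1 else 0
      & forall g' y, g' != g -> component g' y -> phi y = 0].

(* x^*, for x an element of one of the bases *)
Definition star (x : V) : cdual := xget 0 [set phi | is_dual_vector x phi].

End Dual.
End Modules.

Section Complex.
Variables (K : fieldType) (n : nat) (z : 'I_n -> K).
Variable V : 'I_n.+1 -> affmod K.
Variable rho : forall i, affine K -> cdual (V i) -> cdual (V i).

Definition dualV (i : 'I_n.+1) : lmodType K := cdual (V i).
Definition W : lmodType K := tprod dualV.
Definition sl2U_W : lmodType K := tensor (sl2U z) W.

(* index of z_m, m < n, among z_1, ..., z_n, z_(n+1) = infinity *)
Definition fin (m : 'I_n) : 'I_n.+1 := lift ord_max m.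

(* coefficients of the Laurent expansion at T = 0 of A(x), with x in K(T) *)
Definition expansion (x : ratfun K) (A : sl2U z) (j : int) : 'M[K]_2 :=
  map_mx (fun g => laurent (subst_rat x g) j) (mx_of A).

(* the restriction to sl_2 of the automorphism pi: e <-> f, h |-> - h *)
Definition pi_sl2 (a : 'M[K]_2) : 'M[K]_2 :=
  \matrix_(i, j) a (rev_ord i) (rev_ord j).

Definition local_series (i : 'I_n.+1) (A : sl2U z) (j : int) : 'M[K]_2 :=
  if unlift ord_max i is Some m then expansion (t_rat K + cst_rat (z m)) A j
  else pi_sl2 (expansion (t_rat K)^-1 A j).

(* the local series is bounded below and a T^j w = 0 for j large, hence only
   finitely many terms are nonzero *)
Definition local_act (i : 'I_n.+1) (A : sl2U z) (w : dualV i) : dualV i :=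
  \sum_(j \in [set: int]) rho (loop (local_series i A j) j) w.

Definition sl2U_act (A : sl2U z) : W -> W :=
  ulift (fun w : family dualV => \sum_i pure (dfwith w (local_act A (w i)))).

(* the differential from degree -1 to degree 0; Omega[1] is concentrated in
   these two degrees, so that the rest of the chain complex plays no role for
   morphisms out of Omega[1] *)
Definition chain_d : sl2U_W -> W :=
  ulift (fun p : sl2U z * W => sl2U_act p.1 p.2).

Definition vstar : family dualV := fun i => star (vac (V i)).

(* v_1^* (x) ... (x) w (x) ... (x) v_(n+1)^*, with w in position i *)
Definition at_pos (i : 'I_n.+1) (w : dualV i) : W := pure (dfwith vstar w).

Definition f_ (b : nat) (i : 'I_n.+1) (u : V i) : V i := over_T (mx_f K) b u.
Definition e_ (b : nat) (i : 'I_n.+1) (u : V i) : V i := over_T (mx_e K) b u.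

Definition eU (g : Omega0 z) : sl2U z := mulU (tr_e K) g.
Definition fU (g : Omega0 z) : sl2U z := mulU (tr_f K) g.
Definition hU (g : Omega0 z) : sl2U z := mulU (tr_h K) g.

Definition is_eta1 (kappa : K) (eta1 : Omega1 z -> W) : Prop :=
  (forall (b : nat) (m : 'I_n),
     eta1 (pole z m b.+1) =
     - kappa *: at_pos (star (f_ b (vac (V (fin m)))))) /\
  (forall b : nat,
     eta1 (monom z b) = kappa *: at_pos (star (e_ b.+1 (vac (V ord_max))))).

Definition is_eta0 (eta0 : Omega0 z -> sl2U_W) : Prop :=
  [/\ forall (b : nat) (m : 'I_n), (1 <= b)%N ->
        let v := vac (V (fin m)) in
        eta0 (pole z m b) =
        tens (fU (pole z m b)) (pure vstar)
        - \sum_(1 <= l < b.+1)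
            (tens (eU (pole z m l))
               (at_pos (2%:R *: \sum_(0 <= i < b.+1) \sum_(0 <= j < i.+1 | (i + j == b - l)%N)
                                  star (f_ i (f_ j v))))
             + tens (hU (pole z m l)) (at_pos (star (f_ (b - l) v)))),
      eta0 (monom z 0) = tens (fU (monom z 0)) (pure vstar),
      eta0 (monom z 1) = tens (fU (monom z 1)) (pure vstar)
    & forall b : nat, (2 <= b)%N ->
        let v := vac (V ord_max) in
        eta0 (monom z b) =
        tens (fU (monom z b)) (pure vstar)
        - \sum_(0 <= l < b.-1)
            (tens (eU (monom z l))
               (at_pos (2%:R *: \sum_(1 <= i < b.+1) \sum_(1 <= j < i.+1 | (i + j == b - l)%N)
                                  star (e_ i (e_ j v))))
             + tens (hU (monom z l.+1)) (at_pos (star (e_ (b - l - 1) v))))].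

End Complex.

(* Main.v *)
Require Import Defs.
From HB Require Import structures.
From mathcomp Require Import all_boot all_order all_algebra.
From mathcomp Require Import fraction complex.
From mathcomp Require Import boolp classical_sets functions cardinality fsbigop.
From mathcomp Require Import reals zify ring.

(** Why the theorem holds.

    Applying the chain differential to [eta0 (1/(t - z_m)^b)] produces terms of
    two kinds. At a point other than [z_m] all functions involved are regular
    ([expand_pole_other], [expand_pole_inf]), and since the dual vacuum [v*] is a
    highest weight vector only their values at the point matter
    ([local_act_regular], [star_vac_f], [star_vac_e], [star_vac_h]). These terms
    reproduce the partial fractions of [M^i / (t - z_i) / (t - z_m)^b]
    ([dtilde_pole]). At [z_m] itself the functions are pure modes, and the claim
    becomes an identity between dual vectors of one Verma module: with
    [phi_s = (f/T^s v)*] and [psi_s = 2 sum_(i >= j, i + j = s) (f/T^i f/T^j v)*],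
      [f T^-b v* - sum_(1 <= l <= b) (e T^-l psi_(b-l) + h T^-l phi_(b-l))
       = (M + b kappa) phi_b].
    The monomials [t^b] lead to the same identity at infinity, where [f T^-i] is
    replaced by [e T^(-i-1)] and [h] by [c - h]. Both are proved at once
    ([contravariant_identity], [star_identity]) by a boolean side.

    For this identity the dual vectors have to be known as functions on the
    whole of [V]. Monomials with the factors [f T^-i] in front suggest to
    project [V] onto polynomials in commuting variables [x_i], forgetting the
    monomials with other factors. Polynomials form a module over the currents
    ([sym_act_rep]: multiplications, derivations, second-order operators), so
    the universal property of [V] provides this projection [P]
    ([sym_map_exists]), and [phi_s], [psi_s], [v*] are coefficients of [P]
    ([star_pairing]). That a dual vector is determined by its values on the
    basis rests on the spanning half of the theorem of Poincare, Birkhoff and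
    Witt ([words_span], [component_FHE], [dual_vector_unique]).

    Transposed to [V], the identity is an equality of linear forms. On elements
    [f/T^p f/T^q u], [f/T^p u] with [u] arbitrary it follows from the commutation
    relations and from the effect of [P] on a leading factor
    ([defect_FF], [defect_F]); the monomials without a leading [f/T^p] contribute
    nothing, because [P] maps them, and their images under one more operator, to
    too few variables ([pbw_low]).

    The maps [eta0] and [eta1] exist, and may be tested on elementary functions,
    because these form a basis of the regular functions: Laurent coefficients
    at the points [z_m] and at infinity are the coordinate forms
    ([elem_coef_elem]), and partial fractions give the spanning
    ([elem_rat_regular]). Both maps are injective since linear forms on their
    targets read off these coordinates up to the nonzero factors [1] and
    [- kappa], [kappa]: evaluation at a decomposable vector for [eta1]
    ([detect1P]), the [f]-component for [eta0] ([detect0P]). *)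


Set Implicit Arguments.
Unset Strict Implicit.
Unset Printing Implicit Defensive.

Import Order.TTheory GRing.Theory Num.Theory.
Local Open Scope classical_set_scope.
Local Open Scope ring_scope.

(** * Linear maps, spans and finitely supported sums *)

Section LinearMaps.
Variables (K : fieldType) (U N : lmodType K) (T : U -> N).
Hypothesis linT : linear T.

Lemma linear_map0 : T 0 = 0.
Proof. by have := linT (-1) 0 0; rewrite scaler0 addr0 scaleN1r addNr. Qed.

Lemma linear_mapD x y : T (x + y) = T x + T y.
Proof. by have := linT 1 x y; rewrite !scale1r. Qed.

Lemma linear_mapZ c x : T (c *: x) = c *: T x.
Proof. by have := linT c x 0; rewrite !addr0 linear_map0 addr0. Qed.

Lemma linear_mapN x : T (- x) = - T x.
Proof. by rewrite -scaleN1r linear_mapZ scaleN1r. Qed.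

Lemma linear_mapB x y : T (x - y) = T x - T y.
Proof. by rewrite linear_mapD linear_mapN. Qed.

Lemma linear_map_sum I (r : seq I) (P : pred I) (F : I -> U) :
  T (\sum_(i <- r | P i) F i) = \sum_(i <- r | P i) T (F i).
Proof.
elim/big_rec2: _ => [|i y x _ <-]; first exact: linear_map0.
exact: linear_mapD.
Qed.

End LinearMaps.

Section Spans.
Variables (K : fieldType) (U : lmodType K).
Implicit Types (A S : set U).

Lemma submod0 S : is_submod S -> S 0. Proof. by case. Qed.

Lemma submodZ S c x : is_submod S -> S x -> S (c *: x).
Proof. by case=> S0 SL Sx; rewrite -[_ *: _]addr0; apply: SL. Qed.

Lemma submodD S x y : is_submod S -> S x -> S y -> S (x + y).
Proof. by case=> S0 SL Sx Sy; rewrite -[x]scale1r; apply: SL. Qed.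

Lemma submodN S x : is_submod S -> S x -> S (- x).
Proof. by move=> SS Sx; rewrite -scaleN1r; apply: submodZ. Qed.

Lemma submodB S x y : is_submod S -> S x -> S y -> S (x - y).
Proof. by move=> SS Sx Sy; apply: submodD => //; apply: submodN. Qed.

Lemma submod_sum S I (r : seq I) (P : pred I) (F : I -> U) : is_submod S ->
  (forall i, P i -> S (F i)) -> S (\sum_(i <- r | P i) F i).
Proof.
move=> SS SF; elim/big_ind: _ => //; first exact: submod0.
by move=> x y; apply: submodD.
Qed.

Lemma lspan_submod A : is_submod (lspan A).
Proof.
split=> [S [[S0 _] _] //|c x y Ax Ay S SS].
by case: (SS) => -[_ SL] _; apply: SL; [apply: Ax|apply: Ay].
Qed.

Lemma lspan_gen A x : A x -> lspan A x.
Proof. by move=> Ax S [_]; apply. Qed.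

Lemma lspan_ind A S : is_submod S -> (forall x, A x -> S x) ->
  forall x, lspan A x -> S x.
Proof. by move=> SS AS x; apply; split. Qed.

Lemma lspan_subset A B : (forall x, A x -> lspan B x) ->
  forall x, lspan A x -> lspan B x.
Proof. by apply: lspan_ind; apply: lspan_submod. Qed.

End Spans.

Lemma preim_submod (K : fieldType) (U N : lmodType K) (T : U -> N) (S : set N) :
  linear T -> is_submod S -> is_submod [set x | S (T x)].
Proof.
move=> linT SS; split=> [|c x y] /=; first by rewrite linear_map0 //; apply: submod0.
by move=> Sx Sy; rewrite linT; apply: submodD => //; apply: submodZ.
Qed.

Lemma eq_submod (K : fieldType) (U N : lmodType K) (T T' : U -> N) :
  linear T -> linear T' -> is_submod [set x | T x = T' x].
Proof.
move=> linT linT'; split=> [|c x y] /=; first by rewrite !linear_map0.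
by move=> ex ey; rewrite linT linT' ex ey.
Qed.

Lemma eq_on_lspan (K : fieldType) (U N : lmodType K) (T T' : U -> N) (A : set U) :
  linear T -> linear T' -> (forall x, A x -> T x = T' x) ->
  forall x, lspan A x -> T x = T' x.
Proof. by move=> linT linT'; apply: lspan_ind; apply: eq_submod. Qed.

Lemma kernel_submod (K : fieldType) (U N : lmodType K) (T : U -> N) :
  linear T -> is_submod [set x | T x = 0].
Proof.
move=> linT; split=> [|c x y] /=; first exact: linear_map0.
by move=> ex ey; rewrite linT ex ey scaler0 addr0.
Qed.

Section LinearClosure.
Variables (K : fieldType) (U N P : lmodType K).

Lemma linear_id : linear (fun x : U => x). Proof. by []. Qed.
Lemma linear_zero : linear (fun _ : U => 0 : N).
Proof. by move=> c x y; rewrite scaler0 addr0. Qed.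
Lemma linear_comp (T : N -> P) (T' : U -> N) :
  linear T -> linear T' -> linear (fun x => T (T' x)).
Proof. by move=> l l' c x y; rewrite l' l. Qed.
Lemma linear_add (T T' : U -> N) :
  linear T -> linear T' -> linear (fun x => T x + T' x).
Proof. by move=> l l' c x y; rewrite l l' scalerDr addrACA. Qed.
Lemma linear_scale d (T : U -> N) : linear T -> linear (fun x => d *: T x).
Proof. by move=> l c x y; rewrite l scalerDr !scalerA mulrC. Qed.
Lemma linear_opp (T : U -> N) : linear T -> linear (fun x => - T x).
Proof. by move=> l c x y; rewrite l opprD scalerN. Qed.
Lemma linear_sub (T T' : U -> N) :
  linear T -> linear T' -> linear (fun x => T x - T' x).
Proof. by move=> l l'; apply: linear_add => //; apply: linear_opp. Qed.
Lemma linear_bigsum I (r : seq I) (Q : pred I) (T : I -> U -> N) :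
  (forall i, Q i -> linear (T i)) -> linear (fun x => \sum_(i <- r | Q i) T i x).
Proof.
move=> l c x y; rewrite scaler_sumr -big_split /=.
by apply: eq_bigr => i Qi; rewrite l.
Qed.

End LinearClosure.

Section FiniteSupport.
Variables (I : choiceType).

Definition fsupp (N : zmodType) (F : I -> N) : Prop := finite_set [set i | F i != 0].

Variables (K : fieldType) (N : lmodType K).
Implicit Types F G : I -> N.

Lemma fsum_seq F (r : seq I) : uniq r -> (forall i, i \notin r -> F i = 0) ->
  \sum_(i \in [set: I]) F i = \sum_(i <- r) F i.
Proof.
move=> ur F0; rewrite (fsbig_seq _ _ ur) /=; apply/esym/fsbig_widen => // i [_ /=].
by move/negP/F0.
Qed.

Lemma fsum1 F i : (forall j, j != i -> F j = 0) -> \sum_(j \in [set: I]) F j = F i.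
Proof.
move=> F0; rewrite (@fsum_seq F [:: i]) ?big_seq1 // => j.
by rewrite inE; apply: F0.
Qed.

Lemma fsum0 F : (forall j, F j = 0) -> \sum_(j \in [set: I]) F j = 0.
Proof. by move=> F0; rewrite (@fsum_seq F [::]) ?big_nil. Qed.

Lemma fsuppP F : fsupp F -> exists2 r : seq I, uniq r & forall i, i \notin r -> F i = 0.
Proof.
case/finite_seqP => r Er; exists (undup r); first exact: undup_uniq.
move=> i; rewrite mem_undup => /negP ir; apply/eqP/negPn/negP => Fi.
by apply: ir; have : [set j | F j != 0] i by []; rewrite Er.
Qed.

Lemma fsupp_seq F (r : seq I) : (forall i, i \notin r -> F i = 0) -> fsupp F.
Proof.
move=> F0; apply: (@sub_finite_set _ _ [set` r]); last exact: finite_seq.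
by move=> i /= Fi; apply: contraNT Fi => ir; rewrite F0.
Qed.

Lemma fsum_linear c F G : fsupp F -> fsupp G ->
  \sum_(i \in [set: I]) (c *: F i + G i) =
  c *: (\sum_(i \in [set: I]) F i) + \sum_(i \in [set: I]) G i.
Proof.
move=> /fsuppP[r ur Fr] /fsuppP[s us Gs].
have u : uniq (undup (r ++ s)) by exact: undup_uniq.
rewrite !(fsum_seq u); first by rewrite scaler_sumr -big_split.
all: move=> i; rewrite mem_undup mem_cat negb_or => /andP[ir is'];
  by rewrite ?Fr ?Gs ?scaler0 ?addr0.
Qed.

End FiniteSupport.

(** * The polynomial representation of sl_2[1/T] *)

(** A map on lists defined by recursion descends to multisets as soon as it is
    compatible with [cons] and with the exchange of the first two entries. *)
Lemma perm_eq_rel_ind (X : eqType) (r : seq X -> seq X -> Prop) :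
  (forall s, r s s) -> (forall t s u, r s t -> r t u -> r s u) ->
  (forall x s t, perm_eq s t -> r s t -> r (x :: s) (x :: t)) ->
  (forall x y s, r (x :: y :: s) (y :: x :: s)) ->
  forall s t, perm_eq s t -> r s t.
Proof.
move=> r0 rt rc rs; elim=> [|x s IHs] t st.
  by have /nilP -> : nilp t by rewrite /nilp -(perm_size st).
have xt : x \in t by rewrite -(perm_mem st) mem_head.
case/splitPr: t / xt st => t1 t2 st.
have st' : perm_eq s (t1 ++ t2).
  by rewrite -(perm_cons x); apply: perm_trans st _; rewrite perm_catC /= perm_cons perm_catC.
apply: (rt (x :: t1 ++ t2)); first by apply: rc => //; apply: IHs.
elim: (t1) => //= y t1' IHt; apply: rt (rs _ _ _) _; apply: rc => //.
exact: (permEl (perm_catCA [:: x] t1' t2)).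
Qed.

Section Sym.
Variable K : fieldType.

Definition perm_inv (N : lmodType K) (b : seq nat -> N) : Prop :=
  forall s t, perm_eq s t -> b s = b t.

(** The polynomial ring in commuting variables [x_0, x_1, ...], as the free
    module on the monomials: a list of indices up to permutation. *)
Definition sym := umod perm_inv.
HB.instance Definition _ := GRing.Lmodule.on sym.

Definition mon (s : seq nat) : sym := gen perm_inv s.

Lemma mon_perm : perm_inv mon.
Proof. by move=> s t st; apply: umodP => N b gb; rewrite !ulift_gen //; apply: gb. Qed.

Lemma sym_span u : lspan [set mon s | s in [set: seq nat]] u.
Proof.
rewrite (umod_gen u); apply: submod_sum => [|p _]; first exact: lspan_submod.
by apply: (submodZ _ (lspan_submod _)); apply: lspan_gen; exists p.2.
Qed.

Lemma sym_ext (N : lmodType K) (T T' : sym -> N) : linear T -> linear T' ->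
  (forall s, T (mon s) = T' (mon s)) -> forall u, T u = T' u.
Proof.
move=> l l' e u; apply: (eq_on_lspan l l' _ (sym_span u)).
by move=> _ [s _ <-].
Qed.

Lemma perm_inv_cons (N : lmodType K) (b : seq nat -> N) i :
  perm_inv b -> perm_inv (fun s => b (i :: s)).
Proof. by move=> gb s t st; apply: gb; rewrite perm_cons. Qed.

Definition xmul (i : nat) : sym -> sym := ulift (fun s => mon (i :: s)).

Lemma xmul_linear i : linear (xmul i).
Proof. exact/ulift_linear/perm_inv_cons/mon_perm. Qed.

Lemma xmul_mon i s : xmul i (mon s) = mon (i :: s).
Proof. exact/ulift_gen/perm_inv_cons/mon_perm. Qed.

Lemma xmulC i j u : xmul i (xmul j u) = xmul j (xmul i u).
Proof.
move: u; apply: sym_ext; try (apply: linear_comp; exact: xmul_linear).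
by move=> s; rewrite !xmul_mon; apply: mon_perm; exact: (permEl (perm_catCA [:: i] [:: j] s)).
Qed.

Fixpoint hop_mon (j : nat) (s : seq nat) : sym :=
  if s is i :: s' then xmul i (hop_mon j s') - 2%:R *: mon (i + j :: s') else 0.

Lemma hop_mon_perm j : perm_inv (hop_mon j).
Proof.
apply: perm_eq_rel_ind => //= [t s u -> //|x s t st -> |x y s].
  by congr (_ - _ *: _); apply: mon_perm; rewrite perm_cons.
rewrite !(linear_mapB (@xmul_linear _)) !(linear_mapZ (@xmul_linear _)) !xmul_mon.
rewrite xmulC -!addrA; congr (_ + _); rewrite addrC; congr (- (_ *: _) - _ *: _).
  by apply: mon_perm; exact: (permEl (perm_catCA [:: _] [:: _] _)).
by apply: mon_perm; exact: (permEl (perm_catCA [:: _] [:: _] _)).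
Qed.

(** The derivation sending [x_i] to [-2 x_(i+j)]. *)
Definition hop (j : nat) : sym -> sym := ulift (hop_mon j).

Lemma hop_linear j : linear (hop j).
Proof. exact/ulift_linear/hop_mon_perm. Qed.

Lemma hop_nil j : hop j (mon [::]) = 0.
Proof. exact/ulift_gen/hop_mon_perm. Qed.

Lemma hop_xmul j i u : hop j (xmul i u) = xmul i (hop j u) - 2%:R *: xmul (i + j) u.
Proof.
move: u; apply: sym_ext.
- by apply: linear_comp (@hop_linear _) (@xmul_linear _).
- apply: linear_sub; last by apply: linear_scale; exact: xmul_linear.
  by apply: linear_comp; [exact: xmul_linear|exact: hop_linear].
by move=> s; rewrite !xmul_mon /hop !ulift_gen //; exact: hop_mon_perm.
Qed.

Fixpoint eop_mon (l : nat) (s : seq nat) : sym :=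
  if s is i :: s' then xmul i (eop_mon l s') + hop (l + i) (mon s') else 0.

Lemma eop_mon_perm l : perm_inv (eop_mon l).
Proof.
apply: perm_eq_rel_ind => //= [t s u -> //|x s t st -> |x y s].
  by congr (_ + hop _ _); apply: mon_perm.
rewrite !(linear_mapD (@xmul_linear _)) xmulC -!addrA; congr (_ + _).
rewrite -!xmul_mon !hop_xmul [LHS]addrCA; congr (_ + (_ - _ *: xmul _ _)).
lia.
Qed.

(** The second-order operator [- \sum_(i, i') x_(i+i'+l) d_i d_i']. *)
Definition eop (l : nat) : sym -> sym := ulift (eop_mon l).

Lemma eop_linear l : linear (eop l).
Proof. exact/ulift_linear/eop_mon_perm. Qed.

Lemma eop_nil l : eop l (mon [::]) = 0.
Proof. exact/ulift_gen/eop_mon_perm. Qed.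

Lemma eop_xmul l i u : eop l (xmul i u) = xmul i (eop l u) + hop (l + i) u.
Proof.
move: u; apply: sym_ext.
- by apply: linear_comp (@eop_linear _) (@xmul_linear _).
- apply: linear_add; last exact: hop_linear.
  by apply: linear_comp; [exact: xmul_linear|exact: eop_linear].
by move=> s; rewrite !xmul_mon /eop !ulift_gen //; exact: eop_mon_perm.
Qed.

(** The remaining commutators annihilate the constants and, by the Jacobi
    identity, are determined by their brackets with multiplications. *)
Lemma sym_induction (T T' : sym -> sym) : linear T -> linear T' ->
  T (mon [::]) = T' (mon [::]) ->
  (forall i u, T u = T' u -> T (xmul i u) = T' (xmul i u)) ->
  forall u, T u = T' u.
Proof.
move=> l l' e0 eS; apply: sym_ext => //.
by elim=> // i s IHs; rewrite -xmul_mon; apply: eS.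
Qed.

Let linX i := @xmul_linear i.
Let linH i := @hop_linear i.
Let linE i := @eop_linear i.

Lemma hop_comm i j u : hop i (hop j u) = hop j (hop i u).
Proof.
move: u; apply: sym_induction; try (by apply: linear_comp).
  by rewrite !hop_nil !linear_map0.
move=> p u IH; rewrite !hop_xmul !(linear_mapB (linH _)) !(linear_mapZ (linH _)).
rewrite !hop_xmul IH !scalerBr -!addrA; congr (_ + _).
rewrite ![in RHS]opprB ![in LHS]opprB.
rewrite (_ : (p + j + i)%N = (p + i + j)%N); last by lia.
by rewrite addrCA [RHS]addrCA; congr (_ + _); rewrite addrC.
Qed.

Lemma hop_eop_comm j l u : hop j (eop l u) = eop l (hop j u) + 2%:R *: eop (l + j) u.
Proof.
move: u; apply: sym_induction.
- by apply: linear_comp.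
- by apply: linear_add; [apply: linear_comp|apply: linear_scale].
- by rewrite hop_nil !eop_nil (linear_map0 (linH _)) (linear_map0 (linE _)) scaler0 addr0.
move=> p u IH; rewrite hop_xmul !eop_xmul !(linear_mapB (linE _)) !(linear_mapZ (linE _)).
rewrite !(linear_mapD (linH _)) hop_xmul !eop_xmul IH (linear_mapD (linX _)).
rewrite !(linear_mapZ (linX _)) hop_comm !scalerDr.
rewrite (_ : (l + (p + j))%N = (l + j + p)%N); last by lia.
set a := xmul _ _; set b := _ *: xmul _ (eop (l + j) u); set c := _ *: xmul _ _.
set d := hop _ _; set e := _ *: hop _ _.
by rewrite [RHS]addrAC [a + d + _]addrA opprD addrACA subrr addr0 [a + d + b]addrAC [RHS]addrAC.
Qed.

Lemma eop_comm i j u : eop i (eop j u) = eop j (eop i u).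
Proof.
move: u; apply: sym_induction; try (by apply: linear_comp).
  by rewrite !eop_nil !(linear_map0 (linE _)).
move=> p u IH; rewrite !eop_xmul !(linear_mapD (linE _)) !eop_xmul IH.
rewrite !hop_eop_comm -!addrA; congr (_ + _).
rewrite [LHS]addrCA [RHS]addrCA; congr (_ *: eop _ _ + _); first by lia.
by rewrite addrC.
Qed.

(** ** Grading by number of variables and total index *)

Definition homog (d m : nat) : set sym :=
  lspan [set mon s | s in [set s | size s = d /\ sumn s = m]].

Lemma homog_submod d m : is_submod (homog d m).
Proof. exact: lspan_submod. Qed.

Lemma homog_mon s : homog (size s) (sumn s) (mon s).
Proof. by apply: lspan_gen; exists s. Qed.

Lemma homog_map (T : sym -> sym) d m (S : set sym) : linear T -> is_submod S ->
  (forall s, size s = d -> sumn s = m -> S (T (mon s))) ->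
  forall u, homog d m u -> S (T u).
Proof.
move=> lT SS ST; apply: lspan_ind; first exact: preim_submod.
by move=> _ [s [ds ms] <-]; apply: ST.
Qed.

Lemma homog_xmul i d m u : homog d m u -> homog d.+1 (i + m)%N (xmul i u).
Proof.
apply: (homog_map (linX _) (homog_submod _ _)).
by move=> s <- <-; rewrite xmul_mon; apply: (@homog_mon (i :: s)).
Qed.

Lemma homog_hop j d m u : homog d m u -> homog d (m + j)%N (hop j u).
Proof.
apply: (homog_map (linH _) (homog_submod _ _)).
move=> s <- <-; elim: s => [|i s IHs]; first by rewrite hop_nil; apply: submod0 (homog_submod _ _).
rewrite -xmul_mon hop_xmul; apply: (submodB (homog_submod _ _)).
  by rewrite /= -addnA; apply: homog_xmul.
apply: (submodZ _ (homog_submod _ _)); rewrite xmul_mon.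
by have := @homog_mon (i + j :: s)%N; rewrite /= addnAC.
Qed.

Lemma homog_eop l d m u : homog d.+1 m u -> homog d (m + l)%N (eop l u).
Proof.
apply: (homog_map (linE _) (homog_submod _ _)).
move=> s; elim: s d m => [|i s IHs] // d m [<-] <- /=.
rewrite -xmul_mon eop_xmul; apply: (submodD (homog_submod _ _)); last first.
  rewrite (_ : (i + sumn s + l)%N = (sumn s + (l + i))%N); last by lia.
  by apply: homog_hop; apply: homog_mon.
case: s IHs => [|i' s] IHs.
  by rewrite eop_nil linear_map0 //; apply: submod0 (homog_submod _ _).
by rewrite /= -[(_ + _ + l)%N]addnA; apply: homog_xmul; apply: IHs.
Qed.

(** ** Coefficients *)

Lemma coef_perm_inv (t : seq nat) : perm_inv (fun s => (perm_eq s t)%:R : K^o).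
Proof. by move=> s s' ss'; rewrite (permPl ss'). Qed.

Definition coef (t : seq nat) : sym -> K^o := ulift (fun s => (perm_eq s t)%:R : K^o).

Lemma coef_linear t : linear (coef t).
Proof. exact/ulift_linear/coef_perm_inv. Qed.

Lemma coef_mon t s : coef t (mon s) = (perm_eq s t)%:R.
Proof. exact/ulift_gen/coef_perm_inv. Qed.

Lemma coef_homog t d m u : homog d m u -> (size t, sumn t) != (d, m) -> coef t u = 0.
Proof.
move=> hu tdm; move: u hu; apply: (lspan_ind (kernel_submod (@coef_linear t))).
move=> _ [s [ds ms] <-]; rewrite /= coef_mon; case: (boolP (perm_eq s t)) => // st.
by rewrite -ds -ms (perm_size st) (perm_sumn st) eqxx in tdm.
Qed.

End Sym.

(** * The affine algebra and the subalgebra of currents regular at infinity *)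

Section Currents.
Variable K : fieldType.
Local Notation affine := (affine K).
Local Notation mx_e := (mx_e K).
Local Notation mx_f := (mx_f K).
Local Notation mx_h := (mx_h K).
Local Notation central := (central K).

(** The two triangular orderings of the statement are treated at once: on the
    side [false] the free variables are the [f T^-i], on the side [true] they
    are the [e T^-i], and [sgn] is the sign of the involution exchanging them. *)
Definition mxa (s : bool) : 'M[K]_2 := if s then mx_e else mx_f.
Definition mxc (s : bool) : 'M[K]_2 := if s then mx_f else mx_e.
Definition sgn (s : bool) : K := if s then -1 else 1.

Lemma sgn_sq s : sgn s * sgn s = 1.
Proof. by case: s; rewrite /sgn ?mulrNN mulr1. Qed.

Lemma mx2P (a b : 'M[K]_2) : a 0 0 = b 0 0 -> a 0 1 = b 0 1 -> a 1 0 = b 1 0 ->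
  a 1 1 = b 1 1 -> a = b.
Proof.
move=> e00 e01 e10 e11; apply/matrixP => i j.
have o2 (k : 'I_2) : k = 0 \/ k = 1.
  by case: k => [[|[|//]]] lt; [left|right]; apply: val_inj.
by case: (o2 i) => ->; case: (o2 j) => ->.
Qed.

Lemma mx2_mulE (a b : 'M[K]_2) i j : (a *m b) i j = a i 0 * b 0 j + a i 1 * b 1 j.
Proof.
rewrite mxE big_ord_recl big_ord1; congr (_ + a _ _ * b _ _);
  by apply: val_inj.
Qed.

Lemma mx2_trE (a : 'M[K]_2) : \tr a = a 0 0 + a 1 1.
Proof.
rewrite /mxtrace big_ord_recl big_ord1; congr (_ + a _ _); exact: val_inj.
Qed.

Lemma mx2_subE (a b : 'M[K]_2) i j : (a - b) i j = a i j - b i j.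
Proof. by rewrite !mxE. Qed.

Ltac mx2 := apply: mx2P; rewrite /comm_mx2 ?mx2_subE ?mx2_mulE ?mxE /=; ring.

Lemma commNC (a b : 'M[K]_2) : comm_mx2 a b = - comm_mx2 b a.
Proof. by rewrite /comm_mx2 opprB. Qed.

Lemma comm_aa s : comm_mx2 (mxa s) (mxa s) = 0.
Proof. by rewrite /comm_mx2 subrr. Qed.
Lemma comm_cc s : comm_mx2 (mxc s) (mxc s) = 0.
Proof. by rewrite /comm_mx2 subrr. Qed.
Lemma comm_hh : comm_mx2 mx_h mx_h = 0.
Proof. by rewrite /comm_mx2 subrr. Qed.
Lemma comm_ca s : comm_mx2 (mxc s) (mxa s) = sgn s *: mx_h.
Proof. by case: s; rewrite /sgn; mx2. Qed.
Lemma comm_ha s : comm_mx2 mx_h (mxa s) = (- 2%:R * sgn s) *: mxa s.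
Proof. by case: s; rewrite /sgn; mx2. Qed.
Lemma comm_hc s : comm_mx2 mx_h (mxc s) = (2%:R * sgn s) *: mxc s.
Proof. by case: s; rewrite /sgn; mx2. Qed.

Lemma tr_aa s : \tr (mxa s *m mxa s) = 0.
Proof. by case: s; rewrite mx2_trE !mx2_mulE !mxE /=; ring. Qed.
Lemma tr_cc s : \tr (mxc s *m mxc s) = 0.
Proof. by case: s; rewrite mx2_trE !mx2_mulE !mxE /=; ring. Qed.
Lemma tr_hh : \tr (mx_h *m mx_h) = 2%:R.
Proof. by rewrite mx2_trE !mx2_mulE !mxE /=; ring. Qed.
Lemma tr_ca s : \tr (mxc s *m mxa s) = 1.
Proof. by case: s; rewrite mx2_trE !mx2_mulE !mxE /=; ring. Qed.
Lemma tr_ha s : \tr (mx_h *m mxa s) = 0.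
Proof. by case: s; rewrite mx2_trE !mx2_mulE !mxE /=; ring. Qed.
Lemma tr_hc s : \tr (mx_h *m mxc s) = 0.
Proof. by case: s; rewrite mx2_trE !mx2_mulE !mxE /=; ring. Qed.

Lemma tr_mxa s : \tr (mxa s) = 0.
Proof. by case: s; rewrite mx2_trE !mxE /=; ring. Qed.
Lemma tr_mxc s : \tr (mxc s) = 0.
Proof. by case: s; rewrite mx2_trE !mxE /=; ring. Qed.

Lemma loop_linear i : linear (fun a : 'M[K]_2 => loop a i).
Proof.
move=> c a b; rewrite /loop; congr pair => /=.
  apply/funext => j; rewrite -[RHS]/(c *: (if j == i then a else 0) + (if j == i then b else 0)).
  by case: eqP => // _; rewrite scaler0 addr0.
exact/esym/(etrans (addr0 _))/mulr0.
Qed.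

Lemma sl2hat_loop a i : \tr a = 0 -> sl2hat (loop a i : affine).
Proof.
move=> ta; split=> [|j] /=; last by case: ifP => // _; rewrite mxtrace0.
apply: (@fsupp_seq _ _ _ _ [:: i]) => j; rewrite inE => /negPf /= ->; reflexivity.
Qed.

Lemma sl2hat_central : sl2hat central.
Proof.
split=> [|j] /=; last by rewrite mxtrace0.
by apply: (@fsupp_seq _ _ _ _ [::]).
Qed.

Lemma sl2hat_submod : is_submod (@sl2hat K).
Proof.
split=> [|c x y [fx tx] [fy ty]].
  by split=> [|j] /=; [apply: (@fsupp_seq _ _ _ _ [::])|rewrite mxtrace0].
split=> [|j]; last by rewrite -[_.1 j]/(c *: x.1 j + y.1 j) raddfD /= linearZ /= tx ty mulr0 addr0.
have [r _ xr] := fsuppP fx; have [s _ ys] := fsuppP fy.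
apply: (@fsupp_seq _ _ _ _ (r ++ s)) => j; rewrite mem_cat negb_or => /andP[jr js].
by rewrite -[_.1 j]/(c *: x.1 j + y.1 j) xr // ys // scaler0 addr0.
Qed.

Lemma sl2hat_fsupp (x : affine) : sl2hat x -> fsupp x.1. Proof. by case. Qed.

Lemma comm_linear_l b : linear (fun a : 'M[K]_2 => comm_mx2 a b).
Proof.
move=> c x y; rewrite /comm_mx2 mulmxDl mulmxDr -scalemxAl -scalemxAr.
by rewrite scalerBr opprD addrACA.
Qed.

Lemma comm_linear_r b : linear (fun a : 'M[K]_2 => comm_mx2 b a).
Proof.
move=> c x y; rewrite ![comm_mx2 b _]commNC comm_linear_l.
by rewrite opprD scalerN.
Qed.

Lemma fsupp_sub (I : choiceType) (N N' : zmodType) (F : I -> N) (G : I -> N') :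
  fsupp F -> (forall i, F i = 0 -> G i = 0) -> fsupp G.
Proof.
move=> fF FG; apply: sub_finite_set fF => i /=.
by apply: contra_neq => /FG.
Qed.

(** [brack] is a sum over all degrees, so that it is linear only on elements
    of finite support. *)
Lemma brack_linear_l (c : K) (x y w : affine) : sl2hat x -> sl2hat y ->
  brack (c *: x + y) w = c *: brack x w + brack y w.
Proof.
move=> /sl2hat_fsupp fx /sl2hat_fsupp fy; rewrite /brack; congr pair => /=.
  apply/funext => m.
  rewrite -[RHS]/(c *: (\sum_(i \in setT) comm_mx2 (x.1 i) (w.1 (m - i))) +
    \sum_(i \in setT) comm_mx2 (y.1 i) (w.1 (m - i))).
  rewrite -fsum_linear.
  - by apply: eq_fsbigr => i _; rewrite -comm_linear_l.
  - by apply: fsupp_sub fx _ => i ->; apply: (linear_map0 (comm_linear_l _)).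
  - by apply: fsupp_sub fy _ => i ->; apply: (linear_map0 (comm_linear_l _)).
have E (F : int -> K^o) : (\sum_(i \in setT) F i : K^o) = \sum_(i \in setT) (F i : K) by [].
rewrite -[RHS]/(c *: (\sum_(i \in setT) (i%:~R * \tr (x.1 i *m w.1 (- i)) : K^o)) +
    \sum_(i \in setT) (i%:~R * \tr (y.1 i *m w.1 (- i)) : K^o)).
rewrite -fsum_linear.
- apply: eq_fsbigr => i _; rewrite -[(c *: x.1 + y.1) i]/(c *: x.1 i + y.1 i).
  rewrite mulmxDl -scalemxAl mxtraceD mxtraceZ mulrDr mulrCA; reflexivity.
- by apply: fsupp_sub fx _ => i ->; rewrite mul0mx mxtrace0 mulr0.
- by apply: fsupp_sub fy _ => i ->; rewrite mul0mx mxtrace0 mulr0.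
Qed.

Lemma brack_linear_r (c : K) (x y w : affine) : sl2hat w ->
  brack w (c *: x + y) = c *: brack w x + brack w y.
Proof.
move=> /sl2hat_fsupp fw; rewrite /brack; congr pair => /=.
  apply/funext => m.
  rewrite -[RHS]/(c *: (\sum_(i \in setT) comm_mx2 (w.1 i) (x.1 (m - i))) +
    \sum_(i \in setT) comm_mx2 (w.1 i) (y.1 (m - i))).
  rewrite -fsum_linear.
  - by apply: eq_fsbigr => i _; rewrite -comm_linear_r.
  - by apply: fsupp_sub fw _ => i ->; apply: (linear_map0 (comm_linear_l _)).
  - by apply: fsupp_sub fw _ => i ->; apply: (linear_map0 (comm_linear_l _)).
rewrite -[RHS]/(c *: (\sum_(i \in setT) (i%:~R * \tr (w.1 i *m x.1 (- i)) : K^o)) +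
    \sum_(i \in setT) (i%:~R * \tr (w.1 i *m y.1 (- i)) : K^o)).
rewrite -fsum_linear.
- apply: eq_fsbigr => i _; rewrite -[(c *: x.1 + y.1) (-i)]/(c *: x.1 (-i) + y.1 (-i)).
  rewrite mulmxDr -scalemxAr mxtraceD mxtraceZ mulrDr mulrCA; reflexivity.
- by apply: fsupp_sub fw _ => i ->; rewrite mul0mx mxtrace0 mulr0.
- by apply: fsupp_sub fw _ => i ->; rewrite mul0mx mxtrace0 mulr0.
Qed.

(** Polynomials in [1/T] without central component: no central term arises in
    the bracket of two such currents. *)
Definition current_gen : set affine :=
  [set x | exists (a : 'M[K]_2) (i : nat), \tr a = 0 /\ x = loop a (- i%:Z)].
Definition currents : set affine := lspan current_gen.

Lemma current_loop a (i : nat) : \tr a = 0 -> currents (loop a (- i%:Z)).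
Proof. by move=> ta; apply: lspan_gen; exists a, i. Qed.

Lemma currents_sl2hat x : currents x -> sl2hat x.
Proof.
apply: (lspan_ind sl2hat_submod) => _ [a [i [ta ->]]]; exact: sl2hat_loop.
Qed.

Lemma brack_current (a b : 'M[K]_2) (i j : nat) :
  brack (loop a (- i%:Z)) (loop b (- j%:Z)) = loop (comm_mx2 a b) (- (i + j)%N%:Z).
Proof.
rewrite brack_loop -opprD -PoszD; case: ifP => [|_]; last by rewrite scale0r addr0.
rewrite oppr_eq0 => /eqP; case: i => [|//] _.
by rewrite oppr0 mul0r scale0r addr0.
Qed.

Lemma tr_comm (a b : 'M[K]_2) : \tr (comm_mx2 a b) = 0.
Proof. by rewrite /comm_mx2 raddfB /= mxtrace_mulC subrr. Qed.

Lemma currents_ind2 (R : affine -> affine -> Prop) :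
  (forall x, current_gen x -> is_submod [set y | currents y /\ R x y]) ->
  (forall y, currents y -> is_submod [set x | currents x /\ R x y]) ->
  (forall a b (i j : nat), \tr a = 0 -> \tr b = 0 ->
     R (loop a (- i%:Z)) (loop b (- j%:Z))) ->
  forall x y, currents x -> currents y -> R x y.
Proof.
move=> lr ll g x y cx cy; suff [] : currents x /\ R x y by [].
move: x cx; apply: (lspan_ind (ll y cy)) => x gx; split; first exact: lspan_gen.
suff [] : currents y /\ R x y by [].
move: y cy; apply: (lspan_ind (lr x gx)) => y gy; split; first exact: lspan_gen.
by case: gx => a [i [ta ->]]; case: gy => b [j [tb ->]]; apply: g.
Qed.

Lemma currents_submod : is_submod currents.
Proof. exact: lspan_submod. Qed.

Lemma currents_subalg : is_subalg currents.
Proof.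
split=> [|x y]; first exact: currents_submod.
have CS := currents_submod.
apply: (currents_ind2 (R := fun x y => currents (brack x y))).
- move=> {}x /lspan_gen gx; split=> [|c u v [cu bu] [cv bv]]; split=> /=.
  + exact: (submod0 CS).
  + have := @brack_linear_r (-1) 0 0 x (currents_sl2hat gx).
    rewrite scaler0 addr0 scaleN1r addNr => ->; exact: (submod0 CS).
  + by apply: (submodD CS) => //; apply: (submodZ _ CS).
  + rewrite brack_linear_r; last exact: currents_sl2hat.
    by apply: (submodD CS) => //; apply: (submodZ _ CS).
- move=> {}y gy; split=> [|c u v [cu bu] [cv bv]]; split=> /=.
  + exact: (submod0 CS).
  + have := @brack_linear_l (-1) 0 0 y (submod0 sl2hat_submod) (submod0 sl2hat_submod).
    rewrite scaler0 addr0 scaleN1r addNr => ->; exact: (submod0 CS).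
  + by apply: (submodD CS) => //; apply: (submodZ _ CS).
  + rewrite brack_linear_l; try exact: currents_sl2hat.
    by apply: (submodD CS) => //; apply: (submodZ _ CS).
- move=> a b i j ta tb; rewrite brack_current; apply: current_loop; exact: tr_comm.
Qed.

Lemma nminus_currents x : @nminus K x -> currents x.
Proof.
apply: (smallest_sub (X := currents)); first exact: currents_subalg.
by move=> _ [->|->]; [apply: (@current_loop _ 0); exact: tr_f|apply: (@current_loop _ 1); exact: tr_e].
Qed.

Lemma nminus_sl2hat x : @nminus K x -> sl2hat x.
Proof. by move/nminus_currents/currents_sl2hat. Qed.

(** In the coordinates of [m] along the free direction, [h] and the opposite
    direction: a multiplication, a derivation, a second-order operator. *)
Definition current_act (s : bool) (m : 'M[K]_2) (i : nat) (u : sym K) : sym K :=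
  m (if s then 0 else 1) (if s then 1 else 0) *: xmul i u
  + ((sgn s * m 0 0) *: hop i u
     + m (if s then 1 else 0) (if s then 0 else 1) *: eop i u).

Definition sym_act (s : bool) (x : affine) (u : sym K) : sym K :=
  \sum_(i \in [set: nat]) current_act s (x.1 (- i%:Z)) i u.

Lemma current_act_linear s m i : linear (current_act s m i).
Proof.
apply: linear_add; first by apply: linear_scale; apply: xmul_linear.
apply: linear_add; first by apply: linear_scale; apply: hop_linear.
by apply: linear_scale; apply: eop_linear.
Qed.

Lemma current_act_mx s i u : linear (fun m => current_act s m i u).
Proof.
move=> c m m'; rewrite /current_act !mxE mulrDr !scalerDl [sgn s * (c * _)]mulrCA -!scalerA !scalerDr.
by rewrite [RHS]addrACA; congr (_ + _); rewrite addrACA.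
Qed.

Lemma current_act_a s i u : current_act s (mxa s) i u = xmul i u.
Proof. by case: s; rewrite /current_act !mxE /= ?mulr0 !scale0r scale1r !addr0. Qed.
Lemma current_act_c s i u : current_act s (mxc s) i u = eop i u.
Proof. by case: s; rewrite /current_act !mxE /= ?mulr0 !scale0r scale1r !add0r. Qed.
Lemma current_act_h s i u : current_act s mx_h i u = sgn s *: hop i u.
Proof.
by case: s; rewrite /current_act !mxE /= ?subr0 !scale0r mulr1 add0r addr0.
Qed.

Lemma fsupp_current (x : affine) s u : sl2hat x ->
  fsupp (fun i : nat => current_act s (x.1 (- i%:Z)) i u).
Proof.
move=> /sl2hat_fsupp/fsuppP[r _ xr].
apply: (@fsupp_seq _ _ _ _ [seq `|j|%N | j <- r]) => i ir.
rewrite xr ?(linear_map0 (current_act_mx _ _ _)) //.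
by apply: contra ir => ir; apply/mapP; exists (- i%:Z) => //; rewrite abszN.
Qed.

Lemma sym_act_linear s x : sl2hat x -> linear (sym_act s x).
Proof.
move=> hx c u v; rewrite /sym_act -fsum_linear; try exact: fsupp_current.
by apply: eq_fsbigr => i _; rewrite current_act_linear.
Qed.

Lemma sym_act_linear_l s c x y u : sl2hat x -> sl2hat y ->
  sym_act s (c *: x + y) u = c *: sym_act s x u + sym_act s y u.
Proof.
move=> hx hy; rewrite /sym_act -fsum_linear; try exact: fsupp_current.
by apply: eq_fsbigr => i _; rewrite -current_act_mx.
Qed.

Lemma sym_act_loop s a (i : nat) u :
  sym_act s (loop a (- i%:Z)) u = current_act s a i u.
Proof.
rewrite /sym_act (fsum1 (i := i)) /= ?eqxx // => j /negPf ji.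
by rewrite eqr_opp eqz_nat ji (linear_map0 (current_act_mx _ _ _)).
Qed.

Lemma mx2_decomp s (a : 'M[K]_2) : \tr a = 0 ->
  exists x y z : K, a = x *: mxa s + (y *: mx_h + z *: mxc s).
Proof.
rewrite mx2_trE => /eqP; rewrite addr_eq0 => /eqP a00.
exists (a (if s then 0 else 1) (if s then 1 else 0)), (a 0 0),
  (a (if s then 1 else 0) (if s then 0 else 1)).
by case: s; apply: mx2P; rewrite !mxE /= ?a00; ring.
Qed.

Lemma current_act_comm s a b i j u : \tr a = 0 -> \tr b = 0 ->
  current_act s (comm_mx2 a b) (i + j) u =
  current_act s a i (current_act s b j u) - current_act s b j (current_act s a i u).
Proof.
pose R a b := forall i j u, current_act s (comm_mx2 a b) (i + j) u =
  current_act s a i (current_act s b j u) - current_act s b j (current_act s a i u).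
have RN x y : R x y -> R y x.
  by move=> r {}i {}j {}u; rewrite commNC (linear_mapN (current_act_mx _ _ _)) addnC r opprB.
have RL y x z c : R x y -> R z y -> R (c *: x + z) y.
  move=> rx rz {}i {}j {}u; rewrite comm_linear_l !current_act_mx rx rz.
  rewrite (current_act_linear s y j c (current_act s x i u)).
  by rewrite scalerBr [in RHS]opprD addrACA.
have RR y x z c : R y x -> R y z -> R y (c *: x + z).
  by move=> rx rz; apply/RN/RL; apply/RN.
have R0 y : R 0 y.
  move=> {}i {}j {}u; rewrite (linear_map0 (comm_linear_l _)).
  rewrite !(linear_map0 (current_act_mx _ _ _)) (linear_map0 (current_act_linear _ _ _)).
  by rewrite subrr.
have basic x y : x \in [:: mxa s; mx_h; mxc s] -> y \in [:: mxa s; mx_h; mxc s] -> R x y.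
  have Raa : R (mxa s) (mxa s).
    move=> {}i {}j {}u; rewrite comm_aa (linear_map0 (current_act_mx _ _ _)).
    by rewrite !current_act_a xmulC subrr.
  have Rcc : R (mxc s) (mxc s).
    move=> {}i {}j {}u; rewrite comm_cc (linear_map0 (current_act_mx _ _ _)).
    by rewrite !current_act_c eop_comm subrr.
  have Rhh : R mx_h mx_h.
    move=> {}i {}j {}u; rewrite comm_hh (linear_map0 (current_act_mx _ _ _)).
    by rewrite !current_act_h !(linear_mapZ (@hop_linear _ _)) hop_comm subrr.
  have Rha : R mx_h (mxa s).
    move=> {}i {}j {}u; rewrite comm_ha (linear_mapZ (current_act_mx _ _ _)).
    rewrite !current_act_a !current_act_h hop_xmul !(linear_mapZ (@xmul_linear _ _)).
    by rewrite -scalerBr addrAC subrr add0r scalerN scalerA addnC mulNr scaleNr [2%:R * _]mulrC.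
  have Rhc : R mx_h (mxc s).
    move=> {}i {}j {}u; rewrite comm_hc (linear_mapZ (current_act_mx _ _ _)).
    rewrite !current_act_c !current_act_h hop_eop_comm !(linear_mapZ (@eop_linear _ _)).
    by rewrite -scalerBr addrAC subrr add0r scalerA addnC [2%:R * _]mulrC.
  have Rca : R (mxc s) (mxa s).
    move=> {}i {}j {}u; rewrite comm_ca (linear_mapZ (current_act_mx _ _ _)).
    rewrite !current_act_a !current_act_c current_act_h scalerA sgn_sq scale1r.
    by rewrite eop_xmul addrAC subrr add0r.
  rewrite !inE => /or3P[] /eqP -> /or3P[] /eqP -> //; by apply/RN.
move=> ta tb; suff r : R a b by exact: r.
have span x (S : 'M[K]_2 -> Prop) : \tr x = 0 -> S 0 ->
    (forall c u v, S u -> S v -> S (c *: u + v)) ->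
    (forall u, u \in [:: mxa s; mx_h; mxc s] -> S u) -> S x.
  move=> tx S0 SL Sg; have [p [q [r ->]]] := mx2_decomp s tx.
  apply: (SL); first by apply: Sg; rewrite !inE eqxx.
  apply: (SL); first by apply: Sg; rewrite !inE eqxx orbT.
  by rewrite -[r *: _]addr0; apply: SL => //; apply: Sg; rewrite !inE eqxx !orbT.
apply: (span a (R^~ b)) => // [c x y|x xg]; first exact: RL.
apply: (span b (R x)) => // [|c y z|y yg]; [exact: RN|exact: RR|exact: basic].
Qed.

(** Polynomials carry the representation of the currents induced from the
    trivial representation of the subalgebra without the free direction. Being
    explicit, it stands in for the theorem of Poincare, Birkhoff and Witt: the
    Verma module maps to it, and the coefficients of polynomials are the dual
    basis vectors. *)
Theorem sym_act_rep s : is_rep currents (sym_act s).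
Proof.
have CS := currents_submod.
split=> [x /currents_sl2hat|c x y u /currents_sl2hat hx /currents_sl2hat hy|].
- exact: sym_act_linear.
- exact: sym_act_linear_l.
move=> x y u cx cy; move: x y cx cy u.
have act0 u : sym_act s 0 u = 0.
  by apply: fsum0 => i; rewrite (linear_map0 (current_act_mx _ _ _)).
have brC x y : currents x -> currents y -> currents (brack x y).
  by case: currents_subalg => _; apply.
apply: currents_ind2 => [x gx|y gy|a b i j ta tb u]; last first.
- by rewrite brack_current !sym_act_loop current_act_comm.
- have hS := currents_sl2hat; split=> [|c v w [cv bv] [cw bw]]; split=> /=.
  + exact: (submod0 CS).
  + move=> u; have := @brack_linear_l (-1) 0 0 y (submod0 sl2hat_submod) (submod0 sl2hat_submod).
    rewrite scaler0 addr0 scaleN1r addNr => ->.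
    by rewrite !act0 (linear_map0 (sym_act_linear s (hS _ gy))) subrr.
  + by apply: (submodD CS) => //; apply: (submodZ _ CS).
  move=> u; rewrite brack_linear_l; try exact: hS.
  rewrite !sym_act_linear_l; try (by apply: hS; auto).
  rewrite bv bw (sym_act_linear s (hS _ gy)) scalerBr opprD addrACA; reflexivity.
- have hS := currents_sl2hat; have cx := lspan_gen gx.
  split=> [|c v w [cv bv] [cw bw]]; split=> /=.
  + exact: (submod0 CS).
  + move=> u; have := @brack_linear_r (-1) 0 0 x (hS _ cx).
    rewrite scaler0 addr0 scaleN1r addNr => ->.
    by rewrite !act0 (linear_map0 (sym_act_linear s (hS _ cx))) subrr.
  + by apply: (submodD CS) => //; apply: (submodZ _ CS).
  move=> u; rewrite brack_linear_r; last by apply: hS.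
  rewrite !sym_act_linear_l; try (by apply: hS; auto).
  rewrite bv bw (sym_act_linear s (hS _ cx)) scalerBr opprD addrACA; reflexivity.
Qed.

End Currents.

(** * Verma modules *)

Section Generation.
Variable K : fieldType.
Hypothesis two_neq0 : 2%:R != 0 :> K.
Local Notation affine := (affine K).

(** The currents in [n_-] are iterated brackets of [f_1] and [f_2]; the index
    pair records how often each generator is used. *)
Lemma nminus_graded_ind (S : nat -> nat -> affine -> Prop) :
  (forall c p q x, S p q x -> S p q (c *: x)) ->
  (forall p q p' q' x y, S p q x -> S p' q' y -> S (p + p')%N (q + q')%N (brack x y)) ->
  S 1%N 0%N (aff_f1 K) -> S 0%N 1%N (aff_f2 K) ->
  [/\ forall i, S i.+1 i (loop (mx_f K) (- i%:Z)),
      forall j, S j.+1 j.+1 (loop (mx_h K) (- j.+1%:Z))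
    & forall l, S l l.+1 (loop (mx_e K) (- l.+1%:Z))].
Proof.
move=> SZ SB S1 S2.
have h1 : S 1%N 1%N (loop (mx_h K) (- 1%:Z)).
  have := SB _ _ _ _ _ _ S2 S1; rewrite (@brack_current _ _ _ 1 0).
  by rewrite (comm_ca _ false) /sgn scale1r.
have Sf i : S i.+1 i (loop (mx_f K) (- i%:Z)).
  elim: i => // i IHi; have := SB _ _ _ _ _ _ h1 IHi.
  rewrite brack_current (comm_ha _ false) !add1n => /(SZ (- 2%:R)^-1).
  rewrite -(linear_mapZ (loop_linear _)) scalerA mulr1 mulVf ?oppr_eq0 // scale1r; exact.
have Se l : S l l.+1 (loop (mx_e K) (- l.+1%:Z)).
  elim: l => // l IHl; have := SB _ _ _ _ _ _ h1 IHl.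
  rewrite brack_current (comm_hc _ false) !add1n => /(SZ 2%:R^-1).
  rewrite -(linear_mapZ (loop_linear _)) scalerA mulr1 mulVf // scale1r; exact.
split=> // j; have := SB _ _ _ _ _ _ S2 (Sf j).
by rewrite (@brack_current _ _ _ 1) (comm_ca _ false) /sgn scale1r add0n.
Qed.

End Generation.

Section Words.
Variables (K : fieldType) (V : affmod K).

Definition words : set V := [set x | exists w, x = word V w].

Definition wspan_pred : {pred V} := fun u => `[< lspan words u >].

Fact wspan_submod : submod_closed wspan_pred.
Proof.
split=> [|c x y /asboolP wx /asboolP wy]; apply/asboolP.
  exact: (submod0 (lspan_submod _)).
by apply: (submodD (lspan_submod _)) => //; apply: (submodZ _ (lspan_submod _)).
Qed.

HB.instance Definition _ :=
  GRing.isSubmodClosed.Build K V wspan_pred wspan_submod.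

(** The span of the words as a type, to serve as the target of a map given by
    the universal property of the Verma module. *)
Record wspan := MkWspan { wspan_val :> V; _ : wspan_val \in wspan_pred }.

HB.instance Definition _ := [isSub for wspan_val].
HB.instance Definition _ := [Choice of wspan by <:].
HB.instance Definition _ := [SubChoice_isSubLmodule of wspan by <:].

End Words.

Section Verma.
Variable K : fieldType.
Hypothesis two_neq0 : 2%:R != 0 :> K.
Variables (V : affmod K) (M k : K).
Hypothesis hV : is_verma M k V.
Local Notation v := (vac V).
Local Notation affine := (affine K).

Lemma aact_linear (x : affine) : sl2hat x -> linear (aact x : V -> V).
Proof. by case: (verma_rep hV) => + _ _; apply. Qed.

Lemma aact_linear_l c (x y : affine) (u : V) : sl2hat x -> sl2hat y ->
  aact (c *: x + y) u = c *: aact x u + aact y u.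
Proof. by case: (verma_rep hV) => _ + _; apply. Qed.

Lemma aact_brack (x y : affine) (u : V) : sl2hat x -> sl2hat y ->
  aact (brack x y) u = aact x (aact y u) - aact y (aact x u).
Proof. by case: (verma_rep hV) => _ _; apply. Qed.

Lemma aactZ c (x : affine) (u : V) : sl2hat x -> aact (c *: x) u = c *: aact x u.
Proof.
move=> hx; have := aact_linear_l (-1) u hx hx; rewrite scaleN1r addNr scaleN1r addNr => a0.
have := aact_linear_l c u hx (submod0 (@sl2hat_submod K)).
by rewrite !addr0 a0 addr0.
Qed.

Lemma aact_loop_comm (a b : 'M[K]_2) (i j : int) (u : V) : \tr a = 0 -> \tr b = 0 ->
  aact (loop a i) (aact (loop b j) u) = aact (loop b j) (aact (loop a i) u)
   + (aact (loop (comm_mx2 a b) (i + j)) u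
     + ((if i + j == 0 then i%:~R * \tr (a *m b) else 0) * k) *: u).
Proof.
move=> ta tb; have ha := sl2hat_loop i ta; have hb := sl2hat_loop j tb.
have hc := @sl2hat_central K.
have hl := sl2hat_loop (i + j) (tr_comm a b).
apply/eqP; rewrite addrC -subr_eq; apply/eqP; rewrite -aact_brack // brack_loop addrC.
by rewrite aact_linear_l // (verma_c hV) scalerA addrC.
Qed.

Definition opA s (i : int) (u : V) : V := aact (loop (mxa K s) i) u.
Definition opC s (i : int) (u : V) : V := aact (loop (mxc K s) i) u.
Definition opH (i : int) (u : V) : V := aact (loop (mx_h K) i) u.

Lemma opA_linear s i : linear (opA s i).
Proof. exact/aact_linear/sl2hat_loop/tr_mxa. Qed.
Lemma opC_linear s i : linear (opC s i).
Proof. exact/aact_linear/sl2hat_loop/tr_mxc. Qed.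
Lemma opH_linear i : linear (opH i).
Proof. exact/aact_linear/sl2hat_loop/tr_h. Qed.

Lemma aact_loopZ c a i (u : V) : \tr a = 0 ->
  aact (loop (c *: a) i) u = c *: aact (loop a i) u.
Proof.
by move=> ta; rewrite (linear_mapZ (loop_linear i)) aactZ //; apply: sl2hat_loop.
Qed.

Lemma aact_loop0 i (u : V) : aact (loop 0 i) u = 0.
Proof. by rewrite -(scale0r (mx_h K)) aact_loopZ ?tr_h // scale0r. Qed.

Lemma opC_opA s i j u : opC s i (opA s j u) = opA s j (opC s i u)
  + (sgn K s *: opH (i + j) u + ((if i + j == 0 then i%:~R else 0) * k) *: u).
Proof.
rewrite /opA /opC aact_loop_comm ?tr_mxa ?tr_mxc // comm_ca tr_ca mulr1.
by rewrite aact_loopZ ?tr_h.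
Qed.

Lemma opH_opA s i j u : opH i (opA s j u) = opA s j (opH i u) - (2%:R * sgn K s) *: opA s (i + j) u.
Proof.
rewrite /opA /opH aact_loop_comm ?tr_mxa ?tr_h // comm_ha tr_ha mulr0 if_same mul0r.
by rewrite scale0r addr0 aact_loopZ ?tr_mxa // mulNr scaleNr.
Qed.

Lemma opH_opC s i j u : opH i (opC s j u) = opC s j (opH i u) + (2%:R * sgn K s) *: opC s (i + j) u.
Proof.
rewrite /opC /opH aact_loop_comm ?tr_mxc ?tr_h // comm_hc tr_hc mulr0 if_same mul0r.
by rewrite scale0r addr0 aact_loopZ ?tr_mxc.
Qed.

Lemma opH_opH i j u : opH i (opH j u) = opH j (opH i u)
  + ((if i + j == 0 then i%:~R * 2%:R else 0) * k) *: u.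
Proof. by rewrite /opH aact_loop_comm ?tr_h // comm_hh tr_hh aact_loop0 add0r. Qed.

Lemma opA_comm s i j u : opA s i (opA s j u) = opA s j (opA s i u).
Proof.
rewrite /opA aact_loop_comm ?tr_mxa // comm_aa tr_aa aact_loop0.
by rewrite mulr0 if_same mul0r scale0r !addr0.
Qed.

Lemma opC_comm s i j u : opC s i (opC s j u) = opC s j (opC s i u).
Proof.
rewrite /opC aact_loop_comm ?tr_mxc // comm_cc tr_cc aact_loop0.
by rewrite mulr0 if_same mul0r scale0r !addr0.
Qed.

(** ** The highest weight vector *)

Lemma vac_h0 : opH 0 v = M *: v. Proof. exact: verma_h1 hV. Qed.

(** Only [e] and [fT] are known to kill [v]; [hT] is their bracket, and
    brackets with [hT] raise the degree. *)
Lemma vac_killed : [/\ forall i : nat, opA false i.+1%:Z v = 0,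
  forall i : nat, opA true i%:Z v = 0 & forall i : nat, opH i.+1%:Z v = 0].
Proof.
have e0 : opA true 0 v = 0 by exact: verma_e1 hV.
have f1 : opA false 1 v = 0 by exact: verma_e2 hV.
have A0 s i : opA s i 0 = 0 by exact: (linear_map0 (opA_linear s i)).
have H0 i : opH i 0 = 0 by exact: (linear_map0 (opH_linear i)).
have step (i : nat) : opA false i.+1%:Z v = 0 -> opH i.+1%:Z v = 0.
  move=> fi; have := opC_opA false 0 i.+1%:Z v; rewrite -[opC false 0]/(opA true 0).
  by rewrite fi e0 !A0 !add0r /= mul0r scale0r addr0 scale1r => /esym.
have h1 : opH 1 v = 0 by apply: (step 0%N).
have stepA s (i : nat) : opA s i%:Z v = 0 -> opA s i.+1%:Z v = 0.
  move=> ai; have := opH_opA s 1 i%:Z v; rewrite ai h1 A0 H0 sub0r => /eqP.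
  rewrite eq_sym oppr_eq0 scaler_eq0 mulf_eq0 (negPf two_neq0) /=.
  case/orP => /eqP; last exact.
  move=> s0;  by have := sgn_sq K s; rewrite s0 mul0r => /eqP; rewrite eq_sym oner_eq0.
have fi (i : nat) : opA false i.+1%:Z v = 0 by elim: i => // i; apply: stepA.
split=> // i; last by apply: step.
by elim: i => // i; apply: stepA.
Qed.

Lemma vac_A s (i : int) : (~~ s)%:Z <= i -> opA s i v = 0.
Proof.
have [Vf Ve _] := vac_killed; case: i => [i|i]; last by case: s; lia.
by case: s => [_|]; [apply: Ve|case: i => [|i _]; [lia|apply: Vf]].
Qed.

Lemma vac_C (s : bool) (i : int) : s%:Z <= i -> opC s i v = 0.
Proof. by move=> si; have := @vac_A (~~ s) i; rewrite negbK => /(_ si); case: (s). Qed.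

Lemma vac_H (i : nat) : opH i.+1%:Z v = 0.
Proof. by case: vac_killed. Qed.

(** ** Words and components *)

Lemma component_word w : component (count_mem false w, count_mem true w) (word V w).
Proof. by apply: lspan_gen; exists w. Qed.

Lemma component_submod g : is_submod (component g : set V).
Proof. exact: lspan_submod. Qed.

(** The generators [f_1] and [f_2] shift the degree by definition, hence so do
    their iterated brackets. *)
Lemma component_shift p q (x : affine) g (u : V) :
  [\/ exists2 i, x = loop (mx_f K) (- i%:Z) & (p, q) = (i.+1, i),
      exists2 j, x = loop (mx_h K) (- j.+1%:Z) & (p, q) = (j.+1, j.+1)
    | exists2 l, x = loop (mx_e K) (- l.+1%:Z) & (p, q) = (l, l.+1)] ->
  component g u -> component ((p + g.1)%N, (q + g.2)%N) (aact x u).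
Proof.
have hS := @currents_sl2hat K.
pose S p q x := currents x /\ forall g (u : V), component g u ->
  component ((p + g.1)%N, (q + g.2)%N) (aact x u).
have gen (b : bool) : S (~~ b : nat) (b : nat) (aff_f K b).
  have hb : currents (aff_f K b).
    by case: b; [apply: (@current_loop _ _ 1); apply: tr_e|apply: (@current_loop _ _ 0); apply: tr_f].
  split=> // {}g {}u.
  apply: (lspan_ind (preim_submod (aact_linear (hS _ hb)) (component_submod _))).
  move=> _ [w [<- <- ->]]; have := @component_word (b :: w).
  by rewrite /= eqbF_neg eqb_id.
have [] := @nminus_graded_ind _ two_neq0 S.
- move=> c {}p {}q {}x [hx Sx]; split; first exact: (submodZ _ (@currents_submod K)).
  by move=> {}g {}u gu; rewrite aactZ; [|exact: hS]; apply: (submodZ _ (component_submod _)); apply: Sx.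
- move=> {}p {}q p' q' {}x y [hx Sx] [hy Sy]; split.
    by case: (currents_subalg K) => _; apply.
  move=> {}g {}u gu; rewrite aact_brack; try exact: hS.
  apply: (submodB (component_submod _)).
    by rewrite -!addnA; apply: (Sx (_, _)); apply: Sy.
  by rewrite [(p + p')%N]addnC [(q + q')%N]addnC -!addnA; apply: (Sy (_, _)); apply: Sx.
- exact: (gen false).
- exact: (gen true).
move=> Sf Sh Se [[i -> [-> ->]]|[j -> [-> ->]]|[l -> [-> ->]]].
- by case: (Sf i) => _; apply.
- by case: (Sh j) => _; apply.
- by case: (Se l) => _; apply.
Qed.

End Verma.

Section VermaSpan.
Variable K : fieldType.
Variables (V : affmod K) (M k : K).
Hypothesis hV : is_verma M k V.
Local Notation v := (vac V).
Local Notation affine := (affine K).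
Local Notation mx_h := (mx_h K).

Let linA s i := opA_linear hV s i.
Let linC s i := opC_linear hV s i.
Let linH i := opH_linear hV i.

Lemma nminus_gen b : nminus (aff_f K b).
Proof. by move=> S [_]; case: b; apply; [right|left]. Qed.

Lemma nminus_brack x y : @nminus K x -> nminus y -> nminus (brack x y).
Proof.
by move=> nx ny S SS; case: (SS) => -[_ SB] _; apply: SB; [apply: nx|apply: ny].
Qed.

Lemma nminus_submod : is_submod (@nminus K).
Proof.
split=> [S [[[S0 _] _] _] //|c x y nx ny S SS].
by case: (SS) => -[[_ SL] _] _; apply: SL; [apply: nx|apply: ny].
Qed.

Lemma nminus_loops : 2%:R != 0 :> K -> [/\ forall i : nat, nminus (loop (mx_f K) (- i%:Z)),
      forall j : nat, nminus (loop mx_h (- j.+1%:Z))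
    & forall l : nat, nminus (loop (mx_e K) (- l.+1%:Z))].
Proof.
move=> two_neq0; apply: (@nminus_graded_ind _ two_neq0 (fun _ _ => @nminus K)) => //.
- by move=> c _ _ x; apply: submodZ nminus_submod.
- by move=> _ _ _ _ x y; apply: nminus_brack.
- exact: (nminus_gen false).
- exact: (nminus_gen true).
Qed.

Lemma wspan_stable (x : affine) (u : V) : nminus x -> lspan (@words _ V) u -> lspan (@words _ V) (aact x u).
Proof.
have LS := lspan_submod (@words _ V).
pose S (x : affine) := currents x /\ forall u : V, lspan (@words _ V) u -> lspan (@words _ V) (aact x u).
suff nS : forall y, nminus y -> S y by move=> /nS[_]; apply.
have hS := @currents_sl2hat K.
apply: (smallest_sub (X := S)); last first.
  have gen b : S (aff_f K b).
    have hb := nminus_currents (nminus_gen b); split=> // w.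
    apply: (lspan_ind (preim_submod (aact_linear hV (hS _ hb)) LS)).
    by move=> _ [w' ->]; apply: lspan_gen; exists (b :: w').
  by move=> _ [] ->; [apply: (gen false)|apply: (gen true)].
split; last first.
  move=> y y' [cy Sy] [cy' Sy']; split; first by case: (currents_subalg K) => _; apply.
  move=> w ww; rewrite (aact_brack hV); try exact: hS.
  by apply: (submodB LS); auto.
split=> [|c y y' [cy Sy] [cy' Sy']]; split.
- exact: (submod0 (@currents_submod K)).
- move=> w ww; rewrite -(scale0r (central K)) (aactZ hV); last exact: sl2hat_central.
  by rewrite scale0r; apply: submod0.
- by apply: (submodD (@currents_submod K)) => //; apply: (submodZ _ (@currents_submod K)).
- move=> w ww; rewrite (aact_linear_l hV); try exact: hS.
  by apply: (submodD LS); [apply: (submodZ _ LS); auto|auto].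
Qed.

(** The span [S] of the words is an [n_-]-module containing the generator, so
    freeness yields a map [V -> S]; followed by the inclusion it is the
    identity by uniqueness. *)
Lemma words_span (u : V) : lspan (@words _ V) u.
Proof.
pose sigma (x : affine) (u : wspan V) : wspan V := insubd 0 (aact x (wspan_val u)).
have mem (w : wspan V) : lspan (@words _ V) (wspan_val w) by case: w => w wP; exact/asboolP/wP.
have mem2 (w : V) : lspan (@words _ V) w -> w \in @wspan_pred _ V.
  by move=> ww; apply/asboolP.
have valS x w : nminus x -> wspan_val (sigma x w) = aact x (wspan_val w).
  by move=> nx; exact: (insubdK (0 : wspan V) (mem2 _ (wspan_stable nx (mem w)))).
have hn := @nminus_sl2hat K.
have srep : is_rep (@nminus K) sigma.
  split=> [x nx c a b|c x y a nx ny|x y a nx ny]; apply: val_inj => /=.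
  - by rewrite !valS // (aact_linear hV (hn _ nx)).
  - rewrite !valS //; last by apply: (submodD nminus_submod) => //; apply: (submodZ _ nminus_submod).
    by rewrite (aact_linear_l hV) //; apply: hn.
  - rewrite !valS //; last exact: nminus_brack.
    by rewrite (aact_brack hV) //; apply: hn.
have v_in : v \in @wspan_pred _ V.
  by apply/asboolP; apply: lspan_gen; exists [::].
have [phi [[lphi ephi phiv] _]] := verma_free hV (MkWspan v_in) srep.
have vrep : is_rep (@nminus K) (@aact K V).
  split=> [x /hn|c x y w /hn hx /hn hy|x y w /hn hx /hn hy].
  - exact: (aact_linear hV).
  - exact: (aact_linear_l hV).
  - exact: (aact_brack hV).
have [psi [_ psi_uniq]] := verma_free hV v vrep.
have e1 : psi = (fun x => wspan_val (phi x)).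
  apply: psi_uniq; split=> [c x y|x w nx|].
  - by rewrite lphi.
  - by rewrite ephi // valS.
  - by rewrite phiv.
have e2 : psi = id by apply: psi_uniq; split.
by have := mem (phi u); rewrite -[wspan_val _]/((fun x => wspan_val (phi x)) u) -e1 e2.
Qed.

Lemma component_span (S : set V) : is_submod S ->
  (forall g u, component g u -> S u) -> forall u, S u.
Proof.
move=> SS cS u; have := words_span u; apply: (lspan_ind SS).
by move=> _ [w ->]; apply: cS; apply: component_word.
Qed.

(** ** Ordered monomials span *)

Definition pbw s (fs hs es : seq nat) : V :=
  apply_all (mxa K s) fs (apply_all mx_h hs (apply_all (mxc K s) es v)).

Arguments pbw : simpl never.

Lemma over_T_a s i (u : V) : over_T (mxa K s) i u = opA s (- i%:Z) u. Proof. by []. Qed.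
Lemma over_T_c s i (u : V) : over_T (mxc K s) i u = opC s (- i%:Z) u. Proof. by []. Qed.
Lemma over_T_h i (u : V) : over_T mx_h i u = opH (- i%:Z) u. Proof. by []. Qed.

Lemma addNzNz (i j : nat) : - i%:Z + - j%:Z = - (i + j)%N%:Z.
Proof. by rewrite PoszD opprD. Qed.

(** A monomial has [Z^2]-degree determined by its total index [q] and by the
    number [d] of free variables minus the number of opposite ones; [HE] is the
    part without free variables. Straightening one operator at a time keeps
    track of both. *)
Definition HE (s : bool) (q n : nat) : set V :=
  lspan [set x | exists hs es,
    [/\ all (leq 1) hs, all (leq (~~ s)) es, size es = n, (sumn hs + sumn es = q)%N
      & x = pbw s [::] hs es]].

Definition FHE (s : bool) (q : nat) (d : int) : set V :=
  lspan [set x | exists fs hs es,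
    [/\ all (leq s) fs, all (leq 1) hs /\ all (leq (~~ s)) es,
        (size fs)%:Z - (size es)%:Z = d, (sumn fs + sumn hs + sumn es = q)%N
      & x = pbw s fs hs es]].

Lemma HE_submod s q n : is_submod (HE s q n). Proof. exact: lspan_submod. Qed.
Lemma FHE_submod s q d : is_submod (FHE s q d). Proof. exact: lspan_submod. Qed.

Lemma HE_gen (s : bool) hs es : all (leq 1) hs -> all (leq (~~ s)) es ->
  HE s (sumn hs + sumn es)%N (size es) (pbw s [::] hs es).
Proof. by move=> ph pe; apply: lspan_gen; exists hs, es. Qed.

Lemma FHE_gen (s : bool) fs hs es : all (leq s) fs -> all (leq 1) hs ->
  all (leq (~~ s)) es ->
  FHE s (sumn fs + sumn hs + sumn es)%N ((size fs)%:Z - (size es)%:Z) (pbw s fs hs es).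
Proof. by move=> pf ph pe; apply: lspan_gen; exists fs, hs, es. Qed.

Lemma HE_h s q n j u : (0 < j)%N -> HE s q n u -> HE s (j + q)%N n (opH (- j%:Z) u).
Proof.
move=> j0; apply: (lspan_ind (preim_submod (linH _) (HE_submod _ _ _))).
move=> _ [hs [es [ph pe <- <- ->]]].
by rewrite addnA; apply: (@HE_gen s (j :: hs) es) => //=; rewrite j0.
Qed.

Lemma HE_c (s : bool) q n (l : nat) u : (~~ s <= l)%N -> HE s q n u ->
  HE s (l + q)%N n.+1 (opC s (- l%:Z) u).
Proof.
move=> l0; apply: (lspan_ind (preim_submod (linC _ _) (HE_submod _ _ _))).
move=> _ [hs [es [ph pe <- <- ->]]] /=.
elim: hs l l0 ph => [|j hs IH] l l0 /= => [_|/andP[j0 ph]].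
  by apply: (@HE_gen s [::] (l :: es)) => //=; rewrite l0.
have -> : pbw s [::] (j :: hs) es = opH (- j%:Z) (pbw s [::] hs es) by [].
set w := pbw _ _ _ _; have -> : opC s (- l%:Z) (opH (- j%:Z) w) =
    opH (- j%:Z) (opC s (- l%:Z) w) - (2%:R * sgn K s) *: opC s (- (l + j)%N%:Z) w.
  by rewrite (opH_opC hV) addNzNz [(j + l)%N]addnC addrK.
apply: (submodB (HE_submod _ _ _)).
  rewrite (_ : (l + (j + sumn hs + sumn es))%N = (j + (l + (sumn hs + sumn es)))%N); last by lia.
  by apply: HE_h => //; apply: IH.
apply: (submodZ _ (HE_submod _ _ _)).
rewrite (_ : (l + (j + sumn hs + sumn es))%N = ((l + j) + (sumn hs + sumn es))%N); last by lia.
by apply: IH => //; lia.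
Qed.

Lemma HE_FHE s q n u : HE s q n u -> FHE s q (- n%:Z) u.
Proof.
apply: lspan_ind; first exact: FHE_submod.
by move=> _ [hs [es [ph pe <- <- ->]]]; have := @FHE_gen s [::] hs es isT ph pe; rewrite add0r.
Qed.

Lemma FHE_a (s : bool) q d (i : nat) u : (s <= i)%N -> FHE s q d u ->
  FHE s (i + q)%N (d + 1) (opA s (- i%:Z) u).
Proof.
move=> i0; apply: (lspan_ind (preim_submod (linA _ _) (FHE_submod _ _ _))).
move=> _ [fs [hs [es [pf [ph pe] <- <- ->]]]].
have := @FHE_gen s (i :: fs) hs es; rewrite /= i0 => /(_ pf ph pe).
rewrite (_ : (i + sumn fs + sumn hs + sumn es)%N = (i + (sumn fs + sumn hs + sumn es))%N); last by lia.
by rewrite (_ : (size fs).+1%:Z - (size es)%:Z = (size fs)%:Z - (size es)%:Z + 1) //; lia.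
Qed.

Lemma FHE_h s q d (j : nat) u : (0 < j)%N -> FHE s q d u ->
  FHE s (j + q)%N d (opH (- j%:Z) u).
Proof.
move=> j0; apply: (lspan_ind (preim_submod (linH _) (FHE_submod _ _ _))).
move=> _ [fs [hs [es [pf [ph pe] <- <- ->]]]] /=.
elim: fs pf => [_|i fs IH /= /andP[i0 pf]].
  by rewrite sub0r; apply: HE_FHE; apply: HE_h => //; apply: HE_gen.
have -> : pbw s (i :: fs) hs es = opA s (- i%:Z) (pbw s fs hs es) by [].
rewrite (opH_opA hV) addNzNz.
have -> : (size fs).+1%:Z - (size es)%:Z = (size fs)%:Z - (size es)%:Z + 1 by lia.
apply: (submodB (FHE_submod _ _ _)).
  rewrite (_ : (j + (i + sumn fs + sumn hs + sumn es))%N =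
     (i + (j + (sumn fs + sumn hs + sumn es)))%N); last by lia.
  by apply: FHE_a => //; apply: IH.
apply: (submodZ _ (FHE_submod _ _ _)).
rewrite (_ : (j + (i + sumn fs + sumn hs + sumn es))%N =
     ((j + i) + (sumn fs + sumn hs + sumn es))%N); last by lia.
by apply: FHE_a; [lia|apply: FHE_gen].
Qed.

Lemma FHE_c (s : bool) q d (l : nat) u : (~~ s <= l)%N -> FHE s q d u ->
  FHE s (l + q)%N (d - 1) (opC s (- l%:Z) u).
Proof.
move=> l0; apply: (lspan_ind (preim_submod (linC _ _) (FHE_submod _ _ _))).
move=> _ [fs [hs [es [pf [ph pe] <- <- ->]]]] /=.
elim: fs pf => [_|i fs IH /= /andP[i0 pf]].
  rewrite (_ : 0 - (size es)%:Z - 1 = - (size es).+1%:Z); last by lia.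
  by apply: HE_FHE; apply: HE_c => //; apply: HE_gen.
have -> : pbw s (i :: fs) hs es = opA s (- i%:Z) (pbw s fs hs es) by [].
have li : (0 < l + i)%N by case: (s) l0 i0; lia.
rewrite (opC_opA hV) addNzNz oppr_eq0 eqz_nat (gtn_eqF li) mul0r scale0r addr0.
apply: (submodD (FHE_submod _ _ _)).
  rewrite (_ : (l + (i + sumn fs + sumn hs + sumn es))%N =
     (i + (l + (sumn fs + sumn hs + sumn es)))%N); last by lia.
  have -> : (size fs).+1%:Z - (size es)%:Z - 1 = (size fs)%:Z - (size es)%:Z - 1 + 1 by lia.
  by apply: FHE_a => //; apply: IH.
apply: (submodZ _ (FHE_submod _ _ _)).
rewrite (_ : (l + (i + sumn fs + sumn hs + sumn es))%N =
     ((l + i) + (sumn fs + sumn hs + sumn es))%N); last by lia.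
have -> : (size fs).+1%:Z - (size es)%:Z - 1 = (size fs)%:Z - (size es)%:Z by lia.
by apply: FHE_h => //; apply: FHE_gen.
Qed.

(** The difference [d] above, read off the degree [(p, q)]. *)
Definition charge (s : bool) (p q : nat) : int := if s then q%:Z - p%:Z else p%:Z - q%:Z.

Lemma component_FHE s g u : component g u -> FHE s g.2 (charge s g.1 g.2) u.
Proof.
apply: lspan_ind; first exact: FHE_submod.
move=> _ [w [<- <- ->]]; elim: w => [|b w IH] /=.
  by have := @FHE_gen s [::] [::] [::] isT isT isT; rewrite /charge /=; case: s.
case: s IH; case: b => /= IH; rewrite ?add0n ?add1n.
- have := @FHE_a true _ _ 1 _ isT IH; rewrite add1n (_ : _ + 1 = charge true (count_mem false w) (count_mem true w).+1) //.
  by rewrite /charge; move: (count_mem true w) (count_mem false w) => a b; lia.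
- have := @FHE_c true _ _ 0 _ isT IH; rewrite add0n (_ : _ - 1 = charge true (count_mem false w).+1 (count_mem true w)) //.
  by rewrite /charge; move: (count_mem true w) (count_mem false w) => a b; lia.
- have := @FHE_c false _ _ 1 _ isT IH; rewrite add1n (_ : _ - 1 = charge false (count_mem false w) (count_mem true w).+1) //.
  by rewrite /charge; move: (count_mem true w) (count_mem false w) => a b; lia.
- have := @FHE_a false _ _ 0 _ isT IH; rewrite add0n (_ : _ + 1 = charge false (count_mem false w).+1 (count_mem true w)) //.
  by rewrite /charge; move: (count_mem true w) (count_mem false w) => a b; lia.
Qed.

End VermaSpan.

Arguments pbw [K] V s fs hs es : simpl never.

(** * Uniqueness of dual basis vectors *)

Lemma all_leq0 (r : seq nat) : all (leq 0) r.
Proof. exact/allP. Qed.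

Lemma sumn_eq0_pos r : all (leq 1) r -> sumn r = 0%N -> r = [::].
Proof. by case: r => //= -[|x] r. Qed.

Lemma size_leq_sumn r : all (leq 1) r -> (size r <= sumn r)%N.
Proof. by elim: r => //= x r IH /andP[x1 /IH]; lia. Qed.

Section VermaDual.
Variable K : fieldType.
Variables (V : affmod K) (M k : K).
Hypothesis hV : is_verma M k V.
Local Notation v := (vac V).
Local Notation affine := (affine K).
Local Notation mx_h := (mx_h K).

Lemma apply_all_perm (a : 'M[K]_2) fs fs' (u : V) :
  (forall i j (u : V), over_T a i (over_T a j u) = over_T a j (over_T a i u)) ->
  perm_eq fs fs' -> apply_all a fs u = apply_all a fs' u.
Proof.
move=> aC; move: fs fs'.
apply: (perm_eq_rel_ind (r := fun s t => apply_all a s u = apply_all a t u)) => //=.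
- by move=> t s w -> ->.
- by move=> x s t _ ->.
Qed.

Lemma pbw_sort s fs hs es :
  pbw V s fs hs es = pbw V s (sort geq fs) (sort geq hs) (sort geq es).
Proof.
have ps (r : seq nat) : perm_eq r (sort geq r) by rewrite perm_sym perm_sort.
have aC i j (u : V) : over_T (mxa K s) i (over_T (mxa K s) j u) =
  over_T (mxa K s) j (over_T (mxa K s) i u) by exact: (opA_comm hV).
have cC i j (u : V) : over_T (mxc K s) i (over_T (mxc K s) j u) =
  over_T (mxc K s) j (over_T (mxc K s) i u) by exact: (opC_comm hV).
have hC i j (u : V) : over_T mx_h i (over_T mx_h j u) =
  over_T mx_h j (over_T mx_h i u).
  have := opH_opH hV (- i%:Z) (- j%:Z) u; rewrite addNzNz oppr_eq0 eqz_nat addn_eq0 => E.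
  apply: etrans E _; case: i => [|i]; last by rewrite mul0r scale0r addr0.
  by rewrite oppr0 mul0r if_same mul0r scale0r addr0.
rewrite /pbw (apply_all_perm _ aC (ps fs)) (apply_all_perm _ hC (ps hs)).
by rewrite (apply_all_perm _ cC (ps es)).
Qed.

Definition side_degree (s : bool) (g : nat * nat) : bool :=
  (if s then (g.1 < g.2)%N else (g.2 < g.1)%N) || (g == (0, 0)%N).

(** On either side the basis consists of the sorted monomials of the given
    degree, free variables first. *)
Lemma basisE s g : side_degree s g -> (basis g : set V) =
  [set x | exists fs hs es, [/\ sorted geq fs /\ all (leq s) fs,
     sorted geq hs /\ all (leq 1) hs, sorted geq es /\ all (leq (~~ s)) es,
     ((size fs)%:Z - (size es)%:Z = charge s g.1 g.2 /\
      (sumn fs + sumn hs + sumn es = g.2)%N) & x = pbw V s fs hs es]].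
Proof.
rewrite /side_degree /basis /charge; have [->|g0] /= := eqVneq g (0, 0)%N.
  move=> _; apply/seteqP; split=> [x -> /=|x /=].
    by exists [::], [::], [::]; rewrite /= if_same.
  case=> fs [hs [es [[_ pf] [_ ph] [_ pe] [sz /eqP]]]].
  rewrite !addn_eq0 => /andP[/andP[/eqP f0 /eqP h0] /eqP e0].
  rewrite (sumn_eq0_pos ph h0).
  have sz' : size fs = size es by move: sz; rewrite if_same subr0; lia.
  case: s pf pe {sz} => /= pf pe.
    have fn := sumn_eq0_pos pf f0; rewrite fn /= in sz' *.
    by rewrite (size0nil (esym sz')) => ->.
  have en := sumn_eq0_pos pe e0; rewrite en /= in sz' *.
  by rewrite (size0nil sz') => ->.
rewrite orbF; case: s => lt.
  have -> : (g.2 < g.1)%N = false by lia.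
  rewrite lt; apply/seteqP; split=> x /=.
    case=> fs [hs [es [[sf [sh ph] [se pe] e1 e2] ->]]].
    exists es, hs, fs; split=> //; first by split=> //; exact: all_leq0.
    by split; lia.
  case=> es [hs [fs [[se pe] [sh ph] [sf _] [e1 e2] ->]]].
  exists fs, hs, es; split=> //; split=> //; lia.
rewrite lt; apply/seteqP; split=> x /=.
  case=> fs [hs [es [[sf [sh ph] [se pe] e1 e2] ->]]].
  exists fs, hs, es; split=> //; first by split=> //; exact: all_leq0.
  by split; lia.
case=> fs [hs [es [[sf _] [sh ph] [se pe] [e1 e2] ->]]].
exists fs, hs, es; split=> //; split=> //; lia.
Qed.

Lemma basis_nonempty g (x : V) : basis g x -> exists s, side_degree s g.
Proof.
rewrite /basis /side_degree; case: ifP => [lt|_]; first by exists false; rewrite ?lt.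
case: ifP => [lt|_]; first by exists true; rewrite ?lt.
by case: ifP => [g0|_ //]; exists true; rewrite ?g0 orbT.
Qed.

Lemma component_basis s g (u : V) : side_degree s g -> component g u ->
  lspan (basis g) u.
Proof.
move=> sg /(@component_FHE _ _ _ _ hV s); rewrite (basisE sg); apply: lspan_subset.
move=> _ [fs [hs [es [pf [ph pe] e1 e2 ->]]]]; apply: lspan_gen.
exists (sort geq fs), (sort geq hs), (sort geq es).
rewrite !all_sort !size_sort !(perm_sumn (permEl (perm_sort _ _))) -pbw_sort.
have st r : sorted geq (sort geq r) by apply: sort_sorted => a b; apply: leq_total.
by split.
Qed.

Lemma component_loops (a : 'M[K]_2) (p q : nat -> nat) (r : seq nat) g (u : V) :
  (forall i g (u : V), i \in r -> component g u ->
     component ((p i + g.1)%N, (q i + g.2)%N) (over_T a i u)) ->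
  component g u ->
  component ((sumn (map p r) + g.1)%N, (sumn (map q r) + g.2)%N) (apply_all a r u).
Proof.
elim: r => [|i r IH] ca gu /=; first by case: g gu.
rewrite -!addnA; apply: (ca i (_, _)); first exact: mem_head.
by apply: IH => // j g' w jr; apply: ca; rewrite inE jr orbT.
Qed.

Hypothesis two_neq0 : 2%:R != 0 :> K.

Lemma basis_component g (x : V) : basis g x -> component g x.
Proof.
have cf fs g' (u : V) : component g' u ->
    component ((sumn fs + size fs + g'.1)%N, (sumn fs + g'.2)%N) (apply_all (mx_f K) fs u).
  move=> gu; have := @component_loops (mx_f K) S id fs g' u; rewrite map_id.
  rewrite (_ : sumn (map S fs) = sumn fs + size fs)%N; last by elim: fs => //= i fs ->; lia.
  apply=> // i g2 w _; apply: (component_shift two_neq0 hV).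
  by constructor 1; exists i.
have ch hs g' (u : V) : all (leq 1) hs -> component g' u ->
    component ((sumn hs + g'.1)%N, (sumn hs + g'.2)%N) (apply_all mx_h hs u).
  move=> /allP ph gu; have := @component_loops mx_h id id hs g' u; rewrite map_id.
  apply=> // -[|j] g2 w /ph // _; apply: (component_shift two_neq0 hV).
  by constructor 2; exists j.
have ce es g' (u : V) : all (leq 1) es -> component g' u ->
    component ((sumn es - size es + g'.1)%N, (sumn es + g'.2)%N) (apply_all (mx_e K) es u).
  move=> pe gu; have := @component_loops (mx_e K) predn id es g' u; rewrite map_id.
  rewrite (_ : sumn (map predn es) = sumn es - size es)%N; last first.
    by elim: es pe => //= i es IH /andP[i1 pe]; rewrite IH //; have := size_leq_sumn pe; lia.
  move/allP: pe => pe; apply=> // -[|j] g2 w /pe // _; apply: (component_shift two_neq0 hV).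
  by constructor 3; exists j.
have c0 : component (0, 0)%N v by exact: (@component_word _ V [::]).
move=> gx; have [s sg] := basis_nonempty gx; move: gx; rewrite (basisE sg).
case=> fs [hs [es [[sf pf] [sh ph] [se pe] [e1 e2] ->]]].
case: s sg pf pe e1 => sg pf pe; rewrite /charge => e1.
  have := ce fs _ _ pf (ch hs _ _ ph (cf es _ _ c0)); have := size_leq_sumn pf.
  rewrite /= => sfs; rewrite (_ : (_, _) = g) //.
  by case: g e1 e2 {sg} => p q /= e1 e2; congr pair; lia.
have := cf fs _ _ (ch hs _ _ ph (ce es _ _ pe c0)); have := size_leq_sumn pe.
rewrite /= => sfs; rewrite (_ : (_, _) = g) //.
by case: g e1 e2 {sg} => p q /= e1 e2; congr pair; lia.
Qed.

Lemma cdual_linear (phi : cdual V) : linear phi.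
Proof. by case: phi => phi phiP /=; move: (phiP); rewrite unfold_in => /asboolP[]. Qed.

(** The degree is determined because [x] cannot lie in two components, and
    then both forms agree on a basis of that component and vanish on the
    others. *)
Lemma dual_vector_unique (x : V) (phi psi : cdual V) :
  is_dual_vector x phi -> is_dual_vector x psi -> phi = psi.
Proof.
move=> [g [gx phg ph0]] [g' [g'x psg ps0]].
have [gg'|gg'] := eqVneq g' g; last first.
  have := ph0 _ _ gg' (basis_component g'x); rewrite phg // eqxx => /eqP.
  by rewrite oner_eq0.
rewrite gg' in g'x psg ps0 *; apply/val_inj/funext => u /=.
have E : is_submod [set u | phi u = psi u].
  exact: (eq_submod (cdual_linear phi) (cdual_linear psi)).
move: u; apply: (component_span hV E) => g2 u; have [->|ng] := eqVneq g2 g.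
  have [s sg] := basis_nonempty gx; move/(component_basis sg); move: u.
  by apply: (lspan_ind E) => y gy; rewrite /= phg // psg.
by move=> gu /=; rewrite (ph0 _ _ ng gu) (ps0 _ _ ng gu).
Qed.

Lemma star_eq (x : V) (phi : cdual V) : is_dual_vector x phi -> star x = phi.
Proof.
move=> dx; apply: xget_unique => // psi dpsi; exact: dual_vector_unique dpsi dx.
Qed.

End VermaDual.

(** * Low degree coefficients of polynomials *)

Section DegreeFiltration.
Variable K : fieldType.

Definition dle (a : nat) : set (sym K) :=
  lspan [set mon K r | r in [set r | (size r <= a)%N]].

Lemma dle_submod a : is_submod (dle a). Proof. exact: lspan_submod. Qed.

Lemma homog_dle d m a w : (d <= a)%N -> homog d m w -> dle a w.
Proof.
move=> da; apply: lspan_subset => _ [r [rd _] <-]; apply: lspan_gen.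
by exists r => //=; rewrite rd.
Qed.

Lemma dle_mon a r : (size r <= a)%N -> dle a (mon K r).
Proof. by move=> ra; apply: homog_dle ra _; apply: homog_mon. Qed.

Lemma dle_hop a j w : dle a w -> dle a (hop j w).
Proof.
apply: (lspan_ind (preim_submod (@hop_linear K j) (dle_submod a))) => _ [r ra <-].
by apply: (homog_dle ra); apply: homog_hop; apply: homog_mon.
Qed.

Lemma dle_eop a l w : dle a w -> dle a.-1 (eop l w).
Proof.
apply: (lspan_ind (preim_submod (@eop_linear K l) (dle_submod _))) => _ [r ra <-] /=.
case: r ra => [|x r] /= ra; first by rewrite eop_nil; apply: submod0 (dle_submod _).
apply: (@homog_dle (size r) (sumn (x :: r) + l)%N); first by lia.
by apply: homog_eop; apply: (@homog_mon _ (x :: r)).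
Qed.

Lemma coef_dle t a w : dle a w -> (a < size t)%N -> coef t w = 0.
Proof.
move=> + at'; apply: (lspan_ind (kernel_submod (@coef_linear K t))) => _ [r ra <-] /=.
rewrite coef_mon; case: (boolP (perm_eq r t)) => // /perm_size rt.
by move: at'; rewrite -rt ltnNge ra.
Qed.

Lemma coef_nil_xmul i (w : sym K) : coef [::] (xmul i w) = 0.
Proof.
move: w; apply: sym_ext.
- exact: linear_comp (@coef_linear K _) (@xmul_linear K _).
- exact: linear_zero.
by move=> r; rewrite xmul_mon coef_mon; case: (boolP (perm_eq _ _)) => // /perm_size.
Qed.

Lemma coef1_xmul x i (w : sym K) :
  coef [:: x] (xmul i w) = if x == i then coef [::] w else 0.
Proof.
move: w; apply: sym_ext.
- exact: linear_comp (@coef_linear K _) (@xmul_linear K _).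
- by case: eqP => _; [exact: coef_linear|exact: linear_zero].
move=> r; rewrite xmul_mon !coef_mon; case: eqP => [->|xi]; first by rewrite perm_cons.
case: (boolP (perm_eq _ _)) => // ir; have := perm_mem ir x.
case: r ir => [|y r] ir; last by have := perm_size ir.
by rewrite !inE eqxx => /eqP.
Qed.

Lemma coef_nil_hop j (w : sym K) : coef [::] (hop j w) = 0.
Proof.
move: w; apply: sym_ext.
- exact: linear_comp (@coef_linear K _) (@hop_linear K _).
- exact: linear_zero.
move=> r; have hr := @homog_hop K j _ _ _ (@homog_mon K r).
case: r hr => [|x r] hr; first by rewrite hop_nil (linear_map0 (@coef_linear K _)).
by apply: (coef_homog hr).
Qed.

Lemma coef_nil_eop l (w : sym K) : coef [::] (eop l w) = 0.
Proof.
move: w; apply: sym_ext.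
- exact: linear_comp (@coef_linear K _) (@eop_linear K _).
- exact: linear_zero.
case=> [|x [|y r]]; first by rewrite eop_nil (linear_map0 (@coef_linear K _)).
  rewrite -xmul_mon eop_xmul eop_nil hop_nil (linear_map0 (@xmul_linear K _)) addr0.
  exact: (linear_map0 (@coef_linear K _)).
have hr := @homog_eop K l _ _ _ (@homog_mon K (x :: y :: r)).
by apply: (coef_homog hr).
Qed.

(** Twice the sum of the coefficients of the quadratic monomials [x_i x_j]
    with [i + j = m]. *)
Definition quad_mon (m : nat) (r : seq nat) : K^o :=
  if (size r == 2%N) && (sumn r == m) then 2%:R else 0.

Lemma quad_perm m : perm_inv (quad_mon m).
Proof. by move=> r t rt; rewrite /quad_mon (perm_size rt) (perm_sumn rt). Qed.

Definition quad m : sym K -> K^o := ulift (quad_mon m).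

Lemma quad_linear m : linear (quad m).
Proof. exact/ulift_linear/quad_perm. Qed.

Lemma quad_monE m r : quad m (mon K r) = quad_mon m r.
Proof. exact/ulift_gen/quad_perm. Qed.

Lemma quad_xmul m i w :
  quad m (xmul i w) = if (i <= m)%N then 2%:R * coef [:: m - i]%N w else 0.
Proof.
move: w; apply: sym_ext.
- exact: linear_comp (@quad_linear _) (@xmul_linear K _).
- by case: (i <= m)%N; [apply: (linear_scale 2%:R); exact: coef_linear|exact: linear_zero].
move=> r; rewrite xmul_mon quad_monE coef_mon /quad_mon /=.
case: r => [|x [|y r]] /=; rewrite ?addn0 ?andbF /=.
- case: (boolP (perm_eq [::] [:: m - i]%N)) => [/perm_size //|_].
  by rewrite mulr0 if_same.
- rewrite (_ : perm_eq [:: x] [:: m - i]%N = (x == m - i)%N); last first.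
    apply/idP/eqP => [e|->]; last exact: perm_refl.
    by have := perm_mem e x; rewrite !inE eqxx => /esym/eqP.
  case: leqP => im; last by rewrite (_ : (_ == m) = false) //; lia.
  by rewrite (_ : (i + x == m)%N = (x == m - i)%N); [case: eqP => _; rewrite ?mulr1 ?mulr0|lia].
case: (boolP (perm_eq [:: x, y & r] [:: m - i]%N)) => [/perm_size //|_].
by rewrite mulr0 if_same.
Qed.

Lemma quad_dle m w : dle 1 w -> quad m w = 0.
Proof.
apply: (lspan_ind (kernel_submod (@quad_linear m))) => _ [r ra <-] /=.
by rewrite quad_monE /quad_mon; case: eqP => //= r2; move: ra; rewrite /= r2.
Qed.

(** Summing over decreasing pairs counts each monomial [x_i x_j] once, also
    when [i = j]. *)
Lemma quad_sum (s : bool) m N r : (m < N)%N -> all (leq s) r ->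
  quad m (mon K r) = 2%:R * (\sum_(s <= i < N) \sum_(s <= j < i.+1 | (i + j == m)%N)
                       coef [:: i; j] (mon K r)).
Proof.
move=> mN rs; rewrite quad_monE /quad_mon.
have z i j : size r != 2%N \/ sumn r != (i + j)%N -> coef [:: i; j] (mon K r) = 0.
  rewrite coef_mon; case: (boolP (perm_eq _ _)) => // rij.
  by rewrite (perm_size rij) (perm_sumn rij) /= addn0 !eqxx => -[].
have [/andP[/eqP r2 /eqP rm]|nr] := ifP; last first.
  rewrite big1 ?mulr0 // => i _; rewrite big1 // => j /eqP ij; apply: z; rewrite ij.
  by apply/orP; rewrite -negb_and nr.
have [p [q [qp rpq]]] : exists p q, (q <= p)%N /\ perm_eq r [:: p; q].
  case: r r2 {rs rm z} => [|x [|y [|]]] // _; have [xy|xy] := leqP y x; first by exists x, y.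
  by exists y, x; split; [lia|exact: (permEl (perm_catC [:: x] [:: y]))].
have spq : (p + q)%N = m by rewrite -rm (perm_sumn rpq) /= addn0.
have : all (leq s) [:: p; q] by rewrite -(perm_all _ rpq).
rewrite /= andbT => /andP[sp sq].
have c0 i j : (j <= i)%N -> coef [:: i; j] (mon K r) = if (i == p) && (j == q) then 1 else 0.
  move=> ji; rewrite coef_mon (permPl rpq).
  case: (boolP (perm_eq _ _)) => [ij|]; last first.
    by case: ifP => // /andP[/eqP -> /eqP ->]; rewrite perm_refl.
  have := perm_mem ij i; have := perm_mem ij j; rewrite !inE !eqxx orbT orTb.
  have := perm_sumn ij => /=; case: ifP => // /negP ne e1 e2 e3; exfalso; apply: ne; lia.
rewrite (eq_big_nat _ _ (F2 := fun i => if i == p then 1 else 0)).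
  rewrite -big_mkcond /= big_nat1_eq sp (_ : (p < N)%N) ?mulr1 //; lia.
move=> i /andP[si iN]; rewrite big_mkcond /=.
rewrite (eq_big_nat _ _ (F2 := fun j => if j == q then (if i == p then 1 else 0) else 0)).
  rewrite -big_mkcond /= big_nat1_eq sq /=; case: eqP => [->|_]; last by rewrite if_same.
  by rewrite ltnS qp.
move=> j /andP[sj ji]; rewrite c0 //; case: (eqVneq i p) => [->|ip] /=.
  by case: (eqVneq j q) => [->|jq] /=; rewrite ?spq ?eqxx ?if_same.
by rewrite !if_same.
Qed.
End DegreeFiltration.

(** * The projection of a Verma module onto polynomials *)

Section SymMap.
Variable K : fieldType.
Variables (V : affmod K) (M k : K).
Hypothesis hV : is_verma M k V.
Local Notation v := (vac V).
Local Notation mx_h := (mx_h K).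

Let linA s i := opA_linear hV s i.
Let linC s i := opC_linear hV s i.
Let linH i := opH_linear hV i.

(** The projection of [V] along the monomials that contain an operator other
    than the free variables. *)
Record is_sym_map (s : bool) (P : V -> sym K) : Prop := IsSymMap {
  sym_map_linear : linear P;
  sym_map_vac : P v = mon K [::];
  sym_map_A : forall (i : nat) u, (s <= i)%N -> P (opA s (- i%:Z) u) = xmul i (P u);
  sym_map_H : forall (j : nat) u, (0 < j)%N ->
    P (opH (- j%:Z) u) = sgn K s *: hop j (P u);
  sym_map_C : forall (l : nat) u, (~~ s <= l)%N -> P (opC s (- l%:Z) u) = eop l (P u) }.

(** The universal property of the Verma module, applied to polynomials. *)
Lemma sym_map_exists s : 2%:R != 0 :> K -> exists P, is_sym_map s P.
Proof.
move=> two_neq0.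
have hn := @nminus_currents K.
have srep : is_rep (@nminus K) (sym_act s).
  case: (sym_act_rep K s) => r1 r2 r3; split=> [x /hn|c x y u /hn hx /hn hy|x y u /hn hx /hn hy].
  - exact: r1.
  - exact: r2.
  - exact: r3.
have [P [[lP eP Pv] _]] := verma_free hV (mon K [::]) srep.
have [nf nh ne] := nminus_loops two_neq0.
exists P; split=> // [i u si|[//|j] u _|l u sl].
- rewrite /opA eP; first by rewrite sym_act_loop current_act_a.
  by case: s si {eP srep} => [|_]; [case: i => [//|i _]; exact: ne|exact: nf].
- by rewrite /opH eP // sym_act_loop current_act_h.
rewrite /opC eP; first by rewrite sym_act_loop current_act_c.
by case: s sl {eP srep} => [_|]; [exact: nf|case: l => [//|l _]; exact: ne].
Qed.

Section Fixed.
Variables (s : bool) (P : V -> sym K).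
Hypothesis hP : is_sym_map s P.
Let linP := sym_map_linear hP.

Lemma sym_map_all fs (u : V) : all (leq s) fs ->
  P (apply_all (mxa K s) fs u) = foldr (@xmul K) (P u) fs.
Proof.
by elim: fs => //= i fs IH /andP[i0 pf]; rewrite over_T_a (sym_map_A hP) ?IH.
Qed.

Lemma foldr_xmul_mon fs r : foldr (@xmul K) (mon K r) fs = mon K (fs ++ r).
Proof. by elim: fs => //= i fs ->; rewrite xmul_mon. Qed.

Lemma foldr_xmul0 fs : foldr (@xmul K) 0 fs = 0.
Proof. by elim: fs => //= i fs ->; rewrite (linear_map0 (@xmul_linear K i)). Qed.

Lemma sym_map_pbw fs hs es : all (leq s) fs -> all (leq 1) hs -> all (leq (~~ s)) es ->
  P (pbw V s fs hs es) = if nilp hs && nilp es then mon K fs else 0.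
Proof.
move=> pf ph pe; rewrite /pbw sym_map_all //.
have Pe : P (apply_all (mxc K s) es v) = if nilp es then mon K [::] else 0.
  elim: es pe => [|l es IH] /= => [_|/andP[l0 pe]]; first exact: (sym_map_vac hP).
  rewrite over_T_c (sym_map_C hP) // IH //; case: ifP => _; first exact: eop_nil.
  exact: (linear_map0 (@eop_linear K l)).
have -> : P (apply_all mx_h hs (apply_all (mxc K s) es v)) =
    if nilp hs && nilp es then mon K [::] else 0.
  elim: hs ph => [|j hs IH] //= /andP[j0 ph].
  rewrite over_T_h (sym_map_H hP) // IH //; case: ifP => _.
    by rewrite hop_nil scaler0.
  by rewrite (linear_map0 (@hop_linear K j)) scaler0.
by case: ifP => _; rewrite ?foldr_xmul0 // foldr_xmul_mon cats0.
Qed.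

Lemma pbw_span (S : set V) : is_submod S ->
  (forall fs hs es, all (leq s) fs -> all (leq 1) hs -> all (leq (~~ s)) es ->
     S (pbw V s fs hs es)) -> forall u, S u.
Proof.
move=> SS Sp; apply: (component_span hV SS) => g u /(@component_FHE _ _ _ _ hV s).
move: u; apply: (lspan_ind SS) => _ [fs [hs [es [pf [ph pe] _ _ ->]]]]; exact: Sp.
Qed.

Lemma sym_map_support u :
  lspan [set mon K t | t in [set t | all (leq s) t]] (P u).
Proof.
move: u; apply: (pbw_span (preim_submod linP (lspan_submod _))) => fs hs es pf ph pe /=.
rewrite sym_map_pbw //; case: ifP => _; last by apply: submod0 (lspan_submod _).
by apply: lspan_gen; exists fs.
Qed.

Lemma sym_map_coef0 g u t : component g u -> (size t)%:Z != charge s g.1 g.2 \/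
  sumn t != g.2 -> coef t (P u) = 0.
Proof.
move=> /(@component_FHE _ _ _ _ hV s) + st.
apply: (lspan_ind (kernel_submod (linear_comp (@coef_linear K t) linP))).
move=> _ [fs [hs [es [pf [ph pe] e1 e2 ->]]]] /=; rewrite sym_map_pbw //.
case: ifP => [/andP[/nilP hn /nilP en]|_]; last exact: (linear_map0 (@coef_linear K _)).
rewrite coef_mon; case: (boolP (perm_eq _ _)) => // ft; exfalso.
rewrite -(perm_size ft) -(perm_sumn ft) -e1 -e2 hn en /= in st.
by move: st; rewrite subr0 !addn0 !eqxx => -[].
Qed.

Definition pairing (t : seq nat) (u : V) : K^o := coef t (P u).

Lemma pairing_linear t : linear (pairing t).
Proof. exact: linear_comp (@coef_linear K t) linP. Qed.

Definition top_degree (t : seq nat) : nat * nat :=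
  if s then ((sumn t - size t)%N, sumn t) else ((sumn t + size t)%N, sumn t).

Lemma pairing_cdual t : all (leq s) t -> pairing t \in @cdual_pred _ V.
Proof.
move=> pt; apply/asboolP; split; first exact: pairing_linear.
apply: (@sub_finite_set _ _ [set top_degree t]); last exact: finite_set1.
move=> g [x gx /eqP nz] /=; apply: contrapT => gt; apply: nz.
apply: (sym_map_coef0 gx); have [e|] := eqVneq (sumn t) g.2; last by right.
left; apply/eqP => st; apply: gt; move: st; rewrite /top_degree /charge -e.
case: g e {gx} => p q /= <-; case: (s) pt => [/size_leq_sumn|_] //=; last first.
  by move=> st; congr pair; lia.
by move=> le st; congr pair; lia.
Qed.

(** A monomial is sent to its product of free variables if it has no other
    factor and to [0] otherwise, so that taking a coefficient is dual to the
    corresponding basis vector. *)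
Lemma pairing_dual t (pt : all (leq s) t) : sorted geq t ->
  is_dual_vector (apply_all (mxa K s) t v) (MkCdual (pairing_cdual pt)).
Proof.
move=> st; have sg : side_degree s (top_degree t).
  rewrite /side_degree /top_degree; case: t pt {st} => [|i t].
    by move=> _; case: (s).
  case: (s) => [/size_leq_sumn /= le|_]; apply/orP; left => /=; last by rewrite addnS ltnS leq_addr.
  by rewrite ltn_subrL; case: (i + _)%N le.
have et : apply_all (mxa K s) t v = pbw V s t [::] [::] by [].
have px : pairing t (apply_all (mxa K s) t v) = 1.
  by rewrite et /pairing sym_map_pbw //= coef_mon perm_refl.
exists (top_degree t); split=> /=.
- rewrite (basisE V sg); exists t, [::], [::]; split=> //; split=> /=; last first.
    by rewrite !addn0 /top_degree; case: (s).
  rewrite subr0 /charge /top_degree; case: (s) pt => [/size_leq_sumn|_] /=; lia.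
- move=> y; rewrite (basisE V sg) => -[fs [hs [es [[sf pf] [sh ph] [se pe] [e1 e2] ->]]]].
  case: eqP => [->|ne]; first exact: px.
  rewrite /pairing sym_map_pbw //; case: ifP => [/andP[/nilP hn /nilP en]|_]; last first.
    exact: (linear_map0 (@coef_linear K _)).
  rewrite coef_mon; case: (boolP (perm_eq _ _)) => // ft; exfalso; apply: ne.
  rewrite hn en et; congr (pbw V s _ [::] [::]).
  by apply: (sorted_eq _ _ sf st ft) => [a b c|a b] /=; rewrite /geq /=; lia.
move=> g y gt gy; apply: (sym_map_coef0 gy).
have [e|] := eqVneq (sumn t) g.2; last by right.
left; apply: contra_neq gt => eg; move: eg; rewrite /top_degree /charge -e.
case: g e {gy} => p q /= <-; case: (s) pt => [/size_leq_sumn|_] /=.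
  by move=> le eg; congr pair; lia.
by move=> eg; congr pair; lia.
Qed.

Lemma star_pairing t u : 2%:R != 0 :> K -> all (leq s) t -> sorted geq t ->
  star (apply_all (mxa K s) t v) u = coef t (P u).
Proof.
by move=> two_neq0 pt st; rewrite (star_eq hV two_neq0 (@pairing_dual t pt st)).
Qed.

End Fixed.
End SymMap.

(** * The contravariant identity *)

Lemma regular_scaleE (K : fieldType) (a : K) (b : K^o) : a *: b = a * b :> K.
Proof. by []. Qed.

Section Contravariant.
Variable K : fieldType.
Variables (V : affmod K) (M k : K).
Hypothesis hV : is_verma M k V.
Local Notation v := (vac V).
Local Notation mx_h := (mx_h K).
Variables (s : bool) (P : V -> sym K).
Hypothesis hP : is_sym_map s P.

Let linP := sym_map_linear hP.
Let linA i := opA_linear hV s i.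
Let linC i := opC_linear hV s i.
Let linH i := opH_linear hV i.

(** Shifted so that on both sides [F_l], [l <= 0], are the free variables and
    [E_l], [l >= 0], kill the highest weight vector. *)
Definition opF (l : int) (u : V) : V := opA s (l - s%:Z) u.
Definition opE (l : int) (u : V) : V := opC s (l + s%:Z) u.

Definition lin0 (u : V) : K^o := coef [::] (P u).
Definition lin1 (t : nat) (u : V) : K^o := coef [:: (t + s)%N] (P u).
Definition lin2 (t : nat) (u : V) : K^o := quad (t + s + s)%N (P u).

Lemma opF_linear l : linear (opF l). Proof. exact: linA. Qed.
Lemma opE_linear l : linear (opE l). Proof. exact: linC. Qed.
Lemma lin0_linear : linear lin0.
Proof. exact: linear_comp (@coef_linear K _) linP. Qed.
Lemma lin1_linear t : linear (lin1 t).
Proof. exact: linear_comp (@coef_linear K _) linP. Qed.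
Lemma lin2_linear t : linear (lin2 t).
Proof. exact: linear_comp (@quad_linear K _) linP. Qed.

Lemma sym_map_F p u : P (opF (- p%:Z) u) = xmul (p + s)%N (P u).
Proof.
rewrite /opF (_ : - p%:Z - s%:Z = - (p + s)%N%:Z); last by lia.
by rewrite (sym_map_A hP) // leq_addl.
Qed.

Lemma opF_comm l m u : opF l (opF m u) = opF m (opF l u).
Proof. exact: (opA_comm hV). Qed.

Lemma opHF l m u : opH l (opF m u) = opF m (opH l u) - (2%:R * sgn K s) *: opF (l + m) u.
Proof. by rewrite /opF (opH_opA hV) addrA. Qed.

Lemma opEF (b p : nat) u : opE b%:Z (opF (- p%:Z) u) = opF (- p%:Z) (opE b%:Z u)
  + (sgn K s *: opH (b%:Z - p%:Z) u + ((if b == p then (b + s)%:R else 0) * k) *: u).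
Proof.
rewrite /opE /opF (opC_opA hV) (_ : b%:Z + s%:Z + (- p%:Z - s%:Z) = b%:Z - p%:Z); last by lia.
rewrite subr_eq0 eqz_nat; congr (_ + (_ + (_ * k) *: _)).
Qed.

Lemma lin0_F (l : int) u : l <= 0 -> lin0 (opF l u) = 0.
Proof.
move=> l0; have -> : l = - `|l|%N%:Z by lia.
by rewrite /lin0 sym_map_F coef_nil_xmul.
Qed.

Lemma lin0_H (l : int) u : l < 0 -> lin0 (opH l u) = 0.
Proof.
move=> l0; have -> : l = - `|l|%N%:Z by lia.
rewrite /lin0 (sym_map_H hP); last by lia.
by rewrite (linear_mapZ (@coef_linear K _)) coef_nil_hop scaler0.
Qed.

Lemma lin0_C (l : nat) u : (~~ s <= l)%N -> lin0 (opC s (- l%:Z) u) = 0.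
Proof. by move=> l0; rewrite /lin0 (sym_map_C hP) // coef_nil_eop. Qed.

Lemma lin1_F t p u : lin1 t (opF (- p%:Z) u) = if t == p then lin0 u else 0.
Proof. by rewrite /lin1 sym_map_F coef1_xmul eqn_add2r. Qed.

(** On the side where the free variables start at [x_1], the variable [x_0]
    does not occur. *)
Lemma coef_small x u : (x < s)%N -> coef [:: x] (P u) = 0.
Proof.
move=> xs; have := sym_map_support hV hP u.
apply: (lspan_ind (kernel_submod (@coef_linear K [:: x]))) => _ [r rs <-] /=.
rewrite coef_mon; case: (boolP (perm_eq _ _)) => // rx.
by move: rs; rewrite /= (perm_all _ rx) /= andbT leqNgt xs.
Qed.

Lemma lin2_F t p u : lin2 t (opF (- p%:Z) u) = if (p <= t)%N then 2%:R * lin1 (t - p)%N u else 0.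
Proof.
rewrite /lin2 sym_map_F quad_xmul leq_add2r /lin1.
have [pt|tp] := leqP p t.
  rewrite (_ : (p <= t + s)%N); last by lia.
  by rewrite (_ : (t + s + s - (p + s) = t - p + s)%N) //; lia.
case: ifP => // ts; rewrite coef_small ?mulr0 //; lia.
Qed.

Lemma lin0_H0 u : lin0 (opH 0 u) = M * lin0 u.
Proof.
move: u; have [S0 SL] := eq_submod (linear_comp lin0_linear (linH 0)) (linear_scale M lin0_linear).
apply: (pbw_span hV (s := s)) => [//|fs hs es pf ph pe] /=.
case: fs pf => [_|i fs /= /andP[i0 _]]; last first.
  have -> : pbw V s (i :: fs) hs es = opF (- (i - s)%N%:Z) (pbw V s fs hs es).
    by rewrite /opF (_ : - (i - s)%N%:Z - s%:Z = - i%:Z) //; lia.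
  have i1 : - (i - s)%N%:Z <= 0 :> int by lia.
  rewrite opHF add0r (linear_mapB lin0_linear) (linear_mapZ lin0_linear).
  by rewrite !lin0_F // regular_scaleE !mulr0 subr0.
case: hs ph => [_|j hs /= /andP[j0 _]]; last first.
  have -> : pbw V s [::] (j :: hs) es = opH (- j%:Z) (pbw V s [::] hs es) by [].
  have j1 : - j%:Z < 0 :> int by lia.
  rewrite (opH_opH hV) mul0r if_same mul0r scale0r addr0.
  by rewrite !lin0_H // mulr0.
case: es pe => [_|l es /= /andP[l0 _]].
  rewrite -[pbw V s _ _ _]/v; rewrite (vac_h0 hV).
  exact: (linear_mapZ lin0_linear).
have -> : pbw V s [::] [::] (l :: es) = opC s (- l%:Z) (pbw V s [::] [::] es) by [].
rewrite (opH_opC hV) add0r (linear_mapD lin0_linear) (linear_mapZ lin0_linear).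
by rewrite !lin0_C // regular_scaleE !mulr0 addr0.
Qed.

Hypothesis two_neq0 : 2%:R != 0 :> K.

(** On the subalgebra part [H..E v] of a monomial every operator stays within
    the expected number of variables. *)
Lemma pbw_low hs es : all (leq 1) hs -> all (leq (~~ s)) es ->
  [/\ forall i, dle 0 (P (opC s i (pbw V s [::] hs es))) /\
                lin0 (opC s i (pbw V s [::] hs es)) = 0,
      forall i, dle 0 (P (opH i (pbw V s [::] hs es))),
      forall i, dle 1 (P (opA s i (pbw V s [::] hs es)))
    & dle 0 (P (pbw V s [::] hs es))].
Proof.
have D a : is_submod [set u : V | dle a (P u)] by apply: preim_submod linP _; apply: dle_submod.
have D01 u : dle 0 (P u) -> dle 1 (P u).
  by apply: lspan_subset => _ [r r0 <-]; apply: dle_mon; apply: leq_trans r0 _.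
have dH a j u : (0 < j)%N -> dle a (P u) -> dle a (P (opH (- j%:Z) u)).
  move=> j0 du; rewrite (sym_map_H hP) //; apply: (submodZ _ (dle_submod K a)).
  exact: dle_hop.
have dC a l u : (~~ s <= l)%N -> dle a (P u) -> dle a.-1 (P (opC s (- l%:Z) u)).
  by move=> l0 du; rewrite (sym_map_C hP) //; apply: dle_eop.
move=> ph pe; elim: hs ph => [_|j hs IH /= /andP[j0 /IH {IH}[hC hH hA hu]]]; last first.
  have -> : pbw V s [::] (j :: hs) es = opH (- j%:Z) (pbw V s [::] hs es) by [].
  move: (pbw V s [::] hs es) hC hH hA hu => u hC hH hA hu.
  have j1 : - j%:Z < 0 :> int by lia.
  split=> [i|i|i|]; last exact: dH.
  - have -> : opC s i (opH (- j%:Z) u) =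
        opH (- j%:Z) (opC s i u) - (2%:R * sgn K s) *: opC s (- j%:Z + i) u.
      by rewrite (opH_opC hV) addrK.
    split.
      apply: (submodB (D _)); first by apply: dH => //; case: (hC i).
      by apply: (submodZ _ (D _)); case: (hC (- j%:Z + i)).
    rewrite (linear_mapB lin0_linear) (linear_mapZ lin0_linear) lin0_H //.
    by case: (hC (- j%:Z + i)) => _ ->; rewrite scaler0 subr0.
  - rewrite (opH_opH hV); apply: (submodD (D _)); first exact: dH.
    exact: (submodZ _ (D _)).
  have -> : opA s i (opH (- j%:Z) u) =
        opH (- j%:Z) (opA s i u) + (2%:R * sgn K s) *: opA s (- j%:Z + i) u.
    by rewrite (opH_opA hV) subrK.
  apply: (submodD (D 1%N)); first by apply: dH.
  by apply: (submodZ _ (D 1%N)); apply: hA.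
elim: es pe => [_|l es IH /= /andP[l0 /IH {IH}[hC hH hA hu]]]; last first.
  have -> : pbw V s [::] [::] (l :: es) = opC s (- l%:Z) (pbw V s [::] [::] es) by [].
  move: (pbw V s [::] [::] es) hC hH hA hu => u hC hH hA hu.
  split=> [i|i|i|]; last exact: (dC 0%N).
  - rewrite (opC_comm hV); split; last exact: lin0_C.
    by apply: (dC 0%N) => //; case: (hC i).
  - rewrite (opH_opC hV); apply: (submodD (D _)); first exact: (dC 0%N).
    by apply: (submodZ _ (D _)); case: (hC (i - l%:Z)).
  have -> : opA s i (opC s (- l%:Z) u) = opC s (- l%:Z) (opA s i u) - (sgn K s *: opH (- l%:Z + i) u
      + ((if - l%:Z + i == 0 then (- l%:Z)%:~R else 0) * k) *: u).
    by rewrite (opC_opA hV) addrK.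
  apply: (submodB (D _)); first by apply: D01; apply: (dC 1%N).
  apply: D01; apply: (submodD (D 0%N)); first by apply: (submodZ _ (D 0%N)); apply: hH.
  by apply: (submodZ _ (D 0%N)).
rewrite -[pbw V s [::] [::] [::]]/v.
have Pv := sym_map_vac hP.
have P0 : P 0 = 0 by exact: (linear_map0 linP).
have d0 a : dle a (0 : sym K) by exact: (submod0 (dle_submod K a)).
have vE i : P (opC s i v) = 0.
  have [si|si] := leP s%:Z i; first by rewrite (vac_C two_neq0 hV si) P0.
  have -> : i = - `|i|%N%:Z by lia.
  by rewrite (sym_map_C hP) ?Pv ?eop_nil //; lia.
split=> [i|i|i|].
- by rewrite /lin0 vE; split=> //; apply: (linear_map0 (@coef_linear K _)).
- case: (ltrgtP i 0) => [i0|i0|->].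
  + have -> : i = - `|i|%N%:Z by lia.
    by rewrite (sym_map_H hP) ?Pv ?hop_nil ?scaler0 //; lia.
  + have -> : i = (`|i|%N.-1).+1%:Z by lia.
    by rewrite (vac_H two_neq0 hV) P0.
  rewrite (vac_h0 hV) (linear_mapZ linP) Pv; apply: (submodZ _ (dle_submod K _)).
  exact: dle_mon.
- have [si|si] := leP (~~ s)%:Z i; first by rewrite (vac_A two_neq0 hV si) P0.
  have -> : i = - `|i|%N%:Z by lia.
  rewrite (sym_map_A hP) ?Pv ?xmul_mon; first exact: dle_mon.
  by case: (s) si; lia.
- by rewrite Pv; apply: dle_mon.
Qed.

Lemma sum_pick b q (g : nat -> K) :
  \sum_(1 <= l < b.+1) (if (b - l == q)%N then g l else 0) =
  if (q < b)%N then g (b - q)%N else 0.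
Proof.
rewrite (eq_big_nat _ _ (F2 := fun l => if l == (b - q)%N then (if (q < b)%N then g l else 0) else 0)).
  rewrite -big_mkcond /= big_nat1_eq; case: (ltnP q b) => qb; last by rewrite if_same.
  by rewrite (_ : (1 <= b - q < b.+1)%N) //; lia.
move=> l /andP[l1 lb]; case: (ltnP q b) => qb.
  by rewrite (_ : (b - l == q)%N = (l == b - q)%N) //; apply/eqP/eqP; lia.
by rewrite if_same (_ : (b - l == q)%N = false) //; apply/eqP; lia.
Qed.

Definition defect_term (b l : nat) (u : V) : K^o :=
  lin2 (b - l) (opF l%:Z u) + sgn K s * lin1 (b - l) (opH l%:Z u).

(** The weight of the side is [M] or [-M]; the level contributes through the
    central term and each of the [b] terms of the sum contributes [2]. *)
Definition weight (b : nat) : K := sgn K s * M + (b + s)%:R * k + b%:R * 2%:R.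

Definition defect (b : nat) (u : V) : K^o :=
  lin0 (opE b%:Z u) - \sum_(1 <= l < b.+1) defect_term b l u - weight b * lin1 b u.

Lemma defect_linear b : linear (defect b).
Proof.
apply: linear_sub; last by apply: (linear_scale (weight b)); exact: lin1_linear.
apply: linear_sub; first by apply: linear_comp lin0_linear (opE_linear _).
apply: (@linear_bigsum K V K^o nat _ xpredT (defect_term b)) => l _.
apply: linear_add.
  by apply: linear_comp (@lin2_linear _) (opF_linear _).
by apply: (linear_scale (sgn K s)); apply: linear_comp (@lin1_linear _) (linH _).
Qed.

Lemma lin0_mulF (c : K) p u : lin0 (c *: opF (- p%:Z) u) = 0.
Proof. by rewrite (linear_mapZ lin0_linear) lin0_F ?scaler0 //; lia. Qed.

(** Every term reduces to the constant coefficient of [F_(b-p-q) u], with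
    multiplicities [-2], [-2] and [4]. *)
Lemma defect_FF b p q u : defect b (opF (- p%:Z) (opF (- q%:Z) u)) = 0.
Proof.
pose beta := lin0 (opF (b%:Z - p%:Z - q%:Z) u).
have nonpos (i : nat) : - i%:Z <= 0 :> int by lia.
have t1 : lin0 (opE b%:Z (opF (- p%:Z) (opF (- q%:Z) u))) = - 2%:R * beta.
  rewrite opEF !(linear_mapD lin0_linear) lin0_F // add0r lin0_mulF addr0.
  rewrite opHF (linear_mapZ lin0_linear) (linear_mapB lin0_linear) lin0_F // sub0r.
  rewrite (linear_mapZ lin0_linear) -/beta -[LHS]/(sgn K s * - (2%:R * sgn K s * beta)).
  transitivity (- 2%:R * (sgn K s * sgn K s) * beta); first by ring.
  by rewrite sgn_sq mulr1.
have t2 l : (1 <= l < b.+1)%N -> lin2 (b - l) (opF l%:Z (opF (- p%:Z) (opF (- q%:Z) u))) =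
    if (b - l == p + q)%N then 2%:R * lin0 (opF l%:Z u) else 0.
  move=> lb; rewrite (opF_comm l%:Z) (opF_comm l%:Z) lin2_F lin1_F.
  case: (leqP p (b - l)) => pb; last by case: eqP => //; lia.
  rewrite (_ : (b - l - p == q)%N = (b - l == p + q)%N); last by apply/eqP/eqP; lia.
  by case: eqP => // _; rewrite mulr0.
have t3 l : (1 <= l < b.+1)%N ->
    sgn K s * lin1 (b - l) (opH l%:Z (opF (- p%:Z) (opF (- q%:Z) u))) =
    (if (b - l == q)%N then - 2%:R * lin0 (opF (l%:Z - p%:Z) u) else 0)
    + (if (b - l == p)%N then - 2%:R * lin0 (opF (l%:Z - q%:Z) u) else 0).
  move=> lb; rewrite opHF (linear_mapB (@lin1_linear _)) (linear_mapZ (@lin1_linear _)).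
  rewrite (opF_comm _ (- q%:Z)) !lin1_F opHF (linear_mapB lin0_linear).
  rewrite (linear_mapZ lin0_linear) lin0_F // sub0r.
  have e x : sgn K s * (2%:R * sgn K s * x) = 2%:R * x.
    by transitivity (2%:R * (sgn K s * sgn K s) * x); [ring|rewrite sgn_sq mulr1].
  rewrite !regular_scaleE mulrBr addrC; congr (_ + _).
    by case: eqP => _; rewrite ?mulr0 ?oppr0 // e mulNr.
  by case: eqP => _; rewrite ?mulr0 // mulrN e mulNr.
rewrite /defect t1 lin1_F lin0_F // if_same mulr0 subr0.
rewrite (eq_big_nat _ _ (F2 := fun l =>
   (if (b - l == p + q)%N then 2%:R * lin0 (opF l%:Z u) else 0) +
   ((if (b - l == q)%N then - 2%:R * lin0 (opF (l%:Z - p%:Z) u) else 0)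
    + (if (b - l == p)%N then - 2%:R * lin0 (opF (l%:Z - q%:Z) u) else 0)))); last first.
  by move=> l lb; rewrite /defect_term t2 // t3.
rewrite !big_split /= (sum_pick b (p + q)%N) (sum_pick b q) (sum_pick b p).
have e1 : (if (p + q < b)%N then 2%:R * lin0 (opF (b - (p + q))%N%:Z u) else 0) = 2%:R * beta.
  case: ltnP => pqb; last by rewrite /beta lin0_F ?mulr0 //; lia.
  by rewrite /beta (_ : (b - (p + q))%N%:Z = b%:Z - p%:Z - q%:Z) //; lia.
have e2 : (if (q < b)%N then - 2%:R * lin0 (opF ((b - q)%N%:Z - p%:Z) u) else 0) = - 2%:R * beta.
  case: ltnP => pqb; last by rewrite /beta lin0_F ?mulr0 //; lia.
  by rewrite /beta (_ : (b - q)%N%:Z - p%:Z = b%:Z - p%:Z - q%:Z) //; lia.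
have e3 : (if (p < b)%N then - 2%:R * lin0 (opF ((b - p)%N%:Z - q%:Z) u) else 0) = - 2%:R * beta.
  case: ltnP => pqb; last by rewrite /beta lin0_F ?mulr0 //; lia.
  by rewrite /beta (_ : (b - p)%N%:Z - q%:Z = b%:Z - p%:Z - q%:Z) //; lia.
rewrite e1 e2 e3; move: (beta : K) => x.
rewrite -[LHS]/(- 2%:R * x - (2%:R * x + (- 2%:R * x + - 2%:R * x))); ring.
Qed.

(** The terms with [H_(b-p) u] cancel, and the two remaining sums agree after
    the shift [l -> l + p]; for [p = b] what survives is the weight. *)
Lemma defect_F b p u : defect b (opF (- p%:Z) u) = 0.
Proof.
have nonpos (i : nat) : - i%:Z <= 0 :> int by lia.
have t1 : lin0 (opE b%:Z (opF (- p%:Z) u)) = sgn K s * lin0 (opH (b%:Z - p%:Z) u)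
     + (if b == p then (b + s)%:R * k * lin0 u else 0).
  rewrite opEF !(linear_mapD lin0_linear) lin0_F // add0r !(linear_mapZ lin0_linear).
  by rewrite !regular_scaleE; case: eqP => // _; rewrite !mul0r.
have t2 l : lin2 (b - l) (opF l%:Z (opF (- p%:Z) u)) =
    if (p <= b - l)%N then 2%:R * lin1 (b - l - p) (opF l%:Z u) else 0.
  by rewrite opF_comm lin2_F.
have t3 l : sgn K s * lin1 (b - l) (opH l%:Z (opF (- p%:Z) u)) =
    (if (b - l == p)%N then sgn K s * lin0 (opH l%:Z u) else 0)
    - 2%:R * lin1 (b - l) (opF (l%:Z - p%:Z) u).
  rewrite opHF (linear_mapB (@lin1_linear _)) (linear_mapZ (@lin1_linear _)) lin1_F.
  rewrite regular_scaleE mulrBr; congr (_ - _); first by case: eqP => _; rewrite ?mulr0.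
  by transitivity (2%:R * (sgn K s * sgn K s) * lin1 (b - l) (opF (l%:Z - p%:Z) u));
    [ring|rewrite sgn_sq mulr1].
rewrite /defect t1 lin1_F.
rewrite (eq_big_nat _ _ (F2 := fun l =>
   ((if (p <= b - l)%N then 2%:R * lin1 (b - l - p) (opF l%:Z u) else 0)
    - 2%:R * lin1 (b - l) (opF (l%:Z - p%:Z) u)) +
   (if (b - l == p)%N then sgn K s * lin0 (opH l%:Z u) else 0))); last first.
  by move=> l lb; rewrite /defect_term t2 t3 addrAC addrA.
rewrite big_split /= (sum_pick b p (fun l => sgn K s * lin0 (opH l%:Z u))).
case: (ltngtP b p) => bp.
- rewrite lin0_H ?mulr0 ?addr0 ?subr0; last by lia.
  rewrite big_nat big1 ?subr0 // => l lb.
  rewrite (_ : (p <= b - l)%N = false); last by lia.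
  rewrite (_ : l%:Z - p%:Z = - (p - l)%N%:Z); last by lia.
  rewrite lin1_F (_ : (b - l == p - l)%N = false); last by lia.
  by rewrite mulr0 subr0.
- rewrite addr0 mulr0 subr0 (_ : (b - p)%N%:Z = b%:Z - p%:Z); last by lia.
  rewrite (_ : \sum_(1 <= l < b.+1) _ = 0) ?add0r ?subrr //.
  rewrite sumrB (_ : \sum_(1 <= l < b.+1) (2%:R * lin1 (b - l) (opF (l%:Z - p%:Z) u)) =
     \sum_(1 <= l < b.+1) (if (p <= b - l)%N then 2%:R * lin1 (b - l - p) (opF l%:Z u) else 0)) ?subrr //.
  rewrite (big_cat_nat _ (n := p.+1)) //=; last by lia.
  rewrite big_nat big1 ?add0r; last first.
    move=> l lb; rewrite (_ : l%:Z - p%:Z = - (p - l)%N%:Z); last by lia.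
    by rewrite lin1_F (_ : (b - l == p - l)%N = false) ?mulr0 //; lia.
  rewrite [RHS](big_cat_nat _ (n := (b - p).+1)) //=; last by lia.
  rewrite [X in _ = _ + X]big_nat [X in _ = _ + X]big1 ?addr0; last first.
    by move=> l lb; rewrite (_ : (p <= b - l)%N = false) //; lia.
  rewrite -[p.+1]addn1 addnC big_addn (_ : (b.+1 - p = (b - p).+1)%N); last by lia.
  apply: eq_big_nat => l lb; rewrite (_ : (p <= b - l)%N); last by lia.
  rewrite (_ : (b - (l + p) = b - l - p)%N); last by lia.
  by rewrite (_ : (l + p)%N%:Z - p%:Z = l%:Z) //; lia.
rewrite -bp subrr lin0_H0 addr0.
rewrite (eq_big_nat _ _ (F2 := fun l => - 2%:R * lin0 u)); last first.
  move=> l lb; rewrite (_ : (b <= b - l)%N = false); last by lia.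
  rewrite (_ : l%:Z - b%:Z = - (b - l)%N%:Z); last by lia.
  by rewrite lin1_F eqxx sub0r mulNr.
rewrite sumr_const_nat subn1 /= -[_ *+ b]mulr_natr /weight; move: (lin0 u : K) => x.
rewrite -[LHS]/(sgn K s * (M * x) + (b + s)%:R * k * x - - 2%:R * x * b%:R
   - (sgn K s * M + (b + s)%:R * k + b%:R * 2%:R) * x); ring.
Qed.

Lemma defect_low b hs es : all (leq 1) hs -> all (leq (~~ s)) es ->
  defect b (pbw V s [::] hs es) = 0.
Proof.
move=> ph pe; have [hC hH hA hu] := pbw_low ph pe.
have l1 t u : dle 0 (P u) -> lin1 t u = 0 by move=> d0; apply: (coef_dle d0).
rewrite /defect /opE (proj2 (hC _)) big1 ?(l1 _ _ hu) ?mulr0 ?subr0 // => l _.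
by rewrite /defect_term /opF /lin2 quad_dle // l1 // mulr0 addr0.
Qed.

(** The difference of the two sides vanishes on each [F_-p F_-q u] and
    [F_-p u] by the commutation relations alone, and on monomials without free
    variables for reasons of degree. *)
Theorem contravariant_identity b u :
  lin0 (opE b%:Z u) - \sum_(1 <= l < b.+1)
     (lin2 (b - l) (opF l%:Z u) + sgn K s * lin1 (b - l) (opH l%:Z u))
  = weight b * lin1 b u.
Proof.
suff : defect b u = 0 by move/eqP; rewrite subr_eq0 => /eqP.
have shift i w : (s <= i)%N -> over_T (mxa K s) i w = opF (- (i - s)%N%:Z) w.
  by move=> si; rewrite /opF (_ : - (i - s)%N%:Z - s%:Z = - i%:Z) //; lia.
move: u; apply: (pbw_span hV (s := s)) => [|fs hs es pf ph pe] /=.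
  exact: (kernel_submod (@defect_linear b)).
case: fs pf => [_|i [|j fs]]; first exact: defect_low.
  rewrite /= andbT => si.
  rewrite -[pbw _ _ _ _ _]/(over_T (mxa K s) i (pbw V s [::] hs es)) shift //.
  exact: defect_F.
move=> /= /and3P[si sj _].
rewrite -[pbw _ _ _ _ _]/(over_T (mxa K s) i (over_T (mxa K s) j (pbw V s fs hs es))).
rewrite !shift //; exact: defect_FF.
Qed.

End Contravariant.

(** * The contragredient action on dual vectors *)

Section Contragredient.
Variable K : fieldType.
Hypothesis two_neq0 : 2%:R != 0 :> K.
Variables (V : affmod K) (M k : K).
Hypothesis hV : is_verma M k V.
Variable rho : affine K -> cdual V -> cdual V.
Hypothesis hrho : is_contragredient rho.
Local Notation v := (vac V).
Local Notation affine := (affine K).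
Local Notation mx_e := (mx_e K).
Local Notation mx_f := (mx_f K).
Local Notation mx_h := (mx_h K).

Lemma cdualP (phi psi : cdual V) : (forall u, phi u = psi u) -> phi = psi.
Proof. by move=> e; apply/val_inj/funext. Qed.

Lemma form_linear u : linear (fun phi : cdual V => phi u : K^o).
Proof. by []. Qed.

Lemma rho_linear (x : affine) : sl2hat x -> linear (rho x).
Proof. by case: hrho => -[+ _ _] _ _; apply. Qed.

Lemma rho_linear_l c (x y : affine) phi : sl2hat x -> sl2hat y ->
  rho (c *: x + y) phi = c *: rho x phi + rho y phi.
Proof. by case: hrho => -[_ + _] _ _; apply. Qed.

Lemma rhoZ c (x : affine) phi : sl2hat x -> rho (c *: x) phi = c *: rho x phi.
Proof.
move=> hx; have := rho_linear_l (-1) phi hx hx.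
rewrite scaleN1r addNr scaleN1r addNr => a0.
have := rho_linear_l c phi hx (submod0 (@sl2hat_submod K)).
by rewrite !addr0 a0 addr0.
Qed.

Lemma rho_loopZ c (a : 'M[K]_2) i phi : \tr a = 0 ->
  rho (loop (c *: a) i) phi = c *: rho (loop a i) phi.
Proof.
by move=> ta; rewrite (linear_mapZ (loop_linear i)) rhoZ //; apply: sl2hat_loop.
Qed.

Lemma rho_loopD (a b : 'M[K]_2) i phi : \tr a = 0 -> \tr b = 0 ->
  rho (loop (a + b) i) phi = rho (loop a i) phi + rho (loop b i) phi.
Proof.
move=> ta tb; rewrite (linear_mapD (loop_linear i)).
have := rho_linear_l 1 phi (sl2hat_loop i ta) (sl2hat_loop i tb).
by rewrite !scale1r.
Qed.

(** [x'] is the transpose of [x] for the pairing between [V] and its dual. *)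
Definition transposes (x x' : affine) : Prop :=
  [/\ sl2hat x, sl2hat x' & forall phi u, rho x phi u = phi (aact x' u)].

Lemma transposesZ c x x' : transposes x x' -> transposes (c *: x) (c *: x').
Proof.
have SS := @sl2hat_submod K.
case=> hx hx' t; split; try exact: (submodZ _ SS).
move=> phi u; rewrite rhoZ // (aactZ hV) // (linear_mapZ (cdual_linear phi)).
by rewrite -t.
Qed.

Lemma brack_loop_pure (a b : 'M[K]_2) (i j : int) :
  (i + j = 0 -> i = 0) \/ \tr (a *m b) = 0 ->
  brack (loop a i) (loop b j) = loop (comm_mx2 a b) (i + j).
Proof.
rewrite brack_loop; case: eqP => [ij|_]; last by rewrite scale0r addr0.
by case=> [/(_ ij) ->|->]; rewrite ?mul0r ?mulr0 scale0r addr0.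
Qed.

Lemma transposes_loop_brack (a a' b b' : 'M[K]_2) (i j : int) :
  (i + j = 0 -> i = 0) \/ \tr (a *m b) = 0 /\ \tr (b' *m a') = 0 ->
  transposes (loop a i) (loop a' (- i)) -> transposes (loop b j) (loop b' (- j)) ->
  transposes (loop (comm_mx2 a b) (i + j)) (loop (comm_mx2 b' a') (- (i + j))).
Proof.
move=> c [hx hx' tx] [hy hy' ty].
have e1 : brack (loop a i) (loop b j) = loop (comm_mx2 a b) (i + j).
  by apply: brack_loop_pure; case: c => [|[]]; [left|right].
have e2 : brack (loop b' (- j)) (loop a' (- i)) = loop (comm_mx2 b' a') (- (i + j)).
  rewrite brack_loop_pure; first by rewrite opprD addrC.
  by case: c => [ij|[_]]; [left; lia|right].
split.
- by apply: sl2hat_loop; apply: tr_comm.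
- by apply: sl2hat_loop; apply: tr_comm.
move=> phi u; rewrite -e1 -e2 (aact_brack hV) // (linear_mapB (cdual_linear phi)).
case: hrho => -[_ _ rb] _ _; rewrite rb // -[LHS]/(rho _ _ u - rho _ _ u).
by rewrite !tx !ty tx.
Qed.

Let T (a a' : 'M[K]_2) i := transposes (loop a i) (loop a' (- i)).

(** The contragredient action is only given on the [e_i] and [f_i]; transposed
    pairs are stable under brackets, and these reach every mode. *)
Lemma transposes_loops i : [/\ T mx_f mx_e i, T mx_e mx_f i & T mx_h mx_h i].
Proof.
have [_ re rf] : is_contragredient rho by [].
have f0 : T mx_f mx_e 0.
  by split; [exact/sl2hat_loop/tr_f|exact/sl2hat_loop/tr_e|exact: (re false)].
have e0 : T mx_e mx_f 0.
  by split; [exact/sl2hat_loop/tr_e|exact/sl2hat_loop/tr_f|exact: (rf false)].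
have eN : T mx_e mx_f (-1).
  by split; [exact/sl2hat_loop/tr_e|exact/sl2hat_loop/tr_f|exact: (re true)].
have f1 : T mx_f mx_e 1.
  by split; [exact/sl2hat_loop/tr_f|exact/sl2hat_loop/tr_e|exact: (rf true)].
have eh : sgn K false *: mx_h = mx_h by rewrite scale1r.
have h1 : T mx_h mx_h 1.
  have := @transposes_loop_brack _ _ _ _ 0 1 (or_introl (fun _ => erefl)) e0 f1.
  by rewrite (comm_ca K false) eh.
have hN : T mx_h mx_h (-1).
  have := @transposes_loop_brack _ _ _ _ (-1) 0 _ eN f0.
  by rewrite (comm_ca K false) eh addr0; apply; left.
have n2 : - 2%:R * sgn K false != 0 :> K by rewrite mulr1 oppr_eq0.
have p2 : 2%:R * sgn K false != 0 :> K by rewrite mulr1.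
have scaleT (c : K) x x' : c != 0 -> transposes (c *: x) (c *: x') -> transposes x x'.
  by move=> c0 /(transposesZ c^-1); rewrite !scalerA mulVf // !scale1r.
have step j (d : int) : T mx_h mx_h d -> (T mx_f mx_e j -> T mx_f mx_e (d + j)) /\
    (T mx_e mx_f j -> T mx_e mx_f (d + j)).
  move=> td; split=> tj.
    have := @transposes_loop_brack _ _ _ _ d j _ td tj.
    rewrite (tr_ha K false) (comm_ha K false) commNC (comm_hc K false).
    rewrite -scaleNr -mulNr !(linear_mapZ (loop_linear _)) => tr.
    apply: scaleT n2 _; apply: tr; right; split=> //.
    by rewrite mxtrace_mulC (tr_hc K false).
  have := @transposes_loop_brack _ _ _ _ d j _ td tj.
  rewrite (tr_hc K false) (comm_hc K false) commNC (comm_ha K false).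
  rewrite -scaleNr -mulNr opprK !(linear_mapZ (loop_linear _)) => tr.
  apply: scaleT p2 _; apply: tr; right; split=> //.
  by rewrite mxtrace_mulC (tr_ha K false).
have [fi ei] : T mx_f mx_e i /\ T mx_e mx_f i.
  case: i => n.
    elim: n => [|n [IHf IHe]]; first by split.
    by have [sf se] := step n%:Z 1 h1; split; [apply: sf|apply: se].
  elim: n => [|n [IHf IHe]].
    by have [sf se] := step 0 (-1) hN; rewrite addr0 in sf se; split; [apply: sf|apply: se].
  have [sf se] := step (Negz n) (-1) hN.
  rewrite (_ : -1 + Negz n = Negz n.+1) in sf se; last by lia.
  by split; [apply: sf|apply: se].
split=> //; have := @transposes_loop_brack _ _ _ _ i 0 _ ei f0.
by rewrite (comm_ca K false) eh addr0; apply; left.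
Qed.

Lemma rho_a s i phi u : rho (loop (mxa K s) i) phi u = phi (opC s (- i) u).
Proof. by have [[_ _ rf] [_ _ re] _] := transposes_loops i; case: s; [apply: re|apply: rf]. Qed.

Lemma rho_c s i phi u : rho (loop (mxc K s) i) phi u = phi (opA s (- i) u).
Proof. by have [[_ _ rf] [_ _ re] _] := transposes_loops i; case: s; [apply: rf|apply: re]. Qed.

Lemma rho_h i phi u : rho (loop mx_h i) phi u = phi (opH (- i) u).
Proof. by have [_ _ [_ _ rh]] := transposes_loops i; apply: rh. Qed.

(** ** The dual vectors entering the statement *)

Section Side.
Variable s : bool.
Local Notation a := (mxa K s).

Lemma star_vac P u : is_sym_map s P -> star v u = lin0 P u.
Proof. by move=> hP; apply: (@star_pairing _ _ _ _ hV s P hP [::]). Qed.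

Lemma star_one P t u : is_sym_map s P ->
  star (over_T a (t + s)%N v) u = lin1 s P t u.
Proof.
move=> hP; apply: (@star_pairing _ _ _ _ hV s P hP [:: (t + s)%N]) => //=.
by rewrite leq_addl.
Qed.

Lemma star_two P m N u : is_sym_map s P -> (m < N)%N ->
  (2%:R *: \sum_(s <= i < N) \sum_(s <= j < i.+1 | (i + j == m)%N)
     star (over_T a i (over_T a j v))) u = quad m (P u).
Proof.
move=> hP mN; rewrite (linear_mapZ (form_linear u)) (linear_map_sum (form_linear u)).
transitivity (2%:R *: (\sum_(s <= i < N) \sum_(s <= j < i.+1 | (i + j == m)%N)
     coef [:: i; j] (P u)) : K^o).
  congr (_ *: _); apply: eq_big_nat => i /andP[si _].
  rewrite (linear_map_sum (form_linear u)) big_nat_cond [RHS]big_nat_cond.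
  apply: eq_bigr => j /andP[/andP[sj ji] _].
  apply: (@star_pairing _ _ _ _ hV s P hP [:: i; j]) => //=; first by rewrite si sj.
  by rewrite andbT /geq /= -ltnS.
apply/esym; have := sym_map_support hV hP u; move: (P u).
apply: eq_on_lspan; first exact: quad_linear.
  apply: (linear_scale (2%:R : K)); apply: linear_bigsum => i _.
  by apply: linear_bigsum => j _; apply: coef_linear.
by move=> _ [r rs <-]; apply: quad_sum.
Qed.

(** The contravariant identity, transposed: it collapses the action of the
    modified factor of [eta0] to a single dual basis vector. *)
Theorem star_identity b :
  rho (loop a (- (b + s)%N%:Z)) (star v)
  - \sum_(1 <= l < b.+1)
     (rho (loop (mxc K s) (s%:Z - l%:Z))
        (2%:R *: \sum_(s <= i < (b + s).+1) \sum_(s <= j < i.+1 | (i + j == b - l + s + s)%N)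
           star (over_T a i (over_T a j v)))
      + sgn K s *: rho (loop mx_h (- l%:Z)) (star (over_T a (b - l + s)%N v)))
  = weight M k s b *: star (over_T a (b + s)%N v).
Proof.
have [P hP] := sym_map_exists hV s two_neq0.
apply: cdualP => u; have := contravariant_identity hV hP two_neq0 b u.
rewrite (linear_mapZ (form_linear u)) (star_one _ _ hP) regular_scaleE => <-.
rewrite (linear_mapB (form_linear u)) (linear_map_sum (form_linear u)).
rewrite rho_a (star_vac _ hP) opprK; congr (_ - _).
apply: eq_big_nat => l lb; rewrite (linear_mapD (form_linear u)).
rewrite rho_c (star_two _ hP); last by case: (s); lia.
rewrite (linear_mapZ (form_linear u)) rho_h (star_one _ _ hP) opprK.
by rewrite (_ : - (s%:Z - l%:Z) = l%:Z - s%:Z) //; lia.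
Qed.

End Side.

(** For the contragredient action [v*] is a highest weight vector of weight
    [M]; its image under [f] is read off the case [b = 0] of the identity. *)
Lemma star_vac_f (j : nat) : rho (loop mx_f j%:Z) (star v) =
  if j == 0%N then M *: star (over_T mx_f 0 v) else 0.
Proof.
case: j => [|j] /=.
  have := star_identity false 0; rewrite big_geq // subr0 addn0 oppr0 => ->.
  by rewrite /weight /sgn mul1r !mul0r !addr0.
have [P hP] := sym_map_exists hV false two_neq0.
apply: cdualP => u; rewrite (rho_a false) (star_vac _ hP).
exact: (lin0_C (s := false)).
Qed.

Lemma star_vac_e (j : nat) : rho (loop mx_e j%:Z) (star v) = 0.
Proof.
have [P hP] := sym_map_exists hV false two_neq0.
apply: cdualP => u; rewrite (rho_c false) (star_vac _ hP).
have := lin0_F hV hP (l := - j%:Z) u; rewrite /opF subr0; apply; lia.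
Qed.

Lemma star_vac_h (j : nat) : rho (loop mx_h j%:Z) (star v) =
  if j == 0%N then M *: star v else 0.
Proof.
have [P hP] := sym_map_exists hV false two_neq0.
apply: cdualP => u; rewrite rho_h (star_vac _ hP); case: j => [|j] /=.
  by rewrite oppr0 (lin0_H0 hV hP) -(star_vac _ hP).
by rewrite (lin0_H hP) //; lia.
Qed.

(** A dual vector is supported on finitely many components, and the transpose
    of a mode of high degree moves every component beyond them. *)
Lemma rho_nilpotent (w : cdual V) : exists N : nat, forall (j : nat) (a : 'M[K]_2),
  (N <= j)%N -> \tr a = 0 -> rho (loop a j%:Z) w = 0.
Proof.
have [B wB] : exists B : nat, forall g (u : V), (B <= g.2)%N -> component g u -> w u = 0.
  case: w => w wP /=; move: (wP); rewrite unfold_in => /asboolP[_ /finite_seqP[r Er]].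
  exists (\max_(g <- r) g.2).+1 => g u Bg gu; apply/eqP/negPn/negP => wu.
  have : [set g | exists2 x : V, component g x & w x != 0] g by exists u.
  rewrite Er /= => gr; have := @leq_bigmax_seq _ r xpredT (fun g : nat * nat => g.2) g gr isT.
  by rewrite leqNgt => /negP; apply.
have lw := cdual_linear w.
exists B.+1 => -[//|j] a Bj ta.
have [x [y [z ->]]] := mx2_decomp false ta.
have kill (X : V -> V) : linear X ->
    (forall g u, component g u -> exists2 g', component g' (X u) & (j.+1 <= g'.2)%N) ->
    forall u, w (X u) = 0.
  move=> lT gT; apply: (component_span hV (kernel_submod (linear_comp lw lT))) => g u gu.
  by have [g' g'u jg] := gT _ _ gu; apply: wB g'u; lia.
have CS := component_shift two_neq0 hV.
have kf u : w (opA false (- j.+1%:Z) u) = 0.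
  move: u; apply: kill => [|g u gu]; first exact: opA_linear hV _ _.
  exists (j.+2 + g.1, j.+1 + g.2)%N; last exact: leq_addr.
  by apply: CS gu; constructor 1; exists j.+1.
have ke u : w (opC false (- j.+1%:Z) u) = 0.
  move: u; apply: kill => [|g u gu]; first exact: opC_linear hV _ _.
  exists (j + g.1, j.+1 + g.2)%N; last exact: leq_addr.
  by apply: CS gu; constructor 3; exists j.
have kh u : w (opH (- j.+1%:Z) u) = 0.
  move: u; apply: kill => [|g u gu]; first exact: opH_linear hV _.
  exists (j.+1 + g.1, j.+1 + g.2)%N; last exact: leq_addr.
  by apply: CS gu; constructor 2; exists j.
have tz (c : K) (b : 'M[K]_2) : \tr b = 0 -> \tr (c *: b) = 0.
  by move=> tb; rewrite mxtraceZ tb mulr0.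
apply: cdualP => u; rewrite !rho_loopD ?mxtraceD ?tz ?tr_mxa ?tr_mxc ?tr_h ?addr0 //.
rewrite !rho_loopZ ?tr_mxa ?tr_mxc ?tr_h //.
rewrite !(linear_mapD (form_linear u)) !(linear_mapZ (form_linear u)).
by rewrite rho_a rho_c rho_h kf ke kh !regular_scaleE !mulr0 !addr0.
Qed.

End Contragredient.

(** * Laurent expansions *)

Local Notation "x %:F" := (@FracField.tofrac _ x) : ring_scope.

Section LaurentSeries.
Variable K : fieldType.
Implicit Types (p q r : {poly K}) (c d : int -> K) (g h : ratfun K).

(** The product of a polynomial and a Laurent series. *)
Definition conv q c (m : int) : K := \sum_(i < size q) q`_i * c (m - i%:Z).

Lemma conv_wide N q c m : (size q <= N)%N ->
  conv q c m = \sum_(0 <= i < N) q`_i * c (m - i%:Z).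
Proof.
move=> qN; rewrite /conv -(big_mkord xpredT (fun i => q`_i * c (m - i%:Z))).
rewrite [RHS](big_cat_nat _ (n := size q)) //= [X in _ = _ + X]big_nat.
by rewrite [X in _ = _ + X]big1 ?addr0 // => i /andP[qi _]; rewrite nth_default ?mul0r.
Qed.

Lemma eq_conv q c d m : c =1 d -> conv q c m = conv q d m.
Proof. by move=> cd; apply: eq_bigr => i _; rewrite cd. Qed.

Lemma conv_linear_r (a : K) q c d m :
  conv q (fun j => a * c j + d j) m = a * conv q c m + conv q d m.
Proof.
rewrite /conv mulr_sumr -big_split; apply: eq_bigr => i _ /=.
by rewrite mulrDr mulrCA.
Qed.

Lemma convD q r c m : conv (q + r) c m = conv q c m + conv r c m.
Proof.
pose N := maxn (size q) (size r).
rewrite !(@conv_wide N) ?leq_maxl ?leq_maxr ?(leq_trans (size_polyD _ _)) //.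
by rewrite -big_split; apply: eq_bigr => i _; rewrite coefD mulrDl.
Qed.

Lemma conv0 c m : conv 0 c m = 0.
Proof. by rewrite /conv size_poly0 big_ord0. Qed.

Lemma convC a c m : conv a%:P c m = a * c m.
Proof.
rewrite (@conv_wide 1) ?size_polyC_leq1 // big_nat1 coefC eqxx.
by rewrite subr0.
Qed.

Lemma convMX q c m : conv (q * 'X) c m = conv q c (m - 1).
Proof.
have [->|q0] := eqVneq q 0; first by rewrite mul0r !conv0.
rewrite (@conv_wide (size q).+1) ?size_mulX // big_nat_recl // coefMX mul0r add0r.
rewrite (@conv_wide (size q)) //; apply: eq_bigr => i _; rewrite coefMX /=.
by congr (_ * c _); rewrite -addn1 PoszD; lia.
Qed.

Lemma convM q r c m : conv (q * r) c m = conv q (conv r c) m.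
Proof.
elim/poly_ind: q m => [|q a IH] m; first by rewrite mul0r !conv0.
rewrite mulrDl !convD mulrAC !convMX IH convC; congr (_ + _).
elim/poly_ind: r m {IH} => [|r b IH] m; first by rewrite mulr0 !conv0 mulr0.
by rewrite mulrDr !convD mulrA !convMX IH -rmorphM !convC mulrDr mulrA.
Qed.

Lemma poly_coefzMX p m : poly_coefz (p * 'X) m = poly_coefz p (m - 1).
Proof.
case: m => [[|m]|m].
- by rewrite /= coefMX.
- have -> : m.+1%:Z - 1 = m%:Z by lia.
  by rewrite /= coefMX.
- by have -> : Negz m - 1 = Negz m.+1 by lia.
Qed.

Lemma poly_coefzD p q m : poly_coefz (p + q) m = poly_coefz p m + poly_coefz q m.
Proof. by case: m => m /=; rewrite ?coefD ?addr0. Qed.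

Lemma poly_coefz_mul q p m : poly_coefz (q * p) m = conv q (poly_coefz p) m.
Proof.
elim/poly_ind: q m => [|q a IH] m.
  by rewrite mul0r conv0; case: m => m //=; rewrite coef0.
rewrite mulrDl poly_coefzD convD mulrAC poly_coefzMX convMX IH convC.
by congr (_ + _); case: m => m /=; rewrite ?coefCM ?mulr0.
Qed.

Definition bounded_below c : Prop := exists N : int, forall j : int, j < N -> c j = 0.

Lemma bounded_below_conv q c : bounded_below c -> bounded_below (conv q c).
Proof.
case=> N cN; exists N => j jN; rewrite /conv big1 // => i _.
by rewrite cN ?mulr0 //; lia.
Qed.

Lemma bounded_below_poly p : bounded_below (poly_coefz p).
Proof. by exists 0 => -[j|j] // j0; exfalso; lia. Qed.

Lemma bounded_below_lin a c d : bounded_below c -> bounded_below d ->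
  bounded_below (fun j => a * c j + d j).
Proof.
move=> [N cN] [N' dN]; exists (Num.min N N') => j; rewrite lt_min => /andP[jN jN'].
by rewrite cN // dN // mulr0 addr0.
Qed.

Lemma bounded_below_ind c N (S : int -> Prop) : (forall j : int, j < N -> S j) ->
  (forall j, (forall i, i < j -> S i) -> S j) -> forall j, S j.
Proof.
move=> SN IS j; have [jN|Nj] := ltP j N; first exact: SN.
have -> : j = N + `|j - N|%N%:Z by lia.
move: `|j - N|%N => n; elim/ltn_ind: n => n IH; apply: IS => i iN.
have [jN|Nj'] := ltP i N; first exact: SN.
have -> : i = N + `|i - N|%N%:Z by lia.
by apply: IH; lia.
Qed.

Lemma lowest_coef q : q != 0 -> exists2 v : nat, q`_v != 0 & forall i, (i < v)%N -> q`_i = 0.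
Proof.
move=> q0; have ex : exists i, q`_i != 0 by exists (size q).-1; rewrite -lead_coefE lead_coef_eq0.
exists (ex_minn ex); first by case: ex_minnP.
move=> i; case: ex_minnP => v _ vmin iv; apply/eqP/negPn/negP => /vmin; lia.
Qed.

(** The ring of Laurent series is an integral domain. *)
Lemma conv_cancel q c : q != 0 -> bounded_below c -> (forall m, conv q c m = 0) ->
  forall j, c j = 0.
Proof.
move=> q0 [N cN] qc; have [v qv vmin] := lowest_coef q0.
apply: (bounded_below_ind c cN) => j IH.
have := qc (j + v%:Z); rewrite (@conv_wide (maxn (size q) v.+1)) ?leq_maxl //.
rewrite (bigD1_seq v) /=; last exact: iota_uniq.
  rewrite addrK [X in _ + X]big1_seq ?addr0; first by move/eqP; rewrite mulf_eq0 (negPf qv) => /eqP.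
  move=> i /andP[iv _]; have [lt|ge] := ltnP i v; first by rewrite vmin ?mul0r.
  by rewrite IH ?mulr0 //; lia.
by rewrite mem_index_iota leq_maxr.
Qed.

(** One presentation of [g] as a quotient suffices, since another one differs
    by factors that can be cancelled. *)
Lemma is_laurentI g c p q : q != 0 -> g = p%:F / q%:F -> bounded_below c ->
  conv q c =1 poly_coefz p -> is_laurent g c.
Proof.
move=> q0 gpq bc qc; split=> // p' q' q'0 gpq' m.
have e : p * q' = p' * q by apply: frac_eq => //; rewrite -gpq -gpq'.
apply/eqP; rewrite -subr_eq0 -[X in X - _]/(conv q' c m); apply/eqP.
rewrite addrC -mulN1r.
apply: (@conv_cancel q (fun j => -1 * poly_coefz p' j + conv q' c j) q0 _ _ m).
  by apply: bounded_below_lin; [exact: bounded_below_poly|exact: bounded_below_conv].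
move=> j; rewrite conv_linear_r -poly_coefz_mul -convM mulrC [q * q']mulrC convM.
rewrite (eq_conv _ _ qc) -poly_coefz_mul [q * p']mulrC -e [q' * p]mulrC.
by rewrite mulrN1 addNr.
Qed.

Lemma is_laurent_unique g c d : is_laurent g c -> is_laurent g d -> c = d.
Proof.
move=> [bc lc] [bd ld]; have [q0 gpq] := frac_numden g.
apply/funext => j; apply/eqP; rewrite -subr_eq0; apply/eqP; move: j.
have := @conv_cancel _ (fun j => -1 * d j + c j) q0 (bounded_below_lin _ bd bc).
move=> cc j; rewrite addrC -mulN1r; apply: (cc) => m.
rewrite conv_linear_r -[conv _ c m]/(\sum_(i < _) _) -[conv _ d m]/(\sum_(i < _) _).
by rewrite (lc _ _ q0 gpq) (ld _ _ q0 gpq) mulN1r addNr.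
Qed.

Lemma laurent_eq g c : is_laurent g c -> laurent g = c.
Proof. by move=> lc; exact: (xget_unique _ lc (fun d ld => is_laurent_unique ld lc)). Qed.

(** Power series inversion: [inv_approx e n] is correct up to order [n]. *)
Fixpoint inv_approx (e : nat -> K) (n : nat) : nat -> K :=
  if n is n'.+1 then
    fun i => if i == n then - (e 0%N)^-1 * \sum_(1 <= j < n.+1) e j * inv_approx e n' (n - j)%N
             else inv_approx e n' i
  else fun=> (e 0%N)^-1.

Lemma inv_approx_stable e n i : (i <= n)%N -> inv_approx e n i = inv_approx e i i.
Proof.
elim: n => [|n IH]; first by case: i.
by rewrite leq_eqVlt => /predU1P[-> //|]; rewrite ltnS => le /=; rewrite ltn_eqF ?ltnS // IH.
Qed.

Lemma inv_series (e : nat -> K) : e 0%N != 0 -> exists d : nat -> K,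
  forall n, \sum_(0 <= j < n.+1) e j * d (n - j)%N = (n == 0%N)%:R.
Proof.
move=> e0; exists (fun i => inv_approx e i i) => -[|n].
  by rewrite big_nat1 /= divff.
rewrite big_nat_recl // subn0 [inv_approx e n.+1 n.+1]/= eqxx mulrA mulrN divff // mulN1r.
rewrite big_add1 /= addrC -sumrB big_nat big1 // => i /andP[_ ik].
by rewrite inv_approx_stable ?subrr //; lia.
Qed.

Lemma laurent_inv q : q != 0 -> exists2 c, bounded_below c & conv q c =1 poly_coefz 1.
Proof.
move=> q0; have [v qv vmin] := lowest_coef q0.
have qv0 : q`_(v + 0) != 0 by rewrite addn0.
have [d dP] := @inv_series (fun i => q`_(v + i)) qv0.
pose c (j : int) := if j + v%:Z is Posz i then d i else 0.
have c0 (j : int) : j < - v%:Z -> c j = 0.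
  by rewrite /c; case e : (j + v%:Z) => [i|i] //; lia.
have ci (j : int) i : j + v%:Z = i%:Z -> c j = d i by rewrite /c => ->.
exists c; first by exists (- v%:Z).
move=> m; case: m => [n|n]; last first.
  by rewrite /= /conv big1 // => i _; have [iv|vi] := ltnP i v; [rewrite vmin ?mul0r|rewrite c0 ?mulr0 //; lia].
rewrite (@conv_wide (maxn (size q) (v + n.+1)%N)) ?leq_maxl //.
rewrite (big_cat_nat _ (n := v)) //=; last by rewrite leq_max leq_addr orbT.
rewrite big_nat big1 ?add0r; last by move=> i /andP[_ iv]; rewrite vmin ?mul0r.
rewrite (big_cat_nat _ (n := (v + n.+1)%N)) ?leq_addr ?leq_maxr //=.
rewrite [X in _ + X]big_nat [X in _ + X]big1 ?addr0; last first.
  by move=> i /andP[iv _]; rewrite c0 ?mulr0 //; lia.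
rewrite -{1}[v]add0n big_addn addKn coef1 -dP.
apply: eq_big_nat => i ik; rewrite [(i + v)%N]addnC.
by congr (_ * _); apply: ci; lia.
Qed.

Lemma laurentP g : is_laurent g (laurent g).
Proof.
have [q0 gpq] := frac_numden g; apply: xgetPex.
have [c bc qc] := laurent_inv q0.
exists (conv \n_(repr g) c); apply: (is_laurentI q0 gpq); first exact: bounded_below_conv.
move=> m; rewrite -convM mulrC convM (eq_conv _ _ qc) -poly_coefz_mul mulr1; reflexivity.
Qed.

(** Needed for all rational functions: only then is the action of
    [sl_2(U(z))] bilinear, as a map out of a tensor product has to be. *)
Lemma laurent_linear (a : K) g h :
  laurent (a *: g + h) = (fun j => a * laurent g j + laurent h j).
Proof.
apply: laurent_eq; have [bg lg] := laurentP g; have [bh lh] := laurentP h.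
have [q0 gpq] := frac_numden g; have [s0 hrs] := frac_numden h.
move: (\n_(repr g)) (\d_(repr g)) q0 gpq => p q q0 gpq.
move: (\n_(repr h)) (\d_(repr h)) s0 hrs => r s s0 hrs.
apply: (@is_laurentI _ _ (a%:P * p * s + r * q) (q * s)).
- exact: mulf_neq0.
- rewrite {1}gpq {1}hrs -[_ *: _]/(a%:P%:F * _) mulrA -tofracM addf_div ?tofrac_eq0 //.
  by rewrite -!tofracM -tofracD.
- exact: bounded_below_lin.
move=> m; rewrite conv_linear_r mulrC {1}[q * s]mulrC !convM.
rewrite (eq_conv _ _ (lg p q q0 gpq)) (eq_conv _ _ (lh r s s0 hrs)).
rewrite -!poly_coefz_mul poly_coefzD [q * r]mulrC; congr (_ + _).
rewrite -mulrA [p * s]mulrC (poly_coefz_mul a%:P) convC mulrC; reflexivity.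
Qed.

Definition reg0 g (a : K) : Prop :=
  exists p q, [/\ q.[0] != 0, g = p%:F / q%:F & a = p.[0] / q.[0]].

Lemma reg0_neq0 q : q.[0] != 0 -> q != 0.
Proof. by apply: contraNneq => ->; rewrite horner0. Qed.

Lemma reg0_poly p : reg0 p%:F p.[0].
Proof. by exists p, 1; rewrite hornerC oner_eq0 tofrac1 !divr1. Qed.

Lemma reg0M g h a b : reg0 g a -> reg0 h b -> reg0 (g * h) (a * b).
Proof.
move=> [p [q [q0 -> ->]]] [r [s [s0 -> ->]]]; exists (p * r), (q * s).
by rewrite !hornerM mulf_neq0 // !tofracM !mulf_div.
Qed.

Lemma reg0V g a : a != 0 -> reg0 g a -> reg0 g^-1 a^-1.
Proof.
move=> a0 [p [q [q0 -> ea]]]; exists q, p; rewrite ea !invf_div; split=> //.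
by apply: contraNneq a0 => p0; rewrite ea p0 mul0r.
Qed.

Lemma reg0X g a b : reg0 g a -> reg0 (g ^+ b) (a ^+ b).
Proof.
move=> ga; elim: b => [|b IH]; last by rewrite !exprS; apply: reg0M.
by have := reg0_poly 1; rewrite tofrac1 hornerC.
Qed.

Lemma laurent_reg0 g a : reg0 g a ->
  (forall j : int, j < 0 -> laurent g j = 0) /\ laurent g 0 = a.
Proof.
move=> [p [q [q0 gpq ->]]]; have qn0 := reg0_neq0 q0.
have [[N gN] lg] := laurentP g; have {lg} := lg p q qn0 gpq.
move=> lg; have {}lg m : conv q (laurent g) m = poly_coefz p m by exact: lg.
have split0 m : (forall i, i < m -> laurent g i = 0) -> conv q (laurent g) m = q.[0] * laurent g m.
  move=> low; rewrite (@conv_wide (size q).+1) // big_nat_recl // subr0 horner_coef0.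
  by rewrite big1 ?addr0 // => i _; rewrite low ?mulr0 //; lia.
have neg (j : int) : j < 0 -> laurent g j = 0.
  apply: (bounded_below_ind (S := fun j => j < 0 -> laurent g j = 0) (laurent g) (N := N)) => {j} [j jN _|j IH j0].
    exact: gN.
  have := lg j; rewrite split0; last by move=> i ij; apply: IH => //; lia.
  case: j j0 {IH} => [j|j] // _ /= /eqP; rewrite mulf_eq0 (negPf q0) => /eqP; exact.
split=> //; have := lg 0; rewrite split0 // => /= e.
by rewrite (horner_coef0 p) -e mulrC mulKf.
Qed.

Lemma laurent_pole b : laurent (t_rat K ^- b) = (fun j : int => (j == - b%:Z)%:R).
Proof.
apply: laurent_eq; apply: (@is_laurentI _ _ 1 ('X^b)).
- by rewrite monic_neq0 ?monicXn.
- by rewrite tofrac1 div1r tofracXn.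
- by exists (- b%:Z) => j jb; rewrite lt_eqF.
move=> m; rewrite (@conv_wide b.+1) ?size_polyXn // big_nat_recr //=.
rewrite big_nat big1 ?add0r; last by move=> i /andP[_ ib]; rewrite coefXn ltn_eqF ?mul0r.
rewrite coefXn eqxx mul1r; case: m => m /=; last by rewrite (_ : (_ == _) = false) //; lia.
by rewrite coef1; congr (_%:R); congr (nat_of_bool _); apply/eqP/eqP; lia.
Qed.

(** ** Substitutions *)

Definition eval_at (x : ratfun K) (p : {poly K}) : ratfun K :=
  (map_poly (@cst_rat K) p).[x].

Definition transcendental (x : ratfun K) : Prop :=
  forall q, q != 0 -> eval_at x q != 0.

Lemma eval_atM x p q : eval_at x (p * q) = eval_at x p * eval_at x q.
Proof. by rewrite /eval_at rmorphM hornerM. Qed.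
Lemma eval_atD x p q : eval_at x (p + q) = eval_at x p + eval_at x q.
Proof. by rewrite /eval_at rmorphD hornerD. Qed.
Lemma eval_atB x p q : eval_at x (p - q) = eval_at x p - eval_at x q.
Proof. by rewrite /eval_at rmorphB hornerD hornerN. Qed.
Lemma eval_atC x (a : K) : eval_at x a%:P = cst_rat a.
Proof. by rewrite /eval_at map_polyC hornerC. Qed.
Lemma eval_atX x : eval_at x 'X = x.
Proof. by rewrite /eval_at map_polyX hornerX. Qed.
Lemma eval_atXn x p b : eval_at x (p ^+ b) = eval_at x p ^+ b.
Proof. by rewrite /eval_at rmorphXn horner_exp. Qed.

Lemma subst_frac x p q : transcendental x -> q != 0 ->
  subst_rat x (p%:F / q%:F) = eval_at x p / eval_at x q.
Proof.
move=> tx q0; have [d0 eg] := frac_numden (p%:F / q%:F).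
rewrite /subst_rat; move: (\n_(repr _)) (\d_(repr _)) d0 eg => n d d0 eg.
have nq : n * q = p * d by apply: frac_eq; rewrite -?eg.
apply/eqP; rewrite -[_.[x]]/(eval_at x n) -[X in _ / X == _]/(eval_at x d).
by rewrite eqr_div ?tx // -!eval_atM nq.
Qed.

Lemma subst_linear x (a : K) g h : transcendental x ->
  subst_rat x (a *: g + h) = a *: subst_rat x g + subst_rat x h.
Proof.
move=> tx; have [q0 gpq] := frac_numden g; have [s0 hrs] := frac_numden h.
move: (\n_(repr g)) (\d_(repr g)) q0 gpq => p q q0 ->.
move: (\n_(repr h)) (\d_(repr h)) s0 hrs => r s s0 ->.
have Z (f : ratfun K) : a *: f = (a%:P)%:F * f by [].
rewrite Z mulrA -tofracM addf_div ?tofrac_eq0 //.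
rewrite -!tofracM -tofracD !subst_frac ?mulf_neq0 //.
rewrite -[a *: _]/(cst_rat a * _) mulrA addf_div ?tx //.
by rewrite eval_atD !eval_atM eval_atC.
Qed.

Lemma subst_pole x (z : K) b : transcendental x ->
  subst_rat x ((t_rat K - cst_rat z) ^- b) = (x - cst_rat z) ^- b.
Proof.
move=> tx; rewrite /t_rat /cst_rat -tofracB -tofracXn -[_^-1]div1r -tofrac1.
rewrite subst_frac ?expf_neq0 ?polyXsubC_eq0 //.
by rewrite eval_atXn eval_atB eval_atX !eval_atC rmorph1 div1r.
Qed.

Lemma subst_monom x b : transcendental x -> subst_rat x (t_rat K ^+ b) = x ^+ b.
Proof.
move=> tx; rewrite /t_rat -tofracXn -[_%:F]divr1 -tofrac1 subst_frac ?oner_eq0 //.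
by rewrite eval_atXn eval_atX -[1]/(1%:P) eval_atC rmorph1 divr1.
Qed.

Lemma transcendental_shift a : transcendental (t_rat K + cst_rat a).
Proof.
move=> q q0; have -> : eval_at (t_rat K + cst_rat a) q = (q \Po ('X + a%:P))%:F.
  elim/poly_ind: q {q0} => [|q c IH].
    by rewrite comp_poly0 tofrac0 /eval_at rmorph0 horner0.
  rewrite eval_atD eval_atM eval_atX eval_atC IH comp_poly_MXaddC.
  by rewrite tofracD tofracM tofracD.
rewrite tofrac_eq0 -size_poly_eq0 size_comp_poly2 ?size_poly_eq0 //.
exact: size_XaddC.
Qed.

Lemma t_rat_neq0 : t_rat K != 0.
Proof. by rewrite tofrac_eq0 polyX_eq0. Qed.

Lemma transcendental_inv : transcendental (t_rat K)^-1.
Proof.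
move=> q q0; pose d := (size q).-1.
have sq : size q = d.+1 by rewrite prednK // lt0n size_poly_eq0.
pose r : {poly K} := \sum_(i < d.+1) q`_i *: 'X^(d - i).
have e : t_rat K ^+ d * eval_at (t_rat K)^-1 q = r%:F.
  rewrite /eval_at horner_coef size_map_poly sq mulr_sumr /r rmorph_sum /=.
  apply: eq_bigr => i _; rewrite coef_map /= -mul_polyC tofracM tofracXn mulrCA.
  congr (_ * _); rewrite exprVn -expfB_cond // (negPf t_rat_neq0) add0n.
  by case: i => i /=; rewrite ltnS.
have r0 : r`_0 = lead_coef q.
  rewrite /r coef_sum big_ord_recr /= big1 ?add0r => [|i _].
    by rewrite coefZ coefXn subnn mulr1 lead_coefE.
  by rewrite coefZ coefXn (_ : (0 == d - i)%N = false) ?mulr0 //; have := ltn_ord i; lia.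
apply/eqP => eq0; move: e; rewrite eq0 mulr0 => /esym/eqP; rewrite tofrac_eq0 => /eqP r00.
by move: r0; rewrite r00 coef0 => /esym/eqP; rewrite lead_coef_eq0 (negPf q0).
Qed.

End LaurentSeries.

(** * Elementary functions *)


Section FieldIdentities.
Variable F : fieldType.
Implicit Types T a b c u v : F.

Lemma partial_fraction_identity T c u v : T - u != 0 -> T - v != 0 -> u - v != 0 ->
  c * (T - u)^-1 * (T - v)^-1 =
  c * (u - v)^-1 * (T - u)^-1 - c * (u - v)^-1 * (T - v)^-1.
Proof. by move=> a0 b0 w0; field; rewrite w0 a0 b0. Qed.

Lemma monomial_division_identity T c u : T - u != 0 ->
  c * (T - u)^-1 * T = c * u * (T - u)^-1 + c.
Proof. by move=> a0; field. Qed.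

Lemma quotient_rule_identity a p q r s p' q' r' s' : q != 0 -> s != 0 ->
  ((a * p' * s + a * p * s' + (r' * q + r * q')) * (q * s)
    - (a * p * s + r * q) * (q' * s + q * s')) / (q * s) ^+ 2 =
  a * ((p' * q - p * q') / q ^+ 2) + (r' * s - r * s') / s ^+ 2.
Proof. by move=> q0 s0; field; rewrite q0 s0. Qed.

Lemma inverse_power_identity T c u : T != 0 -> u != 0 ->
  - (u * c) / (T * u) ^+ 2 = - c / (T * (T * u)).
Proof. by move=> T0 u0; field; rewrite T0 u0. Qed.

End FieldIdentities.

Section Elementary.
Variables (K : fieldType) (n : nat) (z : 'I_n -> K).
Hypothesis hz : injective z.
Local Notation t := (t_rat K).
Local Notation cst := (@cst_rat K).
Local Notation Omega := (Omega0 z).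

Lemma ratfun_scaleE (a : K) (g : ratfun K) : a *: g = cst a * g.
Proof. by []. Qed.

Lemma cst_neq0 (a : K) : a != 0 -> cst a != 0.
Proof. by rewrite fmorph_eq0. Qed.

Lemma shift_neq0 (a : K) : t - cst a != 0.
Proof. by rewrite /t_rat /cst_rat -tofracB tofrac_eq0 polyXsubC_eq0. Qed.

(** ** Partial fractions *)

Lemma partial_fractions_pole (x y : K) b : x != y ->
  (t - cst x)^-1 * (t - cst y) ^- b =
  cst ((x - y) ^- b) * (t - cst x)^-1
  - \sum_(1 <= l < b.+1) cst ((x - y) ^- l) * (t - cst y) ^- (b - l).+1.
Proof.
move=> xy; have w0 : cst (x - y) != 0 by apply: cst_neq0; rewrite subr_eq0.
have a0 := shift_neq0 x; have b0 := shift_neq0 y.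
elim: b => [|b IH].
  by rewrite big_geq // !expr0 !invr1 rmorph1 mulr1 mul1r subr0.
rewrite big_nat_recr //= subnn expr1.
have -> : \sum_(1 <= l < b.+1) cst ((x - y) ^- l) * (t - cst y) ^- (b.+1 - l).+1 =
    (\sum_(1 <= l < b.+1) cst ((x - y) ^- l) * (t - cst y) ^- (b - l).+1) / (t - cst y).
  rewrite mulr_suml; apply: eq_big_nat => l /andP[_ lb].
  by rewrite -mulrA -invfM -exprSr subSn.
rewrite [(t - cst y) ^+ b.+1]exprSr invfM mulrA IH mulrBl opprD addrA [RHS]addrAC.
rewrite rmorphB in w0; congr (_ - _).
have -> : cst ((x - y) ^- b.+1) = cst ((x - y) ^- b) * (cst x - cst y)^-1.
  by rewrite exprSr invfM rmorphM -rmorphB; congr (_ * _); apply: fmorphV.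
move: (cst ((x - y) ^- b)) => c.
exact: (@partial_fraction_identity (ratfun K) t c (cst x) (cst y) a0 b0 w0).
Qed.

Lemma partial_fractions_monom (x : K) b :
  (t - cst x)^-1 * t ^+ b = cst (x ^+ b) * (t - cst x)^-1
  + \sum_(0 <= s < b) cst (x ^+ s) * t ^+ (b - 1 - s).
Proof.
have a0 := shift_neq0 x; elim: b => [|b IH].
  by rewrite big_geq // !expr0 rmorph1 mulr1 mul1r addr0.
rewrite big_nat_recr //= subSS subn0 subnn expr0 mulr1.
have -> : \sum_(0 <= s < b) cst (x ^+ s) * t ^+ (b - s) =
   (\sum_(0 <= s < b) cst (x ^+ s) * t ^+ (b - 1 - s)) * t.
  rewrite mulr_suml; apply: eq_big_nat => l /andP[_ lb].
  by rewrite -mulrA -exprSr; congr (_ * t ^+ _); lia.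
rewrite exprSr mulrA IH mulrDl [RHS]addrCA [LHS]addrC; congr (_ + _).
rewrite exprSr rmorphM.
exact: (@monomial_division_identity (ratfun K) t (cst (x ^+ b)) (cst x) a0).
Qed.

(** ** The twisted differential on elementary functions *)

Lemma deriv_rat_linear (a : K) (g h : ratfun K) :
  deriv_rat (a *: g + h) = a *: deriv_rat g + deriv_rat h.
Proof.
have [q0 gpq] := frac_numden g; have [s0 hrs] := frac_numden h.
move: (\n_(repr g)) (\d_(repr g)) q0 gpq => p q q0 ->.
move: (\n_(repr h)) (\d_(repr h)) s0 hrs => r s s0 ->.
rewrite !ratfun_scaleE /cst_rat mulrA -tofracM addf_div ?tofrac_eq0 //.
rewrite -!tofracM -tofracD !deriv_frac ?mulf_neq0 //.
rewrite !derivD !derivM derivC mul0r add0r !tofracB !tofracM !tofracD !tofracM.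
have Q0 : q%:F != 0 by rewrite tofrac_eq0.
have S0 : s%:F != 0 by rewrite tofrac_eq0.
exact: (@quotient_rule_identity (ratfun K) (a%:P%:F) (p%:F) (q%:F) (r%:F) (s%:F)
  (p^`()%:F) (q^`()%:F) (r^`()%:F) (s^`()%:F) Q0 S0).
Qed.

Lemma deriv_pole (x : K) b :
  deriv_rat ((t - cst x) ^- b) = - b%:R * (t - cst x) ^- b.+1.
Proof.
have -> : (t - cst x) ^- b = (1 : {poly K})%:F / (('X - x%:P) ^+ b)%:F.
  by rewrite tofracXn tofracB tofrac1 div1r.
rewrite deriv_frac ?expf_neq0 ?polyXsubC_eq0 // derivC mul0r sub0r mul1r.
rewrite deriv_exp derivXsubC mul1r tofracN -mulr_natr tofracM !tofracXn rmorph_nat.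
rewrite tofracB -[_ - _]/(t - cst x); case: b => [|b].
  by rewrite mulr0 !oppr0 !mul0r.
rewrite [_ ^+ b.+2]exprS ![_ ^+ b.+1]exprS.
have T0 := shift_neq0 x; have U0 : (t - cst x) ^+ b != 0 by rewrite expf_neq0.
exact: (@inverse_power_identity (ratfun K) _ b.+1%:R _ T0 U0).
Qed.

Lemma deriv_monom b : deriv_rat (t ^+ b) = b%:R * t ^+ b.-1.
Proof.
rewrite /t_rat -tofracXn -[_%:F]divr1 -tofrac1 deriv_frac ?oner_eq0 //.
rewrite derivC mulr0 subr0 mulr1 tofrac1 expr1n divr1 derivXn.
by rewrite -mulr_natr tofracM tofracXn rmorph_nat mulrC.
Qed.

Lemma rat_of_linear : linear (@rat_of K n z). Proof. by []. Qed.

Variables (kappa : K) (M : 'I_n -> K).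

Lemma dtilde_linear : linear (@dtilde K n z kappa M).
Proof.
move=> c x y; apply: val_inj => /=; rewrite deriv_rat_linear mulrDl scalerDr.
by rewrite [RHS]addrACA ratfun_scaleE -!mulrA.
Qed.

Lemma alphaE (g : ratfun K) : g * alpha z kappa M =
  - \sum_(i < n) cst (kappa^-1 * M i) * ((t - cst (z i))^-1 * g).
Proof.
rewrite /alpha mulrN; congr (- _); rewrite mulrA mulr_sumr; apply: eq_bigr => i _.
by rewrite rmorphM -mulrA mulrC !mulrA.
Qed.

(** The derivative and the term at the pole itself combine; the other poles
    contribute through partial fractions. *)
Lemma dtilde_pole m b : dtilde kappa M (pole z m b) =
  - (b%:R + kappa^-1 * M m) *: pole z m b.+1
  - \sum_(i < n | i != m) (kappa^-1 * M i) *: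
      ((z i - z m) ^- b *: pole z i 1
       - \sum_(1 <= l < b.+1) (z i - z m) ^- l *: pole z m (b - l).+1).
Proof.
apply: val_inj; rewrite -[RHS]/(rat_of _) -[LHS]/(deriv_rat ((t - cst (z m)) ^- b) +
  (t - cst (z m)) ^- b * alpha z kappa M).
rewrite deriv_pole alphaE (bigD1 m) //.
rewrite (linear_mapB rat_of_linear) (linear_mapZ rat_of_linear) opprD addrA; congr (_ + _).
  rewrite ratfun_scaleE rmorphN rmorphD rmorph_nat -invfM -exprS opprD mulrDl.
  by rewrite !mulNr.
congr (- _); rewrite (linear_map_sum rat_of_linear); apply: eq_bigr => i im.
rewrite (linear_mapZ rat_of_linear) ratfun_scaleE; congr (_ * _).
rewrite partial_fractions_pole; last by rewrite (inj_eq hz).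
rewrite (linear_mapB rat_of_linear) (linear_map_sum rat_of_linear).
by rewrite (linear_mapZ rat_of_linear) /= expr1.
Qed.

Lemma dtilde_monom b : dtilde kappa M (monom z b) =
  b%:R *: monom z b.-1
  - \sum_(i < n) (kappa^-1 * M i) *:
      (z i ^+ b *: pole z i 1 + \sum_(0 <= s < b) z i ^+ s *: monom z (b - 1 - s)).
Proof.
apply: val_inj; rewrite -[RHS]/(rat_of _) -[LHS]/(deriv_rat (t ^+ b) +
  t ^+ b * alpha z kappa M) deriv_monom alphaE.
rewrite (linear_mapB rat_of_linear) (linear_mapZ rat_of_linear); congr (_ - _).
  by rewrite ratfun_scaleE rmorph_nat.
rewrite (linear_map_sum rat_of_linear); apply: eq_bigr => i _.
rewrite (linear_mapZ rat_of_linear) ratfun_scaleE; congr (_ * _).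
rewrite partial_fractions_monom (linear_mapD rat_of_linear) (linear_map_sum rat_of_linear).
by rewrite (linear_mapZ rat_of_linear) /= expr1.
Qed.

(** ** Local expansions of elementary functions *)

Lemma reg0_shift (a : K) : reg0 (t + cst a) a.
Proof.
have := reg0_poly ('X + a%:P); rewrite hornerD hornerX hornerC add0r.
by rewrite tofracD.
Qed.

Lemma expand_pole_self m b :
  laurent (subst_rat (t + cst (z m)) (pole z m b)) = (fun j : int => (j == - b%:Z)%:R).
Proof.
by rewrite /= subst_pole ?addrK ?laurent_pole //; apply: transcendental_shift.
Qed.

Lemma expand_pole_other m i b : i != m ->
  reg0 (subst_rat (t + cst (z i)) (pole z m b)) ((z i - z m) ^- b).
Proof.
move=> im; rewrite /= subst_pole; last exact: transcendental_shift.
rewrite -addrA -rmorphB; apply: reg0V; last exact/reg0X/reg0_shift.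
by rewrite expf_neq0 // subr_eq0 (inj_eq hz).
Qed.

Lemma expand_pole_inf m b : (0 < b)%N -> reg0 (subst_rat t^-1 (pole z m b)) 0.
Proof.
move=> b0; rewrite /= subst_pole; last exact: transcendental_inv.
have -> : (t^-1 - cst (z m)) ^- b = (t / (1 - cst (z m) * t)) ^+ b.
  rewrite -exprVn; congr (_ ^+ _); have t0 := t_rat_neq0 K.
  rewrite -[RHS]invf_div; congr (_^-1); rewrite mulrBl div1r mulfK //.
have -> : (0 : K) = (0 / 1) ^+ b by rewrite mul0r expr0n gtn_eqF.
apply: reg0X; apply: reg0M.
  by have := reg0_shift 0; rewrite rmorph0 addr0.
apply: reg0V; first exact: oner_neq0.
have := reg0_poly (1 - (z m)%:P * 'X); rewrite !hornerE ?mulr0 ?subr0.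
by rewrite tofracB tofracM tofrac1.
Qed.

Lemma expand_monom_fin i b :
  reg0 (subst_rat (t + cst (z i)) (monom z b)) (z i ^+ b).
Proof.
rewrite /= subst_monom; last exact: transcendental_shift.
exact/reg0X/reg0_shift.
Qed.

Lemma expand_monom_inf b :
  laurent (subst_rat t^-1 (monom z b)) = (fun j : int => (j == - b%:Z)%:R).
Proof. by rewrite /= subst_monom ?exprVn ?laurent_pole //; apply: transcendental_inv. Qed.

End Elementary.

(** * The basis of elementary functions *)

Section ElementaryBasis.
Variables (K : closedFieldType) (n : nat) (z : 'I_n -> K).
Hypothesis hz : injective z.
Local Notation t := (t_rat K).
Local Notation cst := (@cst_rat K).
Local Notation Omega := (Omega0 z).

Definition elem_index := ('I_n * nat + nat)%type.

Definition elem (i : elem_index) : Omega :=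
  match i with inl mb => pole z mb.1 mb.2.+1 | inr b => monom z b end.

(** Coefficients of the principal part at a pole, and of the polynomial part
    at infinity. *)
Definition elem_coef (i : elem_index) (g : Omega) : K^o :=
  match i with
  | inl mb => laurent (subst_rat (t + cst (z mb.1)) g) (- mb.2.+1%:Z)
  | inr b => laurent (subst_rat t^-1 g) (- b%:Z)
  end.

Lemma elem_coef_linear i : linear (elem_coef i).
Proof.
have E (x : ratfun K) (j : int) : transcendental x ->
    linear (fun g : Omega => laurent (subst_rat x g) j : K^o).
  by move=> tx c g h; rewrite [rat_of _]/(c *: rat_of g + rat_of h) subst_linear // laurent_linear.
case: i => [[m b]|b] /=; apply: E; [exact: transcendental_shift|exact: transcendental_inv].
Qed.

(** A pole at [z_m] has no polar part elsewhere and vanishes at infinity; a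
    monomial has no poles at finite distance. *)
Lemma elem_coef_elem i j : elem_coef i (elem j) = (i == j)%:R.
Proof.
case: i => [[m b]|b]; case: j => [[m' b']|b'] /=.
- have [<-|mm'] := eqVneq m m'.
    rewrite expand_pole_self; congr (_%:R); congr nat_of_bool.
    by apply/eqP/eqP => [|[->] //]; move=> e; congr (inl (_, _)); lia.
  rewrite (proj1 (laurent_reg0 (expand_pole_other hz b'.+1 mm'))) //.
  by case: eqP => // -[mm _]; rewrite mm eqxx in mm'.
- by rewrite (proj1 (laurent_reg0 (expand_monom_fin z m b'))).
- have [neg zer] := laurent_reg0 (@expand_pole_inf _ _ z m' b'.+1 isT).
  by case: b => [|b]; [rewrite oppr0 zer|rewrite neg].
rewrite (expand_monom_inf z); congr (_%:R); congr nat_of_bool.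
by apply/eqP/eqP => [|[->] //]; move=> e; congr (inr _); lia.
Qed.

Definition elem_span : set Omega := lspan [set elem i | i in [set: elem_index]].

Definition elem_rat : set (ratfun K) :=
  lspan [set rat_of (elem i) | i in [set: elem_index]].

Lemma elem_rat_submod : is_submod elem_rat. Proof. exact: lspan_submod. Qed.

Lemma elem_rat_gen i : elem_rat (rat_of (elem i)).
Proof. by apply: lspan_gen; exists i. Qed.

Lemma elem_rat_poly p : elem_rat (tofrac p).
Proof.
have E : tofrac p = \sum_(i < size p) p`_i *: t ^+ i.
  rewrite -{1}[p]coefK poly_def rmorph_sum /=; apply: eq_bigr => i _.
  by rewrite -mul_polyC tofracM tofracXn.
rewrite E; apply: (submod_sum _ elem_rat_submod) => i _.
by apply: (submodZ _ elem_rat_submod); apply: (elem_rat_gen (inr (val i))).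
Qed.

Lemma elem_rat_div m g : elem_rat g -> elem_rat ((t - cst (z m))^-1 * g).
Proof.
have S := elem_rat_submod.
have lin : linear (fun g : ratfun K => (t - cst (z m))^-1 * g).
  by move=> c x y; rewrite mulrDr !ratfun_scaleE mulrCA.
have Z (c : K) (x : ratfun K) : cst c * x = c *: x by [].
have gp i b : elem_rat ((t - cst (z i)) ^- b.+1) by exact: (elem_rat_gen (inl (i, b))).
have gm b : elem_rat (t ^+ b) by exact: (elem_rat_gen (inr b)).
apply: (lspan_ind (preim_submod lin S)) => _ [i _ <-] /=; case: i => [[i b]|b] /=.
  have [->|im] := eqVneq i m; first by rewrite -invfM -exprS.
  rewrite partial_fractions_pole ?(inj_eq hz) 1?eq_sym //.
  apply: (submodB S); first by rewrite Z; apply: (submodZ _ S); apply: (gp m 0%N).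
  by apply: (submod_sum _ S) => l _; rewrite Z; apply: (submodZ _ S).
rewrite partial_fractions_monom; apply: (submodD S).
  by rewrite Z; apply: (submodZ _ S); apply: (gp m 0%N).
by apply: (submod_sum _ S) => l _; rewrite Z; apply: (submodZ _ S).
Qed.

(** Roots of the denominator outside the [z_i] cancel; at [z_i] the function
    is [(t - z_i)^-1] times one with a smaller denominator. *)
Lemma elem_rat_regular g : g \in regular z -> elem_rat g.
Proof.
have [q0 gpq] := frac_numden g; move: (\n_(repr g)) (\d_(repr g)) q0 gpq => p q.
move: {2}(size q) (leqnn (size q)) => N.
elim: N p q g => [|N IH] p q g qN q0 gpq rg.
  by rewrite leqn0 size_poly_eq0 (negPf q0) in qN.
have [/eqP/size_poly1P[c c0 qc]|q1] := eqVneq (size q) 1%N.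
  rewrite gpq qc mulrC -[_^-1]/((cst c)^-1) -fmorphV.
  by apply: (submodZ _ elem_rat_submod); apply: elem_rat_poly.
have [x /factor_theorem[q' qq']] := closed_rootP q q1.
have X0 : 'X - x%:P != 0 by rewrite polyXsubC_eq0.
have q'0 : q' != 0 by apply: contraNneq q0 => e; rewrite qq' e mul0r.
have sq' : (size q' <= N)%N.
  by move: qN; rewrite qq' size_Mmonic ?monicXsubC // size_XsubC addn2.
have T0 : tofrac ('X - x%:P) != 0 :> ratfun K by rewrite tofrac_eq0.
case: (pselect (exists i, x = z i)) => [[i xi]|nx].
  have e : g = (t - cst (z i))^-1 * (tofrac p / tofrac q').
    by rewrite gpq qq' tofracM invfM mulrA mulrC xi tofracB.
  rewrite e; apply: elem_rat_div; apply: (IH p q') => //.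
  have -> : tofrac p / tofrac q' = tofrac ('X - x%:P) * g.
    by rewrite gpq qq' tofracM invfM [(tofrac q')^-1 * _]mulrC mulrCA mulVKf.
  apply/regularP => y yz; apply: regular_atM; first exact: regular_at_poly.
  by move/regularP: rg; apply.
have xz i : x != z i by apply/eqP => xi; apply: nx; exists i.
have [p1 [q1' [q1x gpq1]]] := regularP _ _ rg x xz.
have e : p * q1' = p1 * q by apply: frac_eq; rewrite -?gpq ?(root_neq0 q1x).
have /factor_theorem[p' pp'] : root p x.
  have : root (p * q1') x by rewrite e qq' mulrA rootM root_XsubC eqxx orbT.
  by rewrite rootM (negPf q1x) orbF.
apply: (IH p' q') => //; rewrite gpq pp' qq' !tofracM invfM [(tofrac q')^-1 * _]mulrC.
by rewrite mulrA mulfK //.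
Qed.

Lemma elem_spanP (g : Omega) : elem_span g.
Proof.
have [h [hg sh]] : exists h : Omega, rat_of h = rat_of g /\ elem_span h.
  have gr : rat_of g \in regular z by case: g.
  have := elem_rat_regular gr; move: (rat_of g).
  have S : is_submod elem_span by exact: lspan_submod.
  apply: (lspan_ind (S := [set r : ratfun K | exists h : Omega, rat_of h = r /\ elem_span h])).
    split=> [|c x y [h [<- sh]] [h' [<- sh']]]; first by exists 0; split=> //; apply: submod0.
    by exists (c *: h + h'); split=> //; apply: (submodD S) => //; apply: (submodZ _ S).
  by move=> _ [i _ <-]; exists (elem i); split=> //; apply: lspan_gen; exists i.
by rewrite (_ : g = h) //; apply: val_inj.
Qed.

Lemma elem_ext (N : lmodType K) (T T' : Omega -> N) : linear T -> linear T' ->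
  (forall i, T (elem i) = T' (elem i)) -> forall g, T g = T' g.
Proof.
move=> l l' e g; apply: (eq_on_lspan l l' _ (elem_spanP g)).
by move=> _ [i _ <-].
Qed.

Lemma elem_coef_fsupp (g : Omega) : fsupp (fun i => elem_coef i g).
Proof.
have := elem_spanP g; move: g.
apply: (lspan_ind (S := [set g | fsupp (fun i => elem_coef i g)])).
  split=> [|c g h fg fh] /=.
    apply: (@fsupp_seq _ K K^o _ [::]) => i _; exact: (linear_map0 (elem_coef_linear i)).
  have [r _ gr] := fsuppP (fg : fsupp (N := K^o) _).
  have [s _ hs] := fsuppP (fh : fsupp (N := K^o) _).
  apply: (@fsupp_seq _ K K^o _ (r ++ s)) => i; rewrite mem_cat negb_or => /andP[ir is'].
  by rewrite elem_coef_linear gr // hs // scaler0 addr0.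
move=> _ [j _ <-] /=; apply: (@fsupp_seq _ K K^o _ [:: j]) => i.
by rewrite inE elem_coef_elem => /negPf ->.
Qed.

Definition elem_map (N : lmodType K) (B : elem_index -> N) (g : Omega) : N :=
  \sum_(i \in [set: elem_index]) elem_coef i g *: B i.

Lemma elem_map_linear (N : lmodType K) (B : elem_index -> N) : linear (elem_map B).
Proof.
have fB g : fsupp (fun i => elem_coef i g *: B i).
  by apply: fsupp_sub (elem_coef_fsupp g) _ => i ->; rewrite scale0r.
move=> c g h; rewrite /elem_map -fsum_linear //; apply: eq_fsbigr => i _.
by rewrite elem_coef_linear scalerDl scalerA.
Qed.

Lemma elem_map_elem (N : lmodType K) (B : elem_index -> N) j :
  elem_map B (elem j) = B j.
Proof.
rewrite /elem_map (fsum1 (i := j)) ?elem_coef_elem ?eqxx ?scale1r // => i /negPf ij.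
by rewrite elem_coef_elem ij scale0r.
Qed.

Lemma elem_coef_eq0 (g : Omega) : (forall i, elem_coef i g = 0) -> g = 0.
Proof.
move=> g0; have := elem_ext (@linear_id K Omega) (elem_map_linear elem) => /(_ _ g) ->.
  by apply: fsum0 => i; rewrite g0 scale0r.
by move=> i; rewrite elem_map_elem.
Qed.

Lemma elem_injective (N : lmodType K) (eta : Omega -> N) (L : elem_index -> N -> K^o)
    (a : elem_index -> K) : linear eta -> (forall i, linear (L i)) ->
  (forall i, a i != 0) -> (forall i j, L i (eta (elem j)) = a i * (i == j)%:R) ->
  injective eta.
Proof.
move=> leta lL a0 La g h egh; apply/eqP; rewrite -subr_eq0; apply/eqP.
apply: elem_coef_eq0 => i; have := @elem_ext _ (fun g => L i (eta g)) (fun g => a i *: elem_coef i g).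
move=> /(_ (linear_comp (lL i) leta) (linear_scale (a i) (elem_coef_linear i))).
move=> /(_ _ (g - h)); rewrite (linear_mapB leta) egh subrr (linear_map0 (lL i)).
have e j : L i (eta (elem j)) = a i *: elem_coef i (elem j) by rewrite La elem_coef_elem.
by move=> /(_ e)/esym/eqP; rewrite scaler_eq0 (negPf (a0 i)) => /eqP.
Qed.

End ElementaryBasis.

(** * The action on the tensor product *)

Section TensorProducts.
Variable K : fieldType.

Section Family.
Variables (m : nat) (W : 'I_m -> lmodType K).

Lemma dfwith_dfwith (w : Defs.family W) i (x y : W i) :
  dfwith (dfwith w x : Defs.family W) y = dfwith w y.
Proof.
apply: functional_extensionality_dep => j; case: dfwithP => [|j' ij].
  by rewrite dfwith_in.
by rewrite !dfwith_out.
Qed.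

Lemma dfwith_swap (w : Defs.family W) i j (x : W i) (y : W j) : i != j ->
  dfwith (dfwith w x : Defs.family W) y = dfwith (dfwith w y : Defs.family W) x.
Proof.
move=> ij; apply: functional_extensionality_dep => l.
have [<-|jl] := eqVneq j l; first by rewrite dfwith_in dfwith_out // dfwith_in.
rewrite dfwith_out //; have [<-|il] := eqVneq i l; first by rewrite !dfwith_in.
by rewrite !dfwith_out.
Qed.

Lemma dfwith_id (w : Defs.family W) i : dfwith w (w i) = w.
Proof. by apply: functional_extensionality_dep => j; case: dfwithP. Qed.

Lemma pure_linear (w : Defs.family W) i : linear (fun x : W i => pure (dfwith w x)).
Proof. by move=> c x y; apply: pure_multilin. Qed.

Lemma tprod_ext (N : lmodType K) (T T' : tprod W -> N) : linear T -> linear T' ->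
  (forall w, T (pure w) = T' (pure w)) -> forall u, T u = T' u.
Proof.
move=> l l' e u; rewrite (umod_gen u) !(linear_map_sum l) !(linear_map_sum l').
by apply: eq_bigr => p _; rewrite (linear_mapZ l) (linear_mapZ l') e.
Qed.

(** For [j != i] the two substitutions commute, which reduces linearity in the
    [i]-th factor to that of [pure]. *)
Lemma derivation_multilin (X : forall i, W i -> W i) : (forall i, linear (X i)) ->
  multilin (fun w : Defs.family W => \sum_i pure (dfwith w (X i (w i)))).
Proof.
move=> lX w i c x y; rewrite scaler_sumr -big_split; apply: eq_bigr => j _ /=.
have [<-|ij] := eqVneq i j; first by rewrite !dfwith_in !dfwith_dfwith lX pure_linear.
by rewrite !dfwith_out // ![dfwith (dfwith w _ : Defs.family W) (X j _)]dfwith_swap // pure_linear.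
Qed.

Lemma eval_multilin (L : forall i, W i -> K^o) : (forall i, linear (L i)) ->
  multilin (fun w : Defs.family W => \prod_i (L i (w i) : K) : K^o).
Proof.
move=> lL w i c x y.
have E (u : W i) : \prod_j (L j (dfwith w u j) : K) =
    (L i u : K) * \prod_(j < m | j != i) (L j (w j) : K).
  rewrite (bigD1 i) //= dfwith_in; congr (_ * _).
  by apply: eq_bigr => j ji; rewrite dfwith_out // eq_sym.
rewrite !E lL; move: (\prod_(_ < _ | _) _) => p.
by rewrite -[LHS]/((c * (L i x : K) + L i y) * p) mulrDl -mulrA.
Qed.

End Family.

End TensorProducts.

Section Action.
Variables (K : fieldType) (n : nat) (z : 'I_n -> K).
Hypothesis two_neq0 : 2%:R != 0 :> K.
Variables (M : 'I_n.+1 -> K) (k : K) (V : 'I_n.+1 -> affmod K).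
Hypothesis hV : forall i, is_verma (M i) k (V i).
Variable rho : forall i, affine K -> cdual (V i) -> cdual (V i).
Hypothesis hrho : forall i, is_contragredient (@rho i).
Local Notation t := (t_rat K).
Local Notation cst := (@cst_rat K).
Local Notation sl2 := (sl2U z).

Definition local_coord (i : 'I_n.+1) : ratfun K :=
  if unlift ord_max i is Some m then t + cst (z m) else t^-1.

Lemma local_coord_transcendental i : transcendental (local_coord i).
Proof.
rewrite /local_coord; case: (unlift _ _) => [m|].
  exact: transcendental_shift.
exact: transcendental_inv.
Qed.

Lemma expansion_linear (x : ratfun K) j : transcendental x ->
  linear (fun A : sl2 => expansion x A j).
Proof.
move=> tx c A B; apply/matrixP => p q; rewrite !mxE.
by rewrite -[c *: mx_of A p q + _]/(c *: (mx_of A p q) + mx_of B p q) subst_linear // laurent_linear.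
Qed.

Lemma pi_sl2_linear : linear (@pi_sl2 K).
Proof. by move=> c a b; apply/matrixP => p q; rewrite !mxE. Qed.

Lemma local_series_linear i j : linear (fun A : sl2 => local_series i A j).
Proof.
have := @local_coord_transcendental i; rewrite /local_coord /local_series.
case: (unlift _ _) => [m|] tx; first exact: expansion_linear.
exact: linear_comp pi_sl2_linear (expansion_linear _ tx).
Qed.

Lemma expansion_trace (x : ratfun K) (A : sl2) j : transcendental x ->
  \tr (expansion x A j) = 0.
Proof.
move=> tx; have trA : \tr (mx_of A) = 0 by case: A => A /= /sl2_regularP[].
rewrite mx2_trE !mxE; have lin : linear (fun g : ratfun K => laurent (subst_rat x g) j : K^o).
  by move=> c g h; rewrite subst_linear // laurent_linear.
have tr2 : mx_of A 0 0 + mx_of A 1 1 = 0.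
  by rewrite -trA /mxtrace big_ord_recl big_ord1; congr (_ + mx_of A _ _); apply: val_inj.
by have := linear_mapD lin (mx_of A 0 0) (mx_of A 1 1); rewrite tr2 (linear_map0 lin) => <-.
Qed.

Lemma local_series_trace i (A : sl2) j : \tr (local_series i A j) = 0.
Proof.
have := @local_coord_transcendental i; rewrite /local_coord /local_series.
case: (unlift _ _) => [m|] tx; first exact: expansion_trace.
have := expansion_trace A j tx; rewrite !mx2_trE !mxE addrC.
by move=> <-; congr (laurent (subst_rat _ (mx_of A _ _)) _ + laurent (subst_rat _ (mx_of A _ _)) _);
  apply: val_inj.
Qed.

Lemma expansion_bounded (x : ratfun K) (A : sl2) : exists N : int, forall j : int, j < N ->
  expansion x A j = 0.
Proof.
have B (g : ratfun K) : exists N : int, forall j : int, j < N -> laurent (subst_rat x g) j = 0.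
  by case: (laurentP (subst_rat x g)).
have [N00 b00] := B (mx_of A 0 0); have [N01 b01] := B (mx_of A 0 1).
have [N10 b10] := B (mx_of A 1 0); have [N11 b11] := B (mx_of A 1 1).
exists (Num.min (Num.min N00 N01) (Num.min N10 N11)) => j.
rewrite !lt_min => /andP[/andP[j00 j01] /andP[j10 j11]].
by apply: mx2P; rewrite !mxE ?b00 ?b01 ?b10 ?b11.
Qed.

Lemma local_series_bounded i (A : sl2) : exists N : int, forall j : int, j < N ->
  local_series i A j = 0.
Proof.
rewrite /local_series; case: (unlift _ _) => [m|]; first exact: expansion_bounded.
have [N b] := expansion_bounded t^-1 A; exists N => j jN.
by rewrite b // (linear_map0 pi_sl2_linear).
Qed.

Lemma rho_loop0 i j (w : cdual (V i)) : rho (loop 0 j) w = 0.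
Proof.
by rewrite -(scale0r (mx_h K)) (rho_loopZ (hrho i)) ?tr_h // scale0r.
Qed.

(** Low modes vanish because the expansion starts somewhere, high modes
    because they kill [w]. *)
Lemma local_act_fsupp i (A : sl2) (w : cdual (V i)) :
  fsupp (fun j : int => rho (loop (local_series i A j) j) w).
Proof.
have [N bN] := local_series_bounded i A.
have [N' wN] := rho_nilpotent two_neq0 (hV i) (hrho i) w.
apply: (@fsupp_seq _ _ _ _ [seq N + l%:Z | l <- iota 0 (`|N| + N')%N]) => j jn.
have [jN|Nj] := ltP j N; first by rewrite bN // rho_loop0.
have [jN'|Nj'] := ltP j N'%:Z; last first.
  by rewrite (_ : j = `|j|%N%:Z) ?wN ?local_series_trace //; lia.
case/negP: jn; apply/mapP; exists `|j - N|%N; last by lia.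
by rewrite mem_iota; lia.
Qed.

Lemma local_act_linear i (A : sl2) : linear (local_act (V := V) rho A : dualV V i -> dualV V i).
Proof.
move=> c x y; rewrite /local_act -fsum_linear; try exact: local_act_fsupp.
apply: eq_fsbigr => j _; apply: (rho_linear (hrho i)).
exact/sl2hat_loop/local_series_trace.
Qed.

Lemma local_act_linear_l i (w : dualV V i) : linear (fun A : sl2 => local_act rho A w).
Proof.
move=> c A B; rewrite /local_act -fsum_linear; try exact: local_act_fsupp.
apply: eq_fsbigr => j _; rewrite local_series_linear.
rewrite (rho_loopD (hrho i)) ?(rho_loopZ (hrho i)) ?mxtraceZ ?local_series_trace ?mulr0 //.
Qed.

Lemma sl2U_act_good (A : sl2) : multilin (fun w : Defs.family (dualV V) =>
  \sum_i pure (dfwith w (local_act rho A (w i)))).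
Proof.
exact: (derivation_multilin (X := fun i => local_act (V := V) rho A) (fun i => @local_act_linear i A)).
Qed.

Lemma sl2U_act_linear (A : sl2) : linear (sl2U_act (V := V) rho A).
Proof. exact: ulift_linear (sl2U_act_good A). Qed.

Lemma sl2U_act_pure (A : sl2) (w : Defs.family (dualV V)) :
  sl2U_act rho A (pure w) = \sum_i pure (dfwith w (local_act rho A (w i))).
Proof. exact: (ulift_gen _ (sl2U_act_good A)). Qed.

Lemma sl2U_act_linear_l (u : W V) : linear (fun A : sl2 => sl2U_act rho A u).
Proof.
move=> c A B; move: u; apply: tprod_ext; first exact: sl2U_act_linear.
  by apply: linear_add; [apply: linear_scale|]; apply: sl2U_act_linear.
move=> w; rewrite !sl2U_act_pure scaler_sumr -big_split; apply: eq_bigr => i _ /=.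
by rewrite local_act_linear_l pure_linear.
Qed.

Lemma chain_d_good : bilin (fun p : sl2 * W V => sl2U_act rho p.1 p.2).
Proof.
by split=> [c A B u|c A u w] /=; [apply: sl2U_act_linear_l|apply: sl2U_act_linear].
Qed.

Lemma chain_d_linear : linear (chain_d (z := z) (V := V) rho).
Proof. exact: ulift_linear chain_d_good. Qed.

Lemma chain_d_tens (A : sl2) (u : W V) : chain_d rho (tens A u) = sl2U_act rho A u.
Proof. exact: (ulift_gen _ chain_d_good). Qed.

(** ** Action of elementary functions on one factor *)

(** The twist by [pi] at infinity. *)
Definition local_mx (i : 'I_n.+1) (a : 'M[K]_2) : 'M[K]_2 :=
  if unlift ord_max i is Some _ then a else pi_sl2 a.

Lemma tr_local_mx i a : \tr a = 0 -> \tr (local_mx i a) = 0.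
Proof.
rewrite /local_mx; case: (unlift _ _) => // ta; rewrite -ta !mx2_trE !mxE addrC.
by congr (a _ _ + a _ _); apply: val_inj.
Qed.

Lemma local_series_mulU i (a : 'M[K]_2) (ta : \tr a = 0) (g : Omega0 z) j :
  local_series i (mulU ta g) j = laurent (subst_rat (local_coord i) g) j *: local_mx i a.
Proof.
have E (x : ratfun K) : transcendental x ->
    expansion x (mulU ta g) j = laurent (subst_rat x g) j *: a.
  move=> tx; apply/matrixP => p q; rewrite !mxE.
  have := laurent_linear (a p q) (subst_rat x g) 0.
  have := subst_linear (a p q) (rat_of g) 0 tx.
  have z0 : subst_rat x (0 : ratfun K) = 0.
    have := subst_linear (-1) 0 0 tx; rewrite scaler0 addr0 scaleN1r addNr; exact.
  have l0 : laurent (0 : ratfun K) = (fun=> 0).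
    have := laurent_linear (-1) (0 : ratfun K) 0; rewrite scaler0 addr0 => ->.
    by apply/funext => l; rewrite mulN1r addNr.
  rewrite !addr0 z0 addr0 => -> ->; rewrite l0 addr0 mulrC; reflexivity.
have := @local_coord_transcendental i; rewrite /local_series /local_coord /local_mx.
case: (unlift _ _) => [m|] tx; rewrite E // (linear_mapZ pi_sl2_linear); reflexivity.
Qed.

Lemma local_act_polar i (a : 'M[K]_2) (ta : \tr a = 0) (g : Omega0 z) b (w : dualV V i) :
  laurent (subst_rat (local_coord i) g) = (fun j : int => (j == - b%:Z)%:R) ->
  local_act rho (mulU ta g) w = rho (loop (local_mx i a) (- b%:Z)) w.
Proof.
move=> lg; rewrite /local_act (fsum1 (i := - b%:Z)) => [|j jb].
  by rewrite local_series_mulU lg eqxx scale1r.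
by rewrite local_series_mulU lg (negPf jb) scale0r rho_loop0.
Qed.

Lemma local_act_regular i (a : 'M[K]_2) (ta : \tr a = 0) (g : Omega0 z) x (w : dualV V i) :
  reg0 (subst_rat (local_coord i) g) x ->
  (forall j : nat, (0 < j)%N -> rho (loop (local_mx i a) j%:Z) w = 0) ->
  local_act rho (mulU ta g) w = x *: rho (loop (local_mx i a) 0) w.
Proof.
move=> /laurent_reg0[neg zer] pos; rewrite /local_act (fsum1 (i := 0)) => [|j j0].
  by rewrite local_series_mulU zer (rho_loopZ (hrho i)) ?tr_local_mx.
rewrite local_series_mulU (rho_loopZ (hrho i)) ?tr_local_mx //.
have [j1|j1] := ltP j 0; first by rewrite neg // scale0r.
by rewrite (_ : j = `|j|%N%:Z) ?pos ?scaler0 //; lia.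
Qed.

End Action.

(** * The morphism of complexes *)

Section Morphism.
Variables (K : fieldType) (n : nat) (z : 'I_n -> K).
Hypothesis hz : injective z.
Hypothesis two_neq0 : 2%:R != 0 :> K.
Variables (M : 'I_n.+1 -> K) (k : K) (V : 'I_n.+1 -> affmod K).
Hypothesis hV : forall i, is_verma (M i) k (V i).
Variable rho : forall i, affine K -> cdual (V i) -> cdual (V i).
Hypothesis hrho : forall i, is_contragredient (@rho i).
Local Notation mx_e := (mx_e K).
Local Notation mx_f := (mx_f K).
Local Notation mx_h := (mx_h K).
Local Notation sl2 := (sl2U z).
Local Notation v i := (vac (V i)).

Definition psi_f i b l : dualV V i :=
  2%:R *: \sum_(0 <= p < b.+1) \sum_(0 <= q < p.+1 | (p + q == b - l)%N)
             star (f_ p (f_ q (v i))).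

Definition psi_e i b l : dualV V i :=
  2%:R *: \sum_(1 <= p < b.+1) \sum_(1 <= q < p.+1 | (p + q == b - l)%N)
             star (e_ p (e_ q (v i))).

(** At a finite point the free variables are the [f T^-i], at infinity the
    [e T^-i]; there the weight changes sign and the indices are shifted by
    one, which turns [M + b kappa] into [b kappa - M - 2]. *)
Lemma finite_identity i b :
  rho (loop mx_f (- b%:Z)) (star (v i)) - \sum_(1 <= l < b.+1)
    (rho (loop mx_e (- l%:Z)) (psi_f i b l)
     + rho (loop mx_h (- l%:Z)) (star (f_ (b - l) (v i))))
  = (M i + b%:R * (k + 2%:R)) *: star (f_ b (v i)).
Proof.
have := star_identity two_neq0 (hV i) (hrho i) false b; rewrite /= !addn0.
rewrite /weight /sgn mul1r addn0 -addrA -mulrDr => <-; congr (_ - _).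
apply: eq_bigr => l _; rewrite sub0r scale1r; congr (rho _ (_ *: _) + rho _ _).
  by apply: eq_bigr => p _; apply: eq_bigl => q; rewrite !addn0.
by rewrite addn0.
Qed.

Lemma infinite_identity i b : (0 < b)%N ->
  rho (loop mx_e (- b%:Z)) (star (v i)) - \sum_(0 <= l < b.-1)
    (rho (loop mx_f (- l%:Z)) (psi_e i b l)
     - rho (loop mx_h (- l.+1%:Z)) (star (e_ (b - l - 1) (v i))))
  = (b%:R * (k + 2%:R) - M i - 2%:R) *: star (e_ b (v i)).
Proof.
case: b => // b _; have := star_identity two_neq0 (hV i) (hrho i) true b.
rewrite big_add1 /= !addn1 => E.
have -> : b.+1%:R * (k + 2%:R) - M i - 2%:R = weight (M i) k true b.
  by rewrite /weight /sgn addn1 -natr1; ring.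
rewrite -[e_ b.+1 _]/(over_T (mxa K true) b.+1 (v i)) -E; congr (_ - _).
apply: eq_big_nat => l /andP[_ lb]; rewrite scaleN1r.
have -> : 1%:Z - l.+1%:Z = - l%:Z by lia.
have -> : (b - l.+1 + 1 = b.+1 - l - 1)%N by lia.
congr (rho _ (_ *: _) - _).
apply: eq_bigr => p _; apply: eq_bigl => q.
by congr (_ == _); lia.
Qed.

(** ** Positions *)

Lemma sum_positions (N : nmodType) (F : 'I_n.+1 -> N) :
  \sum_i F i = \sum_m F (fin m) + F ord_max.
Proof.
rewrite big_ord_recr /=; congr (_ + _); apply: eq_bigr => m _; congr F.
by apply: val_inj; rewrite /= /bump leqNgt ltn_ord.
Qed.

Lemma fin_inj : injective (@fin n).
Proof. exact: lift_inj. Qed.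

Lemma fin_max m : fin m != ord_max :> 'I_n.+1.
Proof. by rewrite eq_sym neq_lift. Qed.

Lemma local_coord_fin m : local_coord z (fin m) = t_rat K + cst_rat (z m).
Proof. by rewrite /local_coord /fin liftK. Qed.

Lemma local_coord_max : local_coord z ord_max = (t_rat K)^-1.
Proof. by rewrite /local_coord unlift_none. Qed.

Lemma local_mx_fin m a : local_mx (@fin n m) a = a :> 'M[K]_2.
Proof. by rewrite /local_mx /fin liftK. Qed.

Lemma local_mx_max a : local_mx (@ord_max n) a = pi_sl2 a :> 'M[K]_2.
Proof. by rewrite /local_mx unlift_none. Qed.

Lemma pi_e : pi_sl2 mx_e = mx_f.
Proof. by apply: mx2P; rewrite !mxE. Qed.
Lemma pi_f : pi_sl2 mx_f = mx_e.
Proof. by apply: mx2P; rewrite !mxE. Qed.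
Lemma pi_h : pi_sl2 mx_h = - mx_h.
Proof. by apply: mx2P; rewrite !mxE /=; ring. Qed.

Lemma at_pos_linear i : linear (@at_pos K n V i).
Proof. exact: pure_linear. Qed.

Lemma act_vac (A : sl2) : sl2U_act rho A (pure (vstar V)) =
  \sum_i at_pos (local_act rho A (vstar V i)).
Proof. exact: (sl2U_act_pure two_neq0 hV hrho). Qed.

Lemma act_at_pos (A : sl2) i (w : dualV V i) (c : 'I_n.+1 -> K) :
  (forall j, j != i -> local_act rho A (vstar V j) = c j *: vstar V j) ->
  sl2U_act rho A (at_pos w) = at_pos (local_act rho A w) + (\sum_(j | j != i) c j) *: at_pos w.
Proof.
move=> Ac; rewrite (sl2U_act_pure two_neq0 hV hrho) (bigD1 i) //= dfwith_in dfwith_dfwith.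
congr (_ + _); rewrite scaler_suml; apply: eq_bigr => j ji.
rewrite dfwith_out 1?eq_sym // Ac // (linear_mapZ (@pure_linear _ _ _ _ j)); congr (_ *: pure _).
by rewrite dfwith_swap 1?eq_sym // dfwith_id.
Qed.

Lemma sum_other (c : 'I_n -> K) m :
  \sum_(j : 'I_n.+1 | j != fin m) (if unlift ord_max j is Some i then c i else 0) =
  \sum_(i < n | i != m) c i.
Proof.
rewrite big_mkcond sum_positions unlift_none if_same addr0 [RHS]big_mkcond.
apply: eq_bigr => i _; rewrite (inj_eq fin_inj) /fin liftK; reflexivity.
Qed.

(** ** Action of the terms of [eta0] *)

(** A function regular at a point acts on [v*] through its value there, and
    [1/(t - z_m)^b] is a pure mode at [z_m]; hence each term below is local up
    to scalars. *)
Lemma act_f_pole m b : (0 < b)%N ->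
  sl2U_act rho (fU (pole z m b)) (pure (vstar V)) =
  at_pos (rho (loop mx_f (- b%:Z)) (star (v (fin m))))
  + \sum_(i < n | i != m) ((z i - z m) ^- b * M (fin i)) *: at_pos (star (f_ 0 (v (fin i)))).
Proof.
move=> b0; rewrite act_vac sum_positions (bigD1 m) //= -addrA; congr (_ + _).
  rewrite (local_act_polar hrho _ (b := b)) ?local_mx_fin //.
  by rewrite local_coord_fin expand_pole_self.
rewrite (local_act_regular two_neq0 hrho _ (x := 0)).
- rewrite scale0r (linear_map0 (@at_pos_linear _)) addr0; apply: eq_bigr => i im.
  rewrite (local_act_regular two_neq0 hrho _ (x := (z i - z m) ^- b)).
  + rewrite local_mx_fin (star_vac_f two_neq0 (hV _) (hrho _) 0) /= scalerA.
    by rewrite (linear_mapZ (@at_pos_linear _)).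
  + by rewrite local_coord_fin; apply: expand_pole_other.
  by move=> j j0; rewrite local_mx_fin (star_vac_f two_neq0 (hV _) (hrho _)) gtn_eqF.
- by rewrite local_coord_max; apply: expand_pole_inf.
by move=> j j0; rewrite local_mx_max pi_f (star_vac_e two_neq0 (hV _) (hrho _)).
Qed.

Lemma act_e_pole m l (w : dualV V (fin m)) : (0 < l)%N ->
  sl2U_act rho (eU (pole z m l)) (at_pos w) = at_pos (rho (loop mx_e (- l%:Z)) w).
Proof.
move=> l0; rewrite (act_at_pos _ (c := fun=> 0)).
  rewrite big1 // scale0r addr0 (local_act_polar hrho _ (b := l)) ?local_mx_fin //.
  by rewrite local_coord_fin expand_pole_self.
move=> j; case: (unliftP ord_max j) => [i ->|->] jm.
  have im : i != m by apply: contraNneq jm => ->.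
  rewrite (local_act_regular two_neq0 hrho _ (x := (z i - z m) ^- l)).
  - by rewrite local_mx_fin (star_vac_e two_neq0 (hV _) (hrho _) 0) scaler0 scale0r.
  - by rewrite local_coord_fin; apply: expand_pole_other.
  by move=> j' j0; rewrite local_mx_fin (star_vac_e two_neq0 (hV _) (hrho _)).
rewrite (local_act_regular two_neq0 hrho _ (x := 0)) ?scale0r //.
  by rewrite local_coord_max; apply: expand_pole_inf.
by move=> j' j0; rewrite local_mx_max pi_e (star_vac_f two_neq0 (hV _) (hrho _)) gtn_eqF.
Qed.

Lemma act_h_pole m l (w : dualV V (fin m)) : (0 < l)%N ->
  sl2U_act rho (hU (pole z m l)) (at_pos w) = at_pos (rho (loop mx_h (- l%:Z)) w)
  + (\sum_(i < n | i != m) (z i - z m) ^- l * M (fin i)) *: at_pos w.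
Proof.
move=> l0; rewrite (act_at_pos _ (c := fun j => if unlift ord_max j is Some i then
   (z i - z m) ^- l * M (fin i) else 0)).
  rewrite (sum_other (fun i => (z i - z m) ^- l * M (fin i))); congr (at_pos _ + _).
  by rewrite (local_act_polar hrho _ (b := l)) ?local_mx_fin // local_coord_fin expand_pole_self.
move=> j; case: (unliftP ord_max j) => [i ->|->] jm.
  have im : i != m by apply: contraNneq jm => ->.
  rewrite (local_act_regular two_neq0 hrho _ (x := (z i - z m) ^- l)).
  - by rewrite local_mx_fin (star_vac_h two_neq0 (hV _) (hrho _) 0) /= scalerA.
  - by rewrite local_coord_fin; apply: expand_pole_other.
  by move=> j' j0; rewrite local_mx_fin (star_vac_h two_neq0 (hV _) (hrho _)) gtn_eqF.
rewrite (local_act_regular two_neq0 hrho _ (x := 0)) ?scale0r ?unlift_none ?scale0r //.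
  by rewrite local_coord_max; apply: expand_pole_inf.
move=> j' j0; rewrite local_mx_max pi_h -[- mx_h]scaleN1r (rho_loopZ (hrho _)) ?tr_h //.
by rewrite (star_vac_h two_neq0 (hV _) (hrho _)) gtn_eqF // scaler0.
Qed.

Lemma act_f_monom b :
  sl2U_act rho (fU (monom z b)) (pure (vstar V)) =
  \sum_(i < n) (z i ^+ b * M (fin i)) *: at_pos (star (f_ 0 (v (fin i))))
  + at_pos (rho (loop mx_e (- b%:Z)) (star (v ord_max))).
Proof.
rewrite act_vac sum_positions; congr (_ + _); last first.
  rewrite (local_act_polar hrho _ (b := b)) ?local_mx_max ?pi_f //.
  by rewrite local_coord_max expand_monom_inf.
apply: eq_bigr => i _; rewrite (local_act_regular two_neq0 hrho _ (x := z i ^+ b)).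
- rewrite local_mx_fin (star_vac_f two_neq0 (hV _) (hrho _) 0) /= scalerA.
  by rewrite (linear_mapZ (@at_pos_linear _)).
- by rewrite local_coord_fin; apply: expand_monom_fin.
by move=> j j0; rewrite local_mx_fin (star_vac_f two_neq0 (hV _) (hrho _)) gtn_eqF.
Qed.

Lemma sum_fin (c : 'I_n -> K) :
  \sum_(j : 'I_n.+1 | j != ord_max) (if unlift ord_max j is Some i then c i else 0) =
  \sum_(i < n) c i.
Proof.
rewrite big_mkcond sum_positions eqxx addr0.
by apply: eq_bigr => i _; rewrite fin_max /fin liftK.
Qed.

Lemma act_e_monom l (w : dualV V ord_max) :
  sl2U_act rho (eU (monom z l)) (at_pos w) = at_pos (rho (loop mx_f (- l%:Z)) w).
Proof.
rewrite (act_at_pos _ (c := fun=> 0)).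
  rewrite big1 // scale0r addr0 (local_act_polar hrho _ (b := l)) ?local_mx_max ?pi_e //.
  by rewrite local_coord_max expand_monom_inf.
move=> j; case: (unliftP ord_max j) => [i ->|->] jm; last by rewrite eqxx in jm.
rewrite (local_act_regular two_neq0 hrho _ (x := z i ^+ l)).
- by rewrite local_mx_fin (star_vac_e two_neq0 (hV _) (hrho _) 0) scaler0 scale0r.
- by rewrite local_coord_fin; apply: expand_monom_fin.
by move=> j' j0; rewrite local_mx_fin (star_vac_e two_neq0 (hV _) (hrho _)).
Qed.

Lemma act_h_monom l (w : dualV V ord_max) :
  sl2U_act rho (hU (monom z l)) (at_pos w) = - at_pos (rho (loop mx_h (- l%:Z)) w)
  + (\sum_(i < n) z i ^+ l * M (fin i)) *: at_pos w.
Proof.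
rewrite (act_at_pos _ (c := fun j => if unlift ord_max j is Some i then
   z i ^+ l * M (fin i) else 0)).
  rewrite (sum_fin (fun i => z i ^+ l * M (fin i))); congr (_ + _).
  rewrite (local_act_polar hrho _ (b := l)); last by rewrite local_coord_max expand_monom_inf.
  rewrite local_mx_max pi_h -[- mx_h]scaleN1r (rho_loopZ (hrho _)) ?tr_h // scaleN1r.
  exact: (linear_mapN (@at_pos_linear _)).
move=> j; case: (unliftP ord_max j) => [i ->|->] jm; last by rewrite eqxx in jm.
rewrite (local_act_regular two_neq0 hrho _ (x := z i ^+ l)).
- by rewrite local_mx_fin (star_vac_h two_neq0 (hV _) (hrho _) 0) /= scalerA.
- by rewrite local_coord_fin; apply: expand_monom_fin.
by move=> j' j0; rewrite local_mx_fin (star_vac_h two_neq0 (hV _) (hrho _)) gtn_eqF.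
Qed.

End Morphism.

(** * The theorem *)

Section Main.
Variables (K : closedFieldType) (n : nat) (z : 'I_n -> K).
Hypothesis hz : injective z.
Hypothesis two_neq0 : 2%:R != 0 :> K.
Variables (M : 'I_n.+1 -> K) (k : K) (V : 'I_n.+1 -> affmod K).
Hypothesis hM : M ord_max = \sum_(m < n) M (fin m) - 2%:R.
Hypothesis hV : forall i, is_verma (M i) k (V i).
Variable rho : forall i, affine K -> cdual (V i) -> cdual (V i).
Hypothesis hrho : forall i, is_contragredient (@rho i).
Local Notation kappa := (k + 2%:R).
Hypothesis kappa_neq0 : kappa != 0.
Local Notation v i := (vac (V i)).
Local Notation Omega := (Omega0 z).

Definition eta1_elem (i : elem_index n) : W V :=
  match i with
  | inl mb => - kappa *: at_pos (star (f_ mb.2 (v (fin mb.1))))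
  | inr b => kappa *: at_pos (star (e_ b.+1 (v ord_max)))
  end.

Definition eta0_pole (m : 'I_n) (b : nat) : sl2U_W z V :=
  tens (fU (pole z m b)) (pure (vstar V))
  - \sum_(1 <= l < b.+1)
      (tens (eU (pole z m l)) (at_pos (psi_f V (fin m) b l))
       + tens (hU (pole z m l)) (at_pos (star (f_ (b - l) (v (fin m)))))).

Definition eta0_monom (b : nat) : sl2U_W z V :=
  tens (fU (monom z b)) (pure (vstar V))
  - \sum_(0 <= l < b.-1)
      (tens (eU (monom z l)) (at_pos (psi_e V ord_max b l))
       + tens (hU (monom z l.+1)) (at_pos (star (e_ (b - l - 1) (v ord_max))))).

Definition eta0_elem (i : elem_index n) : sl2U_W z V :=
  match i with
  | inl mb => eta0_pole mb.1 mb.2.+1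
  | inr b => eta0_monom b
  end.

Lemma is_eta1E (eta1 : Omega1 z -> W V) :
  is_eta1 kappa eta1 <-> (forall i, eta1 (elem z i) = eta1_elem i).
Proof.
split=> [[ep em] [[m b]|b]|e]; [exact: ep|exact: em|split=> [b m|b]].
  exact: (e (inl (m, b))).
exact: (e (inr b)).
Qed.

(** For [b = 0] and [b = 1] the sums in the formula for [t^b] are empty. *)
Lemma is_eta0E (eta0 : Omega -> sl2U_W z V) :
  is_eta0 eta0 <-> (forall i, eta0 (elem z i) = eta0_elem i).
Proof.
split=> [[ep e0 e1 em] [[m b]|b]|e].
- exact: ep.
- case: b => [|[|b]]; last exact: em.
    by rewrite /= e0 /eta0_monom big_geq // subr0.
  by rewrite /= e1 /eta0_monom big_geq // subr0.
split=> [[|b] m // _|||[|[|b]] // _].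
- exact: (e (inl (m, b))).
- by rewrite (e (inr 0%N)) /= /eta0_monom big_geq // subr0.
- by rewrite (e (inr 1%N)) /= /eta0_monom big_geq // subr0.
exact: (e (inr b.+2)).
Qed.

(** ** Both sides on elementary functions *)

Definition pole_image (m : 'I_n) (b : nat) : W V :=
  (M (fin m) + b%:R * kappa) *: at_pos (star (f_ b (v (fin m))))
  + \sum_(i < n | i != m) ((z i - z m) ^- b * M (fin i)) *: at_pos (star (f_ 0 (v (fin i))))
  - \sum_(1 <= l < b.+1) (\sum_(i < n | i != m) (z i - z m) ^- l * M (fin i)) *:
       at_pos (star (f_ (b - l) (v (fin m)))).

Definition monom_image (b : nat) : W V :=
  (if b == 0%N then 0 else b%:R * kappa - M ord_max - 2%:R) *: at_pos (star (e_ b (v ord_max)))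
  + \sum_(i < n) (z i ^+ b * M (fin i)) *: at_pos (star (f_ 0 (v (fin i))))
  - \sum_(0 <= l < b.-1) (\sum_(i < n) z i ^+ l.+1 * M (fin i)) *:
       at_pos (star (e_ (b - l - 1) (v ord_max))).

Let chain_lin := chain_d_linear (z := z) two_neq0 hV hrho.
Let chainE := chain_d_tens (z := z) two_neq0 hV hrho.

Lemma chain_d_pole m b : (0 < b)%N -> chain_d rho (eta0_pole m b) = pole_image m b.
Proof.
move=> b0; rewrite /eta0_pole /pole_image (linear_mapB chain_lin) (linear_map_sum chain_lin).
rewrite chainE (act_f_pole hz two_neq0 hV hrho m b0) -[in RHS](linear_mapZ (@at_pos_linear _ _ _ _)).
rewrite -(finite_identity two_neq0 hV hrho (fin m) b) (linear_mapB (@at_pos_linear _ _ _ _)).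
rewrite (linear_map_sum (@at_pos_linear _ _ _ _)).
have -> : \sum_(1 <= l < b.+1) chain_d rho
     (tens (eU (pole z m l)) (at_pos (psi_f V (fin m) b l))
       + tens (hU (pole z m l)) (at_pos (star (f_ (b - l) (v (fin m)))))) =
  \sum_(1 <= l < b.+1) (at_pos (rho (loop (mx_e K) (- l%:Z)) (psi_f V (fin m) b l)
     + rho (loop (mx_h K) (- l%:Z)) (star (f_ (b - l) (v (fin m)))))
   + (\sum_(i < n | i != m) (z i - z m) ^- l * M (fin i)) *: at_pos (star (f_ (b - l) (v (fin m))))).
  apply: eq_big_nat => l /andP[l0 _]; rewrite (linear_mapD chain_lin) !chainE.
  rewrite (act_e_pole hz two_neq0 hV hrho) // (act_h_pole hz two_neq0 hV hrho) //.
  by rewrite (linear_mapD (@at_pos_linear _ _ _ _)) addrA.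
rewrite big_split /= opprD addrA; congr (_ - _).
by rewrite addrAC.
Qed.

Lemma chain_d_monom b : chain_d rho (eta0_monom b) = monom_image b.
Proof.
rewrite /eta0_monom /monom_image (linear_mapB chain_lin) (linear_map_sum chain_lin).
rewrite chainE (act_f_monom z two_neq0 hV hrho b).
have [->|b0] := posnP b.
  rewrite !big_geq // !subr0 scale0r add0r oppr0.
  rewrite (star_vac_e two_neq0 (hV _) (hrho _) 0) (linear_map0 (@at_pos_linear _ _ _ _)).
  exact: addr0.
rewrite -[in RHS](linear_mapZ (@at_pos_linear _ _ _ _)).
rewrite -(infinite_identity two_neq0 hV hrho ord_max b0) (linear_mapB (@at_pos_linear _ _ _ _)).
rewrite (linear_map_sum (@at_pos_linear _ _ _ _)).
have -> : \sum_(0 <= l < b.-1) chain_d rho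
   (tens (eU (monom z l)) (at_pos (psi_e V ord_max b l))
       + tens (hU (monom z l.+1)) (at_pos (star (e_ (b - l - 1) (v ord_max))))) =
  \sum_(0 <= l < b.-1) (at_pos (rho (loop (mx_f K) (- l%:Z)) (psi_e V ord_max b l)
     - rho (loop (mx_h K) (- l.+1%:Z)) (star (e_ (b - l - 1) (v ord_max))))
   + (\sum_(i < n) z i ^+ l.+1 * M (fin i)) *: at_pos (star (e_ (b - l - 1) (v ord_max)))).
  apply: eq_big_nat => l _; rewrite (linear_mapD chain_lin) !chainE.
  rewrite (act_e_monom z two_neq0 hV hrho) // (act_h_monom z two_neq0 hV hrho) //.
  by rewrite (linear_mapB (@at_pos_linear _ _ _ _)) addrA.
rewrite big_split /= opprD addrA; congr (_ - _).
by rewrite -addrA addrC.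
Qed.

Section Eta1.
Variable eta1 : Omega1 z -> W V.
Hypothesis lin1 : linear eta1.
Hypothesis he1 : forall i, eta1 (elem z i) = eta1_elem i.

Lemma eta1_pole m b : eta1 (pole z m b.+1) = - kappa *: at_pos (star (f_ b (v (fin m)))).
Proof. exact: (he1 (inl (m, b))). Qed.

Lemma eta1_monom b : eta1 (monom z b) = kappa *: at_pos (star (e_ b.+1 (v ord_max))).
Proof. exact: (he1 (inr b)). Qed.

Lemma eta1_dtilde_pole m b : eta1 (dtilde kappa (fun m => M (fin m)) (pole z m b)) = pole_image m b.
Proof.
rewrite /pole_image (dtilde_pole hz) (linear_mapB lin1) (linear_mapZ lin1) eta1_pole scalerA -addrA.
congr (_ *: _ + _); first by field.
under [X in _ = _ - X]eq_bigr => l _ do rewrite scaler_suml.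
rewrite exchange_big /= -sumrB (linear_map_sum lin1) -sumrN; apply: eq_bigr => i _.
rewrite (linear_mapZ lin1) (linear_mapB lin1) (linear_mapZ lin1) eta1_pole.
rewrite (linear_map_sum lin1) -scalerN opprB scalerBr addrC; congr (_ + _).
  by rewrite !scalerA -scaleNr; congr (_ *: _); move: (_ ^- b) => c; field.
rewrite scaler_sumr -sumrN; apply: eq_bigr => l _.
by rewrite (linear_mapZ lin1) eta1_pole !scalerA -scaleNr; congr (_ *: _); move: (_ ^- l) => c; field.
Qed.

(** The coefficient of the top term matches because [M^(n+1)] is the sum of
    the other [M^i] minus [2]. *)
Lemma eta1_dtilde_monom b : eta1 (dtilde kappa (fun m => M (fin m)) (monom z b)) = monom_image b.
Proof.
rewrite /monom_image dtilde_monom (linear_mapB lin1) (linear_mapZ lin1) eta1_monom (linear_map_sum lin1).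
have E i : eta1 ((kappa^-1 * M (fin i)) *: (z i ^+ b *: pole z i 1 +
      \sum_(0 <= s < b) z i ^+ s *: monom z (b - 1 - s))) =
   - ((z i ^+ b * M (fin i)) *: at_pos (star (f_ 0 (v (fin i)))))
   + \sum_(0 <= s < b) (z i ^+ s * M (fin i)) *: at_pos (star (e_ (b - s) (v ord_max))).
  rewrite (linear_mapZ lin1) (linear_mapD lin1) (linear_mapZ lin1) eta1_pole.
  rewrite (linear_map_sum lin1) scalerDr; congr (_ + _).
    by rewrite !scalerA -scaleNr; congr (_ *: _); field.
  rewrite scaler_sumr; apply: eq_big_nat => s /andP[_ sb].
  rewrite (linear_mapZ lin1) eta1_monom !scalerA (_ : (b - 1 - s).+1 = (b - s)%N); last by lia.
  by congr (_ *: _); field.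
under eq_bigr => i _ do rewrite E.
rewrite big_split /= sumrN opprD opprK exchange_big /=.
under [X in _ + (_ - X)]eq_bigr => s _ do rewrite -scaler_suml.
case: b {E} => [|b] /=; first by rewrite !big_geq // !scale0r addrA.
rewrite big_nat_recl // opprD [X in _ + X = _]addrCA !addrA.
congr (_ + _ - _); last first.
  by apply: eq_bigr => l _; rewrite subSS (_ : (b.+1 - l - 1 = b - l)%N) //; lia.
rewrite subn0 scalerA -scalerBl; congr (_ *: _).
rewrite hM; under eq_bigr => i _ do rewrite expr0 mul1r.
by ring.
Qed.

Lemma chain_d_eta (eta0 : Omega -> sl2U_W z V) : linear eta0 ->
  (forall i, eta0 (elem z i) = eta0_elem i) ->
  forall phi, chain_d rho (eta0 phi) = eta1 (dtilde kappa (fun m => M (fin m)) phi).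
Proof.
move=> lin0 he0; apply: (elem_ext hz).
- exact: linear_comp chain_lin lin0.
- exact: linear_comp lin1 (@dtilde_linear _ _ _ _ _).
case=> [[m b]|b]; rewrite he0 /=.
  by rewrite chain_d_pole // eta1_dtilde_pole.
by rewrite chain_d_monom eta1_dtilde_monom.
Qed.

End Eta1.

(** ** Linear forms detecting the image *)

Lemma star_vac_vac i : star (v i) (v i) = 1.
Proof.
have [P hP] := sym_map_exists (hV i) false two_neq0.
by rewrite (star_vac two_neq0 (hV i) _ hP) /lin0 (sym_map_vac hP) coef_mon.
Qed.

Lemma star_vac_one i s b : star (v i) (over_T (mxa K s) (b + s)%N (v i)) = 0.
Proof.
have [P hP] := sym_map_exists (hV i) s two_neq0.
rewrite (star_vac two_neq0 (hV i) _ hP) /lin0 over_T_a (sym_map_A hP) ?leq_addl //.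
exact: coef_nil_xmul.
Qed.

Lemma star_one_one i s b b' :
  star (over_T (mxa K s) (b + s)%N (v i)) (over_T (mxa K s) (b' + s)%N (v i)) = (b == b')%:R.
Proof.
have [P hP] := sym_map_exists (hV i) s two_neq0.
rewrite (star_one two_neq0 (hV i) _ _ hP) /lin1 over_T_a (sym_map_A hP) ?leq_addl //.
rewrite coef1_xmul eqn_add2r (sym_map_vac hP) coef_mon.
by case: eqP.
Qed.

(** Evaluation on a decomposable vector of the tensor product of the [V_i]. *)
Definition evalW (x : forall i, V i) : W V -> K^o :=
  ulift (fun w : Defs.family (dualV V) => \prod_i (w i (x i) : K) : K^o).

Lemma evalW_good (x : forall i, V i) :
  multilin (fun w : Defs.family (dualV V) => \prod_i (w i (x i) : K) : K^o).
Proof.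
exact: (eval_multilin (W := dualV V) (L := fun i (w : dualV V i) => w (x i))
  (fun i => form_linear (x i))).
Qed.

Lemma evalW_linear x : linear (evalW x).
Proof. exact: ulift_linear (evalW_good x). Qed.

Lemma evalW_pure x w : evalW x (pure w) = \prod_i (w i (x i) : K).
Proof. exact: (ulift_gen _ (evalW_good x)). Qed.

Definition vac_at i (x : V i) : forall j, V j := dfwith (fun j => v j) x.

Lemma evalW_vac : evalW (fun i => v i) (pure (vstar V)) = 1.
Proof. by rewrite evalW_pure big1 // => i _; apply: star_vac_vac. Qed.

Lemma evalW_same i (x : V i) (w : dualV V i) :
  evalW (vac_at x) (at_pos w) = w x.
Proof.
rewrite evalW_pure (bigD1 i) //= /vac_at !dfwith_in big1 ?mulr1 // => j ji.
by rewrite !dfwith_out 1?eq_sym //; apply: star_vac_vac.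
Qed.

Lemma evalW_other i j (x : V i) (w : dualV V j) : i != j -> star (v i) x = 0 ->
  evalW (vac_at x) (at_pos w) = 0.
Proof.
move=> ij x0; rewrite evalW_pure (bigD1 i) //= /vac_at dfwith_in dfwith_out 1?eq_sym //.
by rewrite -[LHS]/((star (v i) x : K) * _) x0 mul0r.
Qed.

(** Evaluation at the basis vector dual to the modified factor. *)
Definition detect1 (i : elem_index n) : W V -> K^o :=
  match i with
  | inl mb => evalW (vac_at (f_ mb.2 (v (fin mb.1))))
  | inr b => evalW (vac_at (e_ b.+1 (v ord_max)))
  end.

Lemma detect1P i j : detect1 i (eta1_elem j) =
  (if i is inl _ then - kappa else kappa) * (i == j)%:R.
Proof.
have f0 m b : star (v (fin m)) (f_ b (v (fin m))) = 0.
  by have := star_vac_one (fin m) false b; rewrite addn0.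
have e0 b : star (v ord_max) (e_ b.+1 (v ord_max)) = 0.
  by have := star_vac_one ord_max true b; rewrite addn1.
case: i => [[m b]|b]; case: j => [[m' b']|b'] /=; rewrite (linear_mapZ (@evalW_linear _)) regular_scaleE.
- have [<-|mm'] := eqVneq m m'.
    rewrite evalW_same; have := star_one_one (fin m) false b' b; rewrite !addn0 => ->.
    by congr (_ * _%:R); congr nat_of_bool; apply/eqP/eqP => [->|[]].
  rewrite evalW_other ?f0 ?(inj_eq (@fin_inj n)) //.
  by case: eqP => // -[mm _]; rewrite mm eqxx in mm'.
- by rewrite evalW_other ?f0 ?fin_max // !mulr0.
- by rewrite evalW_other ?e0 1?eq_sym ?fin_max // !mulr0.
rewrite evalW_same; have := star_one_one ord_max true b' b; rewrite !addn1 => ->.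
by congr (_ * _%:R); congr nat_of_bool; apply/eqP/eqP => [->|[]].
Qed.

Lemma eta1_injective (eta1 : Omega1 z -> W V) : linear eta1 ->
  (forall i, eta1 (elem z i) = eta1_elem i) -> injective eta1.
Proof.
move=> lin1 he1.
apply: (@elem_injective _ _ _ hz _ eta1 detect1 (fun i => if i is inl _ then - kappa else kappa)) => //.
- by case=> [mb|b]; apply: evalW_linear.
- by case=> [mb|b]; rewrite ?oppr_eq0.
by move=> i j; rewrite he1 detect1P.
Qed.

Fact f_entry_regular (A : sl2U z) : mx_of A 1 0 \in regular z.
Proof. by case: A => A /= /sl2_regularP[_]; apply. Qed.

Definition f_entry (A : sl2U z) : Omega := MkOmega0 (f_entry_regular A).

Lemma f_entry_linear : linear f_entry.
Proof. by move=> c A B; apply: val_inj; rewrite /= !mxE. Qed.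

Lemma f_entry_f g : f_entry (fU g) = g.
Proof. by apply: val_inj; rewrite /= !mxE /= scale1r. Qed.
Lemma f_entry_e g : f_entry (eU g) = 0.
Proof. by apply: val_inj; rewrite /= !mxE /= scale0r. Qed.
Lemma f_entry_h g : f_entry (hU g) = 0.
Proof. by apply: val_inj; rewrite /= !mxE /= subr0 scale0r. Qed.

(** Only the leading term of [eta0] has an [f]-component, and its function
    factor is the elementary function itself. *)
Definition detect0 (i : elem_index n) : sl2U_W z V -> K^o :=
  ulift (fun p : sl2U z * W V =>
    (elem_coef i (f_entry p.1) : K) * evalW (fun i => v i) p.2 : K^o).

Lemma detect0_good i : bilin (fun p : sl2U z * W V =>
    (elem_coef i (f_entry p.1) : K) * evalW (fun i => v i) p.2 : K^o).
Proof.
split=> [c A B u|c A u w] /=.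
  rewrite f_entry_linear elem_coef_linear.
  by rewrite -[LHS]/((c * (elem_coef i (f_entry A) : K) + elem_coef i (f_entry B)) * _) mulrDl -mulrA.
rewrite evalW_linear -[LHS]/((elem_coef i (f_entry A) : K) * (c * (_ : K) + _)).
by rewrite mulrDr mulrCA.
Qed.

Lemma detect0_linear i : linear (detect0 i).
Proof. exact: ulift_linear (detect0_good i). Qed.

Lemma detect0_tens i A u : detect0 i (tens A u) =
  (elem_coef i (f_entry A) : K) * evalW (fun i => v i) u.
Proof. exact: (ulift_gen _ (detect0_good i)). Qed.

Lemma detect0P i j : detect0 i (eta0_elem j) = (i == j)%:R.
Proof.
have e0 g u : detect0 i (tens (eU g) u) = 0.
  by rewrite detect0_tens f_entry_e (linear_map0 (elem_coef_linear i)) mul0r.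
have h0 g u : detect0 i (tens (hU g) u) = 0.
  by rewrite detect0_tens f_entry_h (linear_map0 (elem_coef_linear i)) mul0r.
have lin := detect0_linear i.
case: j => [[m b]|b] /=; rewrite (linear_mapB lin) (linear_map_sum lin) big1 ?subr0;
  try by move=> l _; rewrite (linear_mapD lin) e0 h0 addr0.
  by rewrite detect0_tens f_entry_f evalW_vac mulr1 -(elem_coef_elem hz i (inl (m, b))).
by rewrite detect0_tens f_entry_f evalW_vac mulr1 -(elem_coef_elem hz i (inr b)).
Qed.

Lemma eta0_injective (eta0 : Omega -> sl2U_W z V) : linear eta0 ->
  (forall i, eta0 (elem z i) = eta0_elem i) -> injective eta0.
Proof.
move=> lin0 he0.
apply: (@elem_injective _ _ _ hz _ eta0 detect0 (fun _ => 1)) => //.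
- exact: detect0_linear.
- by move=> _; apply: oner_neq0.
by move=> i j; rewrite he0 detect0P mul1r.
Qed.

End Main.

Theorem theorem5p10 (R : realType) (n : nat) (hn : (1 <= n)%N)
    (z : 'I_n -> R[i]) (hz : injective z)
    (M : 'I_n.+1 -> R[i]) (k : R[i]) (hk : k <> - 2%:R)
    (hM : M ord_max = \sum_(m < n) M (fin m) - 2%:R)
    (V : 'I_n.+1 -> affmod R[i])
    (hV : forall i, is_verma (M i) k (V i))
    (rho : forall i, affine R[i] -> cdual (V i) -> cdual (V i))
    (hrho : forall i, is_contragredient (rho i)) :
  let kappa := k + 2%:R in
  (exists (eta0 : {linear Omega0 z -> sl2U_W z V})
          (eta1 : {linear Omega1 z -> W V}),
     is_eta0 eta0 /\ is_eta1 kappa eta1) /\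
  (forall (eta0 : {linear Omega0 z -> sl2U_W z V})
          (eta1 : {linear Omega1 z -> W V}),
     is_eta0 eta0 -> is_eta1 kappa eta1 ->
     [/\ forall phi : Omega0 z,
           chain_d rho (eta0 phi) =
           eta1 (dtilde kappa (fun m => M (fin m)) phi),
         injective eta0
       & injective eta1]).
Proof.
move=> kappa.
have two_neq0 : 2%:R != 0 :> R[i] by rewrite pnatr_eq0.
have kappa_neq0 : k + 2%:R != 0 by rewrite addr_eq0; apply/eqP.
split.
  pose e0 := elem_map (z := z) (@eta0_elem _ _ z V).
  pose e1 := elem_map (z := z) (@eta1_elem _ _ k V).
  have lin0 : linear e0 by apply: (elem_map_linear hz).
  have lin1 : linear e1 by apply: (elem_map_linear hz).
  pose eta0 : {linear Omega0 z -> sl2U_W z V} :=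
    HB.pack e0 (GRing.isLinear.Build _ _ _ _ e0 lin0).
  pose eta1 : {linear Omega1 z -> W V} :=
    HB.pack e1 (GRing.isLinear.Build _ _ _ _ e1 lin1).
  exists eta0, eta1; split; [apply/is_eta0E|apply/is_eta1E] => i; exact: elem_map_elem.
move=> eta0 eta1 /is_eta0E he0 /is_eta1E he1.
have lin0 : linear eta0 by exact: linearP.
have lin1 : linear eta1 by exact: linearP.
split.
- exact: (chain_d_eta hz two_neq0 hM hV hrho kappa_neq0 lin1 he1 lin0 he0).
- exact: (eta0_injective hz two_neq0 hV lin0 he0).
- exact: (eta1_injective hz two_neq0 hV kappa_neq0 lin1 he1).
Qed.
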